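(* Let $\nu$ be a probability measure on the Borel sets of $\mathbb{R}$ and $p:\mathbb{R}\to(0,1)$ a measurable function with $\theta=\int_{\mathbb{R}}\frac{d\nu}{1-p}<\infty$. Let $(W_n)_{n\in\mathbb{Z}}$ be the stationary Markov chain with transition function $$Q(w;B)=p(w)\mathbf{1}_B(w)+[1-p(w)]\,\nu\{B\}$$ and marginal distribution $d\pi=\frac{d\nu}{\theta(1-p)}$. Let $g\in L^2(\pi)$ with $\int g\,d\pi=0$, $X_k=g(W_k)$, $S_n=X_1+\cdots+X_n$. Let $\tau_0<\tau_1<\tau_2<\cdots$ be the times just before the chain jumps (defined in the context), let $Y_j=(\tau_j-\tau_{j-1})X_{\tau_j}$ for $j\ge1$ (these are i.i.d.), and let $H(y)=\int_{\{|Y_1|\le y\}}Y_1^2\,dP$ for $y>0$. If $H$ varies slowly at $\infty$ and $\gamma_1,\gamma_2,\ldots$ are positive numbers with $\gamma_m\to\infty$ and $\gamma_m^2\sim mH(\gamma_m)$ as $m\to\infty$, then the conditional distribution of $S_n/\gamma_n$ given $W_0$ converges in probability, as $n\to\infty$, to the normal distribution with mean $0$ and variance $1/\theta$.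
   Context: Jump times: the chain is realized together with jump indicators $\xi_n\in\{0,1\}$, $n\ge1$, such that, conditionally on $\sigma(W_i,\,i\le n-1;\ \xi_i,\ 1\le i\le n-1)$, one has $\xi_n=0$ with probability $p(W_{n-1})$, in which case $W_n=W_{n-1}$, and $\xi_n=1$ with probability $1-p(W_{n-1})$, in which case $W_n$ is drawn from $\nu$. Then $\tau_0=\min\{n\ge0:\xi_{n+1}=1\}$ and $\tau_k=\min\{n>\tau_{k-1}:\xi_{n+1}=1\}$ for $k\ge1$. Thus $W_0=\cdots=W_{\tau_0}$, $W_{\tau_{k-1}+1}=\cdots=W_{\tau_k}$, and the vectors $(\tau_j-\tau_{j-1},W_{\tau_j})$, $j\ge1$, are i.i.d. and independent of $(\tau_0,W_0)$, with $W_{\tau_j}\sim\nu$ and $P[\tau_j-\tau_{j-1}\ge k\mid W_{\tau_j}=w]=p(w)^{k-1}$ for $k\ge1$. $H$ varies slowly at $\infty$ if $H(y)>0$ for large $y$ and $H(ay)/H(y)\to1$ as $y\to\infty$ for each $a>0$; $a_m\sim b_m$ means $a_m/b_m\to1$. For real random variables $Z_n$ and a distribution $G$ on $\mathbb{R}$, ''the conditional distribution of $Z_n$ given $W_0$ converges in probability to $G$'' means that $d(\mathcal{L}(Z_n\mid W_0),G)\to0$ in probability, where $\mathcal{L}(Z_n\mid W_0)$ is a regular conditional distribution and $d$ is a metric for weak convergence of probability measures on $\mathbb{R}$ (e.g. the Lévy metric). *)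

(* Defs.v *)
From HB Require Import structures.
From mathcomp Require Import all_boot all_order all_algebra.
From mathcomp Require Import all_classical all_reals all_analysis.
From mathcomp Require Import measurable_realfun.

Set Implicit Arguments.
Unset Strict Implicit.
Unset Printing Implicit Defensive.

Import Order.TTheory GRing.Theory Num.Theory.
Import numFieldNormedType.Exports.

Local Open Scope classical_set_scope.
Local Open Scope ring_scope.

(* [f] is a version of the conditional probability of the event [E] given the
   sub-sigma-algebra [G]. *)
Definition is_cond_prob d (T : measurableType d) (R : realType)
    (P : probability T R) (G : set (set T)) (E : set T) (f : T -> \bar R) :
    Prop :=
  (forall B : set (\bar R), measurable B -> G (f @^-1` B)) /\
  (forall A, G A -> P (A `&` E) = (\int[P]_(w in A) f w)%E).

Section Chain.
Context d (T : measurableType d) (R : realType) (P : probability T R).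
Implicit Types (W : int -> {RV P >-> R}) (xi : nat -> {RV P >-> bool}).

Definition transition (p : R -> R) (nu : probability R R) (w : R) (B : set R) :
    \bar R :=
  ((p w)%:E * (\1_B w)%:E + (1 - p w)%:E * nu B)%E.

Definition sigma_chain W (n : int) : set (set T) :=
  <<s [set W i @^-1` B | i in [set i : int | i <= n] & B in measurable] >>.

Definition sigma_chain_jumps W xi (n : nat) : set (set T) :=
  <<s [set W i @^-1` B | i in [set i : int | i <= n%:Z] & B in measurable] `|`
      [set xi i @^-1` B | i in [set i : nat | (1 <= i <= n)%N]
                        & B in measurable] >>.

Record stationary_markov_chain (Q : R -> set R -> \bar R) (mu : probability R R)
    W : Prop := {
  chain_stationary : forall (n : nat) (t : 'I_n -> int) (B : 'I_n -> set R)
      (k : int), (forall i, measurable (B i)) ->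
    P (\bigcap_i (W (t i + k) @^-1` B i)) = P (\bigcap_i (W (t i) @^-1` B i));
  chain_marginal : forall (n : int) (B : set R), measurable B ->
    distribution P (W n) B = mu B;
  chain_markov : forall (n : int) (B : set R), measurable B ->
    is_cond_prob P (sigma_chain W n) (W (n + 1) @^-1` B)
      (fun w => Q (W n w) B) }.

(* The indicator [xi n.+1] governs the step from [W n] to [W n.+1]: [true] is
   the value 1 (jump), [false] the value 0 (no jump). The value [xi 0] plays no
   role anywhere. *)
Record jump_indicators (p : R -> R) (nu : probability R R) W xi : Prop := {
  no_jump_prob : forall n : nat,
    is_cond_prob P (sigma_chain_jumps W xi n) (xi n.+1 @^-1` [set false])
      (fun w => (p (W n%:Z w))%:E);
  no_jump_stay : forall n : nat,
    {ae P, forall w, xi n.+1 w = false -> W n.+1%:Z w = W n%:Z w};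
  jump_draw : forall (n : nat) (B : set R), measurable B ->
    is_cond_prob P (sigma_chain_jumps W xi n)
      (xi n.+1 @^-1` [set true] `&` W n.+1%:Z @^-1` B)
      (fun w => ((1 - p (W n%:Z w))%:E * nu B)%E) }.

(* min {n >= m : xi_(n+1) = 1}, with the junk value 0 if there is no such n;
   this is a null event, since p < 1 is fixed between jumps. *)
Definition next_jump xi (m : nat) (w : T) : nat :=
  match pselect (exists n, (m <= n)%N && xi n.+1 w) with
  | left ex => ex_minn ex
  | right _ => 0%N
  end.

Fixpoint jump_time xi (k : nat) (w : T) : nat :=
  match k with
  | 0%N => next_jump xi 0 w
  | k'.+1 => next_jump xi (jump_time xi k' w).+1 w
  end.

(* Meaningful for j >= 1 only. *)
Definition block W xi (g : R -> R) (j : nat) (w : T) : R :=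
  ((jump_time xi j w)%:R - (jump_time xi j.-1 w)%:R) *
  g (W (jump_time xi j w)%:Z w).

Definition partial_sum W (g : R -> R) (n : nat) (w : T) : R :=
  \sum_(1 <= k < n.+1) g (W k%:Z w).

Definition truncated_second_moment (Y : T -> R) (y : R) : R :=
  \int[P]_(w in [set w | `|Y w| <= y]) (Y w ^+ 2).

End Chain.

Definition slowly_varying (R : realType) (H : R -> R) : Prop :=
  (\forall y \near +oo, 0 < H y) /\
  (forall a : R, 0 < a -> H (a * y) / H y @[y --> +oo] --> (1 : R)).

Definition asymp_equiv (R : realType) (a b : nat -> R) : Prop :=
  a m / b m @[m --> \oo] --> (1 : R).

Definition levy_dist (R : realType) (mu nu : set R -> \bar R) : R :=
  inf [set e : R | 0 < e /\ forall x : R,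
    (mu `]-oo, (x - e)%R]%classic - e%:E <= nu `]-oo, x]%classic /\
     nu `]-oo, x]%classic <= mu `]-oo, (x + e)%R]%classic + e%:E)%E].

Section ConditionalDistribution.
Context d (T : measurableType d) (R : realType) (P : probability T R).

(* [kappa (X w)] is a regular conditional distribution of [Z] given [X]. *)
Definition is_regular_cond_dist (X Z : T -> R) (kappa : R.-pker R ~> R) :
    Prop :=
  forall A B : set R, measurable A -> measurable B ->
    P (X @^-1` A `&` Z @^-1` B) = (\int[P]_(w in X @^-1` A) kappa (X w) B)%E.

(* Regular conditional distributions are unique up to null events, so the
   choice of the versions [kappa n] is immaterial. *)
Definition cond_dist_cvg_in_prob (X : T -> R) (Z : nat -> T -> R)
    (G : set R -> \bar R) : Prop :=
  forall kappa : nat -> R.-pker R ~> R,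
    (forall n, (0 < n)%N -> is_regular_cond_dist X (Z n) (kappa n)) ->
    forall e : R, 0 < e ->
      P [set w | e <= levy_dist (kappa n (X w)) G] @[n --> \oo] --> 0%E.

End ConditionalDistribution.

(* Main.v *)
Require Import Defs.
From HB Require Import structures.
From mathcomp Require Import all_boot all_order all_algebra.
From mathcomp Require Import all_classical all_reals all_analysis.
From mathcomp Require Import measurable_realfun.
From mathcomp Require Import ring lra zify.

(** The times just before the jumps cut the chain into i.i.d. blocks: with respect to
    the past of the jump times, the block sums Y_j are independent of the past, and
    E Y_1 = 0, E (tau_1 - tau_0) = theta. Slow variation of H gives
    m E [|Y_1|/gamma_m ; |Y_1| > gamma_m] -> 0, so Lindeberg's replacement argument
    (swap the Y_j one at a time with normal increments under a smooth test function)
    yields normality of V_m / gamma_n for V_m = Y_1 + ... + Y_m, m = [n / theta], with an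
    error that is uniform over the conditioning events {W_0 \in A}. The same second-order
    expansion, applied to sums stopped at their first large value, gives a maximal
    inequality; it provides the weak law tau_k / k -> theta, and the bound on the
    fluctuation of V_k for k near m that allows S_n to be replaced by V_m. Finally a
    conditional distribution function that deviates from the normal one on an event
    {W_0 \in A} of positive probability contradicts the limit on that event; a finite
    grid then controls the Levy distance. *)

Set Implicit Arguments.
Unset Strict Implicit.
Unset Printing Implicit Defensive.

Import Order.TTheory GRing.Theory Num.Theory.
Import numFieldNormedType.Exports.

Local Open Scope classical_set_scope.
Local Open Scope ring_scope.

(** [Y_1] may have infinite variance. The truncated moment [H(gamma_n)] takes its place, and every
    estimate uses bounded test functions whose Taylor error is linear in the increment above the
    truncation level and cubic below it. All errors then reduce to one quantity, [tail_mass], which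
    is [o(1/n)] at level [gamma_n]. For the gaps, whose first moment alone is at hand, the same
    quantity at level [n] is handled by dominated convergence. The class of test functions is
    described by inequalities with one constant [C] and is stable under averaging, so a swap costs
    the same at every stage. The conditioning event travels through the swaps as part of the past.
    Scaling is by [gamma_n] throughout while about [n / theta] blocks are summed, so the variance
    [1 / theta] comes from the number of summands alone. The obstacle in the chain is that [tau_j]
    looks one step ahead and is not a stopping time of the natural filtration; its past is therefore
    encoded by agreement with known events on each [{tau_j = n}]. *)

Section step.
Context d (T : measurableType d) (R : realType) (P : probability T R).
Implicit Types (X h : T -> R).

(** * Integrability and truncated moments on a probability space *)

Lemma bounded_integrable X (C : R) :
  measurable_fun setT X -> (forall w, `|X w| <= C) ->
  P.-integrable setT (EFin \o X).
Proof.
move=> mX XC; apply: measurable_bounded_integrable => //.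
  exact: fin_num_fun_lty.
exists C; split; rewrite ?num_real// => M CM w _.
exact: (le_trans (XC w) (ltW CM)).
Qed.

Lemma cst_integrable (c : R) : P.-integrable setT (EFin \o (fun=> c)).
Proof. exact: (@bounded_integrable _ `|c|). Qed.

Lemma Rintegral_prob_cst (c : R) : \int[P]_w c = c.
Proof. by rewrite /Rintegral integral_cst// [X in (_ * X)%E]probability_setT mule1. Qed.

Lemma integrable_scale X (c : R) : P.-integrable setT (EFin \o X) ->
  P.-integrable setT (EFin \o (fun w => c * X w)).
Proof.
move=> iX; rewrite (_ : _ \o _ = (fun w => c%:E * (EFin \o X) w)%E).
  exact: integrableZl.
by apply/funext => w; rewrite /= EFinM.
Qed.

Lemma integrable_add X h : P.-integrable setT (EFin \o X) ->
  P.-integrable setT (EFin \o h) ->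
  P.-integrable setT (EFin \o (fun w => X w + h w)).
Proof.
move=> iX ih; rewrite (_ : _ \o _ = ((EFin \o X) \+ (EFin \o h))%E).
  exact: integrableD.
by apply/funext => w; rewrite /= EFinD.
Qed.

Lemma integrable_sub X h : P.-integrable setT (EFin \o X) ->
  P.-integrable setT (EFin \o h) ->
  P.-integrable setT (EFin \o (fun w => X w - h w)).
Proof.
move=> iX ih; rewrite (_ : _ \o _ = ((EFin \o X) \- (EFin \o h))%E).
  exact: integrableB.
by apply/funext => w; rewrite /= EFinB.
Qed.

Lemma trunc_integrable X (s : R) : measurable_fun setT X ->
  P.-integrable setT (EFin \o (fun w => if `|X w| <= s then X w ^+ 2 else 0)).
Proof.
move=> mX; apply: (@bounded_integrable _ (s ^+ 2)).
  apply: measurable_fun_ifT => //.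
    by apply: measurable_fun_ler => //; exact: measurableT_comp.
  exact: measurable_funX.
move=> w; case: ifPn => Xs; last by rewrite normr0 sqr_ge0.
rewrite normrX lerXn2r// nnegrE//.
exact: le_trans Xs.
Qed.

Lemma truncated_second_momentE X (s : R) : measurable_fun setT X ->
  truncated_second_moment P X s =
  \int[P]_w (if `|X w| <= s then X w ^+ 2 else 0).
Proof.
move=> mX; rewrite /truncated_second_moment Rintegral_mkcond.
apply: eq_Rintegral => w _; rewrite patchE.
case: ifPn; first by rewrite inE /= => ->.
by move/negP; rewrite inE /= => /negP/negbTE ->.
Qed.

End step.

(** Smoothness enters only through inequalities with a single constant: [h1] and [h2] are tied to
    [h] by the remainder bound, not by differentiation. The class can thus be integrated without
    differentiating under the integral sign. *)
Record taylor2 (R : realType) (C : R) (h h1 h2 : R -> R) : Prop := {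
  taylor2_mfun : measurable_fun setT h;
  taylor2_mfun1 : measurable_fun setT h1;
  taylor2_mfun2 : measurable_fun setT h2;
  taylor2_bound : forall x, `|h x| <= C;
  taylor2_bound1 : forall x, `|h1 x| <= C;
  taylor2_bound2 : forall x, `|h2 x| <= C;
  taylor2_rem : forall x y,
    `|h (x + y) - h x - h1 x * y - h2 x / 2 * y ^+ 2| <= C * `|y| ^+ 3 }.

(** * One-step Taylor expansion with a truncated second moment *)

Section step_taylor.
Context d (T : measurableType d) (R : realType) (P : probability T R).
Variables (X : T -> R) (mX : measurable_fun setT X).
Hypothesis iX : P.-integrable setT (EFin \o X).
Implicit Types (s C x : R).

Definition tail_weight s w : R :=
  if s < `|X w| then `|X w| / s else (`|X w| / s) ^+ 3.

Definition tail_mass s : R := \int[P]_w tail_weight s w.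

Lemma measurable_tail_weight s : measurable_fun setT (tail_weight s).
Proof.
have mN : measurable_fun setT (fun w => `|X w|) by exact: measurableT_comp.
apply: measurable_fun_ifT.
- exact: measurable_fun_ltr.
- exact: measurable_funM.
- by apply: measurable_funX; exact: measurable_funM.
Qed.

Lemma tail_weight_ge0 s w : 0 < s -> 0 <= tail_weight s w.
Proof.
move=> s0; rewrite /tail_weight; case: ifP => _; first by rewrite divr_ge0// ltW.
by rewrite exprn_ge0// divr_ge0// ltW.
Qed.

Lemma tail_weight_integrable s : 0 < s ->
  P.-integrable setT (EFin \o tail_weight s).
Proof.
move=> s0.
have iXs : P.-integrable setT (EFin \o (fun w => `|X w| / s)).
  under eq_fun do rewrite mulrC.
  by apply: integrable_scale; exact: integrable_norm.
apply: (le_integrable _ _ _ iXs) => //.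
  exact/measurable_EFinP/measurable_tail_weight.
move=> w _; rewrite /= lee_fin ger0_norm ?tail_weight_ge0//.
rewrite [leRHS]ger0_norm; last by rewrite divr_ge0// ltW.
rewrite /tail_weight; case: ltP => // Xs.
have X1 : 0 <= `|X w| / s <= 1.
  by rewrite divr_ge0 ?(ltW s0)//= ler_pdivrMr// mul1r.
set u := `|X w| / s in X1 *; nra.
Qed.

Lemma tail_mass_ge0 s : 0 < s -> 0 <= tail_mass s.
Proof. by move=> s0; apply: Rintegral_ge0 => w _; exact: tail_weight_ge0. Qed.

Hypothesis X0 : \int[P]_w X w = 0.

(** The linear term vanishes because [X] is centred; the quadratic term is kept only on [|X| <= s],
    where its mean is finite; what remains is bounded pointwise by [tail_weight]. *)
Lemma step_taylor C h h1 h2 s x : 0 < s -> taylor2 C h h1 h2 ->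
  `|\int[P]_w h (x + X w / s) - h x
    - h2 x / 2 * (truncated_second_moment P X s / s ^+ 2)|
  <= 3 * C * tail_mass s.
Proof.
move=> s0 [mh mh1 mh2 hC h1C h2C hrem].
have C0 : 0 <= C by exact: le_trans (normr_ge0 _) (hC 0).
have mhX : measurable_fun setT (fun w => h (x + X w / s)).
  apply: (measurableT_comp mh); apply: measurable_funD => //.
  exact: measurable_funM.
pose t w := if `|X w| <= s then X w ^+ 2 else 0.
have it : P.-integrable setT (EFin \o t) by exact: trunc_integrable.
have ih : P.-integrable setT (EFin \o (fun w => h (x + X w / s))).
  exact: (@bounded_integrable _ _ _ _ _ C).
pose c1 := h1 x / s; pose c2 := h2 x / 2 / s ^+ 2.
pose D w := h (x + X w / s) - h x - c1 * X w - c2 * t w.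
have iD : P.-integrable setT (EFin \o D) by do !apply: integrable_sub => //; try exact: integrable_scale; exact: cst_integrable.
have -> : \int[P]_w h (x + X w / s) - h x
    - h2 x / 2 * (truncated_second_moment P X s / s ^+ 2) = \int[P]_w D w.
  have ix := cst_integrable P (h x).
  have ic1 := integrable_scale c1 iX.
  have ic2 := integrable_scale c2 it.
  have ihB := integrable_sub ih ix; have ihB1 := integrable_sub ihB ic1.
  rewrite /D RintegralB// RintegralB// RintegralB// Rintegral_prob_cst.
  rewrite RintegralZl// X0 mulr0 subr0 RintegralZl//.
  by rewrite truncated_second_momentE// /c2 -!mulrA (mulrC (s ^- 2)).
apply: (le_trans (le_normr_Rintegral _ iD)) => //.
rewrite -RintegralZl//; last exact: tail_weight_integrable.
apply: le_Rintegral => //.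
- exact: (integrable_norm iD).
- exact/integrable_scale/tail_weight_integrable.
move=> w _.
have cX : c1 * X w = h1 x * (X w / s) by rewrite /c1 mulrAC mulrA.
(* Above [s], two values of [h] cost [2 C] and the linear term [C |X| / s]; since [|X| / s > 1] the
   sum is at most [3 C |X| / s]. Below [s] the Taylor remainder applies. *)
rewrite /D /tail_weight /t cX [`|X w| <= s]leNgt; have [Xs|Xs] := ltP s `|X w|.
- rewrite /= mulr0 subr0.
  have u1 : 1 <= `|X w| / s by rewrite ler_pdivlMr// mul1r ltW.
  have uE : `|X w / s| = `|X w| / s by rewrite normrM normfV (gtr0_norm s0).
  apply: (le_trans (ler_normB _ _)).
  apply: (@le_trans _ _ (C + C + C * (`|X w| / s))); last by nra.
  apply: lerD; first by apply: (le_trans (ler_normB _ _)); exact: lerD.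
  by rewrite normrM uE ler_wpM2r// divr_ge0// ltW.
- rewrite /=; have -> : c2 * X w ^+ 2 = h2 x / 2 * (X w / s) ^+ 2.
    rewrite /c2 expr_div_n; ring.
  apply: (le_trans (hrem _ _)).
  have -> : `|X w / s| = `|X w| / s by rewrite normrM normfV (gtr0_norm s0).
  rewrite ler_wpM2r ?exprn_ge0 ?divr_ge0 ?(ltW s0)//.
  by rewrite ler_peMl// ler1n.
Qed.

(** The drift of a test function along a centred step is of second order; summed over the steps,
    this bound drives the maximal inequality. *)
Lemma step_bound C h h1 h2 s x : 0 < s -> taylor2 C h h1 h2 ->
  `|\int[P]_w h (x + X w / s) - h x| <=
  C * (3 * tail_mass s + truncated_second_moment P X s / s ^+ 2).
Proof.
move=> s0 hh; have := step_taylor x s0 hh; set H := _ / s ^+ 2.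
set k := \int[P]_w _ - h x => kH.
have H0 : 0 <= H.
  rewrite divr_ge0 ?sqr_ge0//; apply: Rintegral_ge0 => w _; exact: sqr_ge0.
have h2C : `|h2 x / 2 * H| <= C * H.
  rewrite normrM (ger0_norm H0) ler_wpM2r// normrM normfV (@ger0_norm _ 2)//.
  have := taylor2_bound2 hh x; have := normr_ge0 (h2 x); lra.
rewrite -(subrK (h2 x / 2 * H) k); apply: (le_trans (ler_normD _ _)).
rewrite mulrDr; apply: lerD => //.
by rewrite mulrA [C * 3]mulrC.
Qed.

End step_taylor.

(** * Functions measurable for a sub-sigma-algebra *)

Section sub_sigma_algebra.
Context d (T : measurableType d).
Implicit Type G : set (set T).

Definition sub_measurable d' (T' : measurableType d') G (f : T -> T') :=
  forall B, measurable B -> G (f @^-1` B).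

(** Sub-sigma-algebras are families of subsets of one type, so that a filtration is ordered by
    inclusion; this bridge to the generated structure imports the usual closure properties. *)
Lemma sub_measurableP d' (T' : measurableType d') G (f : T -> T') :
  sigma_algebra setT G ->
  sub_measurable G f <-> measurable_fun setT (f : g_sigma_algebraType G -> T').
Proof.
move=> sG; split=> [mf _ B mB|mf B mB].
  by rewrite setTI; apply: sub_gen_smallest; exact: mf.
have := mf measurableT B mB; rewrite setTI.
by rewrite /measurable /= sigma_algebra_id.
Qed.

Lemma sub_measurable_comp d1 (T1 : measurableType d1) d2
    (T2 : measurableType d2) G (f : T -> T1) (h : T1 -> T2) :
  measurable_fun setT h -> sub_measurable G f -> sub_measurable G (h \o f).
Proof.
move=> mh mf B mB; rewrite comp_preimage; apply: mf.
by rewrite -[X in measurable X]setTI; exact: mh.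
Qed.

Lemma sub_measurable_pair d1 (T1 : measurableType d1) d2
    (T2 : measurableType d2) G (f : T -> T1) (g : T -> T2) :
  sigma_algebra setT G -> sub_measurable G f -> sub_measurable G g ->
  sub_measurable G (fun w => (f w, g w)).
Proof.
move=> sG /(sub_measurableP _ sG) mf /(sub_measurableP _ sG) mg.
by apply/(sub_measurableP _ sG); exact: measurable_fun_pair.
Qed.

Lemma sub_measurable_cst d' (T' : measurableType d') G (c : T') :
  sigma_algebra setT G -> sub_measurable G (fun=> c).
Proof. by move=> sG; apply/(sub_measurableP _ sG); exact: measurable_cst. Qed.

Lemma sub_measurable_mem G A : sigma_algebra setT G -> G A ->
  sub_measurable G (fun w => w \in A).
Proof.
move=> sG GA; apply/(sub_measurableP _ sG).
apply: (measurable_fun_bool true); rewrite setTI.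
have -> : (fun w => w \in A) @^-1` [set true] = A.
  by apply/seteqP; split=> w /=; [move/set_mem|move/mem_set].
exact: sub_gen_smallest.
Qed.

Lemma sub_measurableW d' (T' : measurableType d') G (f : T -> T') :
  (forall A, G A -> measurable A) -> sub_measurable G f ->
  measurable_fun setT f.
Proof. by move=> GT mf _ B mB; rewrite setTI; apply/GT/mf. Qed.

End sub_sigma_algebra.

Lemma measurable_set_ge d (T : measurableType d) (R : realType) (f : T -> R)
    (c : R) : measurable_fun setT f -> measurable [set w | c <= f w].
Proof.
move=> mf; rewrite (_ : mkset _ = setT `&` f @^-1` `[c, +oo[%classic).
  exact: mf.
by apply/seteqP; split=> w /=; rewrite in_itv/= andbT => // -[].
Qed.

(** [X] represents the common law. Independence is required from the whole past [G j], not merely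
    from the earlier [Y], so that an event of [G 0] can be carried along in the replacement
    argument. *)
Record iid_adapted d (T : measurableType d) (R : realType) (P : probability T R)
    (G : nat -> set (set T)) (X : T -> R) (Y : nat -> T -> R) : Prop := {
  iid_sigma : forall j, sigma_algebra setT (G j);
  iid_measurable : forall j A, G j A -> measurable A;
  iid_mono : forall j, G j `<=` G j.+1;
  iid_law_measurable : measurable_fun setT X;
  iid_adapt : forall j, sub_measurable (G j.+1) (Y j);
  iid_indep : forall j A B, G j A -> measurable B ->
    P (A `&` Y j @^-1` B) = (P A * P (X @^-1` B))%E }.

(** * Integration over an increment independent of the past *)

Section independence.
Context d (T : measurableType d) (R : realType) (P : probability T R).

(** The joint law of [(U, Y)] agrees with a product law on rectangles, hence everywhere, and
    Tonelli's theorem applies. *)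
Lemma ge0_integral_indep d1 (T1 : measurableType d1) d2 (T2 : measurableType d2)
    (U : T -> T1) (Y X : T -> T2) (F : T1 * T2 -> \bar R) :
  measurable_fun setT U -> measurable_fun setT Y -> measurable_fun setT X ->
  (forall A B, measurable A -> measurable B ->
    P (U @^-1` A `&` Y @^-1` B) = P (U @^-1` A) * P (X @^-1` B))%E ->
  measurable_fun setT F -> (forall z, 0 <= F z)%E ->
  (\int[P]_w F (U w, Y w) = \int[P]_w \int[P]_w' F (U w, X w'))%E.
Proof.
move=> mU mY mX indep mF F0.
have mUY : measurable_fun setT (fun w => (U w, Y w)).
  exact: measurable_fun_pair.
pose U' : {mfun T >-> T1} := mfun_Sub (mem_set mU).
pose X' : {mfun T >-> T2} := mfun_Sub (mem_set mX).
pose UY' : {mfun T >-> (T1 * T2)%type} := mfun_Sub (mem_set mUY).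
have -> : (\int[P]_w F (U w, Y w) = \int[distribution P UY']_z F z)%E.
  by rewrite ge0_integral_distribution.
have prodE Z : measurable Z ->
    (distribution P U' \x distribution P X')%E Z = distribution P UY' Z.
  apply: product_measure_unique => A B mA mB.
  by rewrite /distribution /pushforward /= -indep.
rewrite (eq_measure_integral (distribution P U' \x distribution P X')%E);
  last by move=> Z mZ _; exact/esym/prodE.
rewrite fubini_tonelli1// /fubini_F ge0_integral_distribution//=; first last.
- by move=> x; exact: integral_ge0.
- exact: measurable_fun_fubini_tonelli_F.
apply: eq_integral => w _; rewrite /= ge0_integral_distribution//.
exact: measurableT_comp.
Qed.

Lemma inner_integral_integrable d' (T' : measurableType d') (U : T -> T')
    (X : T -> R) (F : T' * R -> R) (C : R) :
  measurable_fun setT U -> measurable_fun setT X -> measurable_fun setT F ->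
  (forall z, `|F z| <= C) ->
  P.-integrable setT (EFin \o (fun w => \int[P]_w' F (U w, X w'))).
Proof.
move=> mU mX mF FC.
(* Adding [C] makes the integrand nonnegative, so that Tonelli's theorem gives measurability of the
   inner integral. *)
have mFC : measurable_fun setT (fun z => F z + C) by exact: measurable_funD.
have F0 z : 0 <= F z + C by have := FC z; rewrite ler_norml; lra.
have iFX u : P.-integrable setT (EFin \o (fun w => F (u, X w))).
  apply: (@bounded_integrable _ _ _ _ _ C) => //.
  by apply: (measurableT_comp mF); exact: measurable_fun_pair.
have E u : \int[P]_w' F (u, X w') = \int[P]_w' (F (u, X w') + C) - C.
  rewrite RintegralD//; last exact: cst_integrable.
  by rewrite Rintegral_prob_cst addrK.
apply: (@bounded_integrable _ _ _ _ _ C) => [|w].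
  under eq_fun do rewrite E.
  apply: measurable_funB => //; apply: (measurableT_comp (f := fine)) => //.
  pose F' (z : T' * T) := (F (z.1, X z.2) + C)%:E.
  have := @measurable_fun_fubini_tonelli_F _ _ _ _ _ P F'.
  move=> /(_ _ _)/measurableT_comp; apply => //.
  - apply/measurable_EFinP/(measurableT_comp mFC)/measurable_fun_pair => //.
    exact: measurableT_comp.
  - by move=> z; rewrite lee_fin.
apply: (le_trans (le_normr_Rintegral _ (iFX _))) => //.
rewrite -[leRHS](Rintegral_prob_cst P); apply: le_Rintegral => //.
- exact: (integrable_norm (iFX _)).
- exact: cst_integrable.
Qed.

Variables (G : nat -> set (set T)) (X : T -> R) (Y : nat -> T -> R).
Hypothesis iidY : iid_adapted P G X Y.

Lemma iid_mfun j : measurable_fun setT (Y j).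
Proof.
exact: sub_measurableW (iid_measurable iidY (j := j.+1)) (iid_adapt iidY j).
Qed.

Lemma iid_integral j d1 (T1 : measurableType d1) (U : T -> T1)
    (F : T1 * R -> R) (C : R) :
  sub_measurable (G j) U -> measurable_fun setT F -> (forall z, `|F z| <= C) ->
  \int[P]_w F (U w, Y j w) = \int[P]_w (\int[P]_w' F (U w, X w')).
Proof.
move=> mU mF FC.
have mU' := sub_measurableW (iid_measurable iidY (j := j)) mU.
have mX := iid_law_measurable iidY; have mY := iid_mfun j.
have F0 z : 0 <= F z + C by have := FC z; rewrite ler_norml; lra.
have iF (g : T -> T1 * R) : measurable_fun setT g ->
    P.-integrable setT (EFin \o (fun w => F (g w))).
  by move=> mg; apply: (@bounded_integrable _ _ _ _ _ C) => //; exact: measurableT_comp.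
have iFY : P.-integrable setT (EFin \o (fun w => F (U w, Y j w))).
  exact/iF/measurable_fun_pair.
have iFX u : P.-integrable setT (EFin \o (fun w => F (u, X w))).
  by apply/iF/measurable_fun_pair => //; exact: measurable_cst.
have E u : \int[P]_w' (F (u, X w') + C) = \int[P]_w' F (u, X w') + C.
  by rewrite RintegralD//; [rewrite Rintegral_prob_cst|exact: cst_integrable].
have iI := inner_integral_integrable mU' mX mF FC.
apply: (addIr C).
rewrite -[in LHS](Rintegral_prob_cst P C) -RintegralD//; last exact: cst_integrable.
rewrite -[X in _ = _ + X](Rintegral_prob_cst P C) -RintegralD//; last exact: cst_integrable.
transitivity (\int[P]_w (\int[P]_w' (F (U w, X w') + C))); last first.
  by apply: eq_Rintegral => w _; rewrite E.
rewrite /Rintegral; congr fine.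
rewrite (@ge0_integral_indep _ _ _ _ U (Y j) X (fun z => (F z + C)%:E))//.
- apply: eq_integral => w _; rewrite fineK//.
  apply: integrable_fin_num => //.
  rewrite (_ : (fun=> _) = EFin \o (fun w' => F (U w, X w') + C))//.
  by apply: integrable_add => //; exact: cst_integrable.
- by move=> A B mA mB; rewrite (iid_indep iidY) => //; exact: mU.
- by apply/measurable_EFinP; exact: measurable_funD.
Qed.

End independence.

Section iid_transfer.
Context d (T : measurableType d) (R : realType) (P : probability T R).
Variables (G : nat -> set (set T)) (X : T -> R) (Y : nat -> T -> R).
Hypothesis iidY : iid_adapted P G X Y.

Lemma iid_shift a :
  iid_adapted P (fun j => G (a + j)) X (fun j => Y (a + j)).
Proof.
case: iidY => sG mG GG mX aY indep; split => // j.
- exact: mG.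
- by rewrite addnS; exact: GG.
- by rewrite addnS; exact: aY.
- exact: indep.
Qed.

Lemma iid_filtration i j : (i <= j)%N -> G i `<=` G j.
Proof.
move=> /subnK <-; elim: (j - i)%N => // k IH A /IH GA.
by rewrite addSn; exact: (iid_mono iidY).
Qed.

Lemma iid_partial_sum k : sub_measurable (G k) (fun w => \sum_(i < k) Y i w).
Proof.
have sG := iid_sigma iidY.
elim: k => [|k IH].
  under eq_fun do rewrite big_ord0; exact: sub_measurable_cst.
under eq_fun do rewrite big_ord_recr/=.
apply: (@sub_measurable_comp _ _ _ _ _ _ _
    (fun w => (\sum_(i < k) Y i w, Y k w)) (fun z : R * R => z.1 + z.2)).
  exact: measurable_funD.
apply: sub_measurable_pair => //; last exact: (iid_adapt iidY).
by move=> B mB; apply: (iid_mono iidY); exact: IH.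
Qed.

End iid_transfer.

(** * Maximal inequality for partial sums *)

Section maximal_inequality.
Context d (T : measurableType d) (R : realType) (P : probability T R).
Variables (G : nat -> set (set T)) (X : T -> R) (Y : nat -> T -> R).
Hypothesis iidY : iid_adapted P G X Y.
Hypothesis iX : P.-integrable setT (EFin \o X).
Hypothesis X0 : \int[P]_w X w = 0.
Variables (e s : R).
Hypotheses (e0 : 0 < e) (s0 : 0 < s).

(** The normalized sum is frozen at its first value of size at least [e], so a large maximum over
    [k <= K] stays visible in the final value and one Markov inequality suffices. *)
Fixpoint stopped_sum k (w : T) : R :=
  if k is k'.+1 then
    let z := stopped_sum k' w in if `|z| < e then z + Y k' w / s else z
  else 0.

Let step (z : R * R) : R := if `|z.1| < e then z.1 + z.2 / s else z.1.

Let mstep : measurable_fun setT step.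
Proof.
have mfst : measurable_fun setT (@fst R R) by exact: measurable_fst.
apply: measurable_fun_ifT => //.
  by apply: measurable_fun_ltr => //; exact: measurableT_comp.
by apply: measurable_funD => //; exact: measurable_funM.
Qed.

Lemma sub_measurable_stopped_sum k : sub_measurable (G k) (stopped_sum k).
Proof.
have sG := iid_sigma iidY.
elim: k => [|k IH]; first exact: sub_measurable_cst.
apply: (sub_measurable_comp (f := fun w => (stopped_sum k w, Y k w)) mstep).
apply: sub_measurable_pair => //; last exact: (iid_adapt iidY).
by move=> B mB; apply: (iid_mono iidY); exact: IH.
Qed.

Lemma stopped_sum_eq K w : (forall k, (k < K)%N -> `|\sum_(i < k) Y i w| < e * s) ->
  stopped_sum K w = (\sum_(i < K) Y i w) / s.
Proof.
elim: K => [|K IH] small; first by rewrite big_ord0 mul0r.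
rewrite /= IH; last by move=> k kK; apply: small; exact: ltnW.
rewrite normrM normfV (gtr0_norm s0) ltr_pdivrMr// small//.
by rewrite big_ord_recr/= mulrDl.
Qed.

Lemma stopped_sum_ge K k w : (k <= K)%N -> e * s <= `|\sum_(i < k) Y i w| ->
  e <= `|stopped_sum K w|.
Proof.
move=> kK ge_k.
pose p j := e * s <= `|\sum_(i < j) Y i w|.
have exp : exists j, p j by exists k.
case: (ex_minnP exp) => j pj minj.
have ej : e <= `|stopped_sum j w|.
  rewrite stopped_sum_eq; last first.
    by move=> i ij; rewrite ltNge; apply/negP => /minj; rewrite leqNgt ij.
  by rewrite normrM normfV (gtr0_norm s0) ler_pdivlMr.
have /subnK <- : (j <= K)%N by exact: leq_trans (minj _ ge_k) kK.
by elim: (K - j)%N => // n IH; rewrite addSn /= ltNge IH.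
Qed.

Lemma measurable_max_partial_sum K : measurable
  [set w | exists2 k, (k <= K)%N & e * s <= `|\sum_(i < k) Y i w|].
Proof.
rewrite (_ : mkset _ = \bigcup_(k in [set k | (k <= K)%N])
    [set w | e * s <= `|\sum_(i < k) Y i w|]); last first.
  by apply/seteqP; split=> w /= [k kK ek]; exists k.
apply: bigcup_measurable => k _; apply: measurable_set_ge.
apply: measurableT_comp => //.
exact: sub_measurableW (iid_measurable iidY (j := k)) (iid_partial_sum iidY k).
Qed.

(** The mean of [f] along the stopped sum rises by at most [B] per step, and [f >= c] once the sum
    is large, so Markov's inequality concludes. The bounded [f] stands in for the square, whose mean
    may be infinite. *)
Lemma maximal_partial_sum_le C f f1 f2 c K : taylor2 C f f1 f2 ->
  f 0 = 0 -> (forall x, 0 <= f x) -> 0 < c ->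
  (forall x, e <= `|x| -> c <= f x) ->
  (P [set w | exists2 k, (k <= K)%N & (e * s <= `|\sum_(i < k) Y i w|)%R]
    <= (K%:R * (C * (3 * tail_mass P X s
          + truncated_second_moment P X s / s ^+ 2)) / c)%:E)%E.
Proof.
move=> tf f0 fge0 c0 fc; set B := C * _.
have mS k := sub_measurableW (iid_measurable iidY (j := k))
  (sub_measurable_stopped_sum k).
have iS k : P.-integrable setT (EFin \o (fun w => f (stopped_sum k w))).
  apply: (@bounded_integrable _ _ _ _ _ C).
    exact: measurableT_comp (taylor2_mfun tf) (mS k).
  by move=> w; exact: (taylor2_bound tf).
have B0 : 0 <= B.
  apply: le_trans (step_bound (iid_law_measurable iidY) iX X0 0 s0 tf).
  exact: normr_ge0.
have Ef k : \int[P]_w f (stopped_sum k w) <= k%:R * B.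
  elim: k => [|k IH].
    by rewrite /= f0 (Rintegral_prob_cst P) mul0r.
  rewrite (_ : \int[P]_w f (stopped_sum k.+1 w) =
      \int[P]_w (f \o step) (stopped_sum k w, Y k w))//.
  rewrite (iid_integral iidY (C := C)); first last.
  - by move=> z; exact: (taylor2_bound tf).
  - exact: measurableT_comp (taylor2_mfun tf) mstep.
  - exact: sub_measurable_stopped_sum.
  rewrite -natr1 mulrDl mul1r.
  apply: (@le_trans _ _ (\int[P]_w (f (stopped_sum k w) + B))); last first.
    rewrite RintegralD//; last exact: cst_integrable.
    by rewrite Rintegral_prob_cst; exact: lerD.
  (* A frozen sum does not move; a running one is advanced by [step_bound], with the past value as
     base point. *)
  have K0 w : \int[P]_w' (f \o step) (stopped_sum k w, X w') <=
      f (stopped_sum k w) + B.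
    rewrite (_ : Rintegral _ _ _ = \int[P]_w' f (if `|stopped_sum k w| < e
        then stopped_sum k w + X w' / s else stopped_sum k w))//.
    have [_|_] := ltP `|stopped_sum k w| e; last first.
      by rewrite Rintegral_prob_cst lerDl.
    rewrite -lerBlDl; apply: le_trans (ler_norm _) _.
    exact: (step_bound (iid_law_measurable iidY) iX X0 _ s0 tf).
  apply: le_Rintegral => //.
  - exact: (inner_integral_integrable P (mS k) (iid_law_measurable iidY)
      (measurableT_comp (taylor2_mfun tf) mstep)
      (fun z => taylor2_bound tf (step z))).
  - by apply: integrable_add => //; exact: cst_integrable.
have mSK : measurable [set w | e <= `|stopped_sum K w|].
  by apply: measurable_set_ge; exact: measurableT_comp.
apply: (@le_trans _ _ (P [set w | e <= `|stopped_sum K w|])).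
  apply: le_measure; rewrite ?inE//; first exact: measurable_max_partial_sum.
  by move=> w /= [k kK ek]; exact: stopped_sum_ge ek.
rewrite -[leLHS]fineK ?fin_num_measure// lee_fin ler_pdivlMr//.
apply: le_trans (Ef K).
rewrite (_ : _ * c = \int[P]_(w in [set w | e <= `|stopped_sum K w|]) c); last first.
  by rewrite Rintegral_cst// mulrC.
rewrite Rintegral_mkcond; apply: le_Rintegral => //.
- rewrite -restrict_EFin; apply/(integrable_mkcond _ mSK).
  apply: (integrableS measurableT) => //; exact: (cst_integrable P c).
- move=> w _; rewrite patchE; case: ifPn => // /set_mem /= ew.
  exact: fc.
Qed.

End maximal_inequality.

Section lindeberg.
Context d (T : measurableType d) (R : realType) (P : probability T R).

Lemma Rintegral_bound (f : T -> R) (C : R) : measurable_fun setT f ->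
  (forall w, `|f w| <= C) -> `|\int[P]_w f w| <= C.
Proof.
move=> mf fC; have intf := bounded_integrable P mf fC.
apply: (le_trans (le_normr_Rintegral _ intf)) => //.
rewrite -[leRHS](Rintegral_prob_cst P); apply: le_Rintegral => //.
- exact: (integrable_norm intf).
- exact: cst_integrable.
Qed.

End lindeberg.

(** * Averaging test functions against a probability law *)

Section average.
Context (R : realType) (N : probability R R).
Implicit Types h : R -> R.

Definition average h (x : R) : R := \int[N]_z h (x + z).

Let mshift (h : R -> R) (x : R) :
  measurable_fun setT h -> measurable_fun setT (fun z : R => h (x + z)).
Proof. by move=> mh; apply: (measurableT_comp mh); exact: measurable_funD. Qed.

Lemma measurable_average h (C : R) :
  measurable_fun setT h -> (forall x, `|h x| <= C) ->
  measurable_fun setT (average h).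
Proof.
move=> mh hC; apply/measurable_EFinP.
have mid : measurable_fun setT (@idfun R) by exact: measurable_id.
have mF : measurable_fun setT (fun z : R * R => h (z.1 + z.2)).
  by apply: (measurableT_comp mh); exact: measurable_funD.
have /integrableP[] // :=
  inner_integral_integrable N mid mid mF (fun z => hC (z.1 + z.2)).
Qed.

(** The defining inequalities are translation invariant and integrate with the same [C], so iterated
    averages keep the same one-step error. *)
Lemma taylor2_average C h h1 h2 : taylor2 C h h1 h2 ->
  taylor2 C (average h) (average h1) (average h2).
Proof.
move=> [mh mh1 mh2 hC h1C h2C hrem].
have C0 : 0 <= C by exact: le_trans (normr_ge0 _) (hC 0).
split; [exact: measurable_average hC|exact: measurable_average h1C
  |exact: measurable_average h2C
  |by move=> x; apply: Rintegral_bound => //; exact: mshift..|].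
move=> x y.
have ish h' u : measurable_fun setT h' -> (forall x, `|h' x| <= C) ->
    N.-integrable setT (EFin \o (fun z => h' (u + z))).
  by move=> mh' h'C; apply: (@bounded_integrable _ _ _ _ _ C) => //; exact: mshift.
have i1 := ish h (x + y) mh hC; have i2 := ish h x mh hC.
have i3 := integrable_scale y (ish h1 x mh1 h1C).
have i4 := integrable_scale (y ^+ 2 / 2) (ish h2 x mh2 h2C).
have i12 := integrable_sub i1 i2; have i13 := integrable_sub i12 i3.
have -> : average h (x + y) - average h x - average h1 x * y -
    average h2 x / 2 * y ^+ 2 =
    \int[N]_z (h (x + y + z) - h (x + z) - y * h1 (x + z) -
               y ^+ 2 / 2 * h2 (x + z)).
  rewrite RintegralB// RintegralB// RintegralB//.
  rewrite RintegralZl//; last exact: ish.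
  rewrite RintegralZl//; last exact: ish.
  rewrite /average; ring.
apply: Rintegral_bound.
  by have /integrableP[/measurable_EFinP] := integrable_sub i13 i4.
move=> z; apply: le_trans (hrem (x + z) y); rewrite le_eqVlt; apply/orP; left.
by apply/eqP; congr `|_|; rewrite [x + y + z]addrAC; ring.
Qed.

End average.

(** * Lindeberg's replacement argument on an event of the past *)

Section lindeberg.
Context d (T : measurableType d) (R : realType) (P : probability T R).
Variables (G : nat -> set (set T)) (X : T -> R) (Y : nat -> T -> R).
Hypothesis iidY : iid_adapted P G X Y.
Variables (N : probability R R) (C delta s : R) (A : set T).
Hypothesis GA : G 0 A.
Hypothesis step_close : forall h h1 h2, taylor2 C h h1 h2 -> forall x,
  `|\int[P]_w h (x + X w / s) - average N h x| <= delta.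

Let V m w := (\sum_(i < m) Y i w) / s.
(** Membership in [A] becomes a coordinate of the past variable, so that restriction to [A] passes
    through [iid_integral]. *)
Let F h (z : bool * R) : R := if z.1 then h z.2 else 0.

Let mF (h : R -> R) : measurable_fun setT h -> measurable_fun setT (F h).
Proof.
move=> mh; apply: measurable_fun_ifT => //.
by apply: (measurableT_comp mh); exact: measurable_snd.
Qed.

Let sub_AV m : sub_measurable (G m) (fun w => (w \in A, V m w)).
Proof.
have sG := iid_sigma iidY; apply: sub_measurable_pair => //.
  apply: sub_measurable_mem => //.
  exact: (iid_filtration iidY (leq0n m)).
rewrite (_ : V m = (fun z : R => z / s) \o (fun w => \sum_(i < m) Y i w))//.
apply: sub_measurable_comp; first exact: measurable_funM.
exact: (iid_partial_sum iidY).
Qed.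

Let mAV m := sub_measurableW (iid_measurable iidY (j := m)) (sub_AV m).

Let F_bound (h : R -> R) : (forall x : R, `|h x| <= C) -> forall z, `|F h z| <= C.
Proof.
move=> hC [[] x]; rewrite /F /=; first exact: hC.
rewrite normr0; exact: le_trans (normr_ge0 _) (hC 0).
Qed.

Let iFV (h : R -> R) m : measurable_fun setT h -> (forall x : R, `|h x| <= C) ->
  P.-integrable setT (EFin \o (fun w => F h (w \in A, V m w))).
Proof.
move=> mh hC; apply: (@bounded_integrable _ _ _ _ _ C).
  exact: measurableT_comp (mF mh) (mAV m).
by move=> w; exact: F_bound.
Qed.

(** Only the last increment is integrated out, with the past fixed: the error is at most [delta] on
    [A] and zero outside. *)
Let lindeberg_swap h h1 h2 m : taylor2 C h h1 h2 ->
  `|\int[P]_w F h (w \in A, V m.+1 w) -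
    \int[P]_w F (average N h) (w \in A, V m w)| <= delta.
Proof.
move=> th; have ta := taylor2_average N th.
have [mh hC] := (taylor2_mfun th, taylor2_bound th).
have [ma aC] := (taylor2_mfun ta, taylor2_bound ta).
pose H (z : (bool * R) * R) : R := if z.1.1 then h (z.1.2 + z.2 / s) else 0.
have mH : measurable_fun setT H.
  apply: measurable_fun_ifT => //.
    by apply: measurableT_comp => //; exact: measurable_fst.
  apply: (measurableT_comp mh); apply: measurable_funD.
    by apply: measurableT_comp => //; exact: measurable_snd.
  by apply: measurable_funM => //; exact: measurable_snd.
have HC z : `|H z| <= C.
  by rewrite /H; case: ifP => // _; rewrite normr0 (le_trans _ (hC 0)).
have -> : \int[P]_w F h (w \in A, V m.+1 w) =
    \int[P]_w H ((w \in A, V m w), Y m w).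
  apply: eq_Rintegral => w _; rewrite /F /H /V /= big_ord_recr/=.
  by rewrite mulrDl.
rewrite (iid_integral iidY (C := C))//.
have iH : P.-integrable setT
    (EFin \o (fun w => \int[P]_w' H ((w \in A, V m w), X w'))).
  exact: (inner_integral_integrable P (mAV m) (iid_law_measurable iidY) mH HC).
rewrite -RintegralB//; last exact: iFV.
apply: Rintegral_bound.
  have /integrableP[/measurable_EFinP mI _] := iH.
  apply: measurable_funB => //.
  exact: measurableT_comp (mF ma) (mAV m).
move=> w; rewrite /H /F /=; case: (w \in A); first exact: (step_close th).
rewrite Rintegral_prob_cst subrr normr0.
exact: le_trans (normr_ge0 _) (step_close th 0).
Qed.

Lemma lindeberg h h1 h2 m : taylor2 C h h1 h2 ->
  `|\int[P]_(w in A) h ((\sum_(i < m) Y i w) / s) -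
    fine (P A) * iter m (average N) h 0| <= m%:R * delta.
Proof.
have mA := iid_measurable iidY GA.
have E f k : \int[P]_(w in A) f ((\sum_(i < k) Y i w) / s) =
    \int[P]_w F f (w \in A, V k w).
  by rewrite Rintegral_mkcond; apply: eq_Rintegral => w _; rewrite patchE.
rewrite E.
(* The test function must stay general, since each swap replaces [h] by [average N h]. Once no
   summand is left, its value at 0 is constant on [A], which produces the factor [P A]. *)
elim: m h h1 h2 => [|m IH] h h1 h2 th.
  rewrite -E /=; under eq_Rintegral do rewrite big_ord0 mul0r.
  by rewrite Rintegral_cst// mulrC subrr normr0 mul0r.
rewrite -natr1 mulrDl mul1r iterSr.
have := lindeberg_swap m th; have := IH _ _ _ (taylor2_average N th).
set a := Rintegral _ _ _; set b := Rintegral _ _ _; set c := _ * _.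
move=> ac ba; rewrite -(subrKA a) addrC [leRHS]addrC.
by apply: (le_trans (ler_normD _ _)); rewrite addrC lerD.
Qed.

End lindeberg.

(** * Integration against densities and restricted laws *)

Section density.
Context d (T : measurableType d) (R : realType).
Local Open Scope ereal_scope.
Import HBNNSimple.

(** Both sides are monotone limits along simple functions approximating [g]; this reduces the
    identity to level sets, where it is the hypothesis on [m1]. *)
Lemma ge0_integral_density (m1 m2 : {measure set T -> \bar R}) (f : T -> R)
    (g : T -> \bar R) :
  measurable_fun setT f -> (forall x, 0 <= f x)%R ->
  (forall A, measurable A -> m1 A = \int[m2]_(x in A) (f x)%:E) ->
  measurable_fun setT g -> (forall x, 0 <= g x) ->
  \int[m1]_x g x = \int[m2]_x (g x * (f x)%:E).
Proof.
move=> mf f0 m12 mg g0; pose h := nnsfun_approx measurableT mg.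
have mfE : measurable_fun setT (EFin \o f) by exact/measurable_EFinP.
have -> : \int[m1]_x g x = limn (fun n => \int[m1]_x (EFin \o h n) x).
  have gE x : g x = limn (fun n => (EFin \o h n) x).
    by apply/esym/cvg_lim => //; exact: cvg_nnsfun_approx.
  under eq_integral => x _ do rewrite gE.
  apply: monotone_convergence => //.
  - by move=> n; exact/measurable_EFinP.
  - by move=> n x _ /=; rewrite lee_fin.
  - by move=> x _ a b ab; rewrite lee_fin; exact/lefP/nd_nnsfun_approx.
have -> : \int[m2]_x (g x * (f x)%:E) =
    limn (fun n => \int[m2]_x ((h n x)%:E * (f x)%:E)).
  have gE x : g x * (f x)%:E = limn (fun n => (h n x)%:E * (f x)%:E).
    apply/esym/cvg_lim => //; apply: cvgeZr => //.
    exact: (cvg_nnsfun_approx measurableT mg (fun x _ => g0 x)).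
  under eq_integral => x _ do rewrite gE.
  apply: monotone_convergence => //.
  - by move=> n; apply/emeasurable_funM => //; exact/measurable_EFinP.
  - by move=> n x _ /=; rewrite mule_ge0 ?lee_fin.
  - move=> x _ a b ab/=; rewrite lee_wpmul2r ?lee_fin//.
    exact/lefP/nd_nnsfun_approx.
congr (limn _); apply/funext => n.
transitivity (\int[m1]_x
   (\sum_(y \in range (h n)) (y * \1_(h n @^-1` [set y]) x)%:E)).
  by apply: eq_integral => t _; rewrite /= fimfunE -fsumEFin.
have indich r : measurable_fun setT (fun x => (r * \1_(h n @^-1` [set r]) x)%:E).
  by apply/measurable_EFinP; exact: measurable_funM.
rewrite ge0_integral_fsum//; last by move=> m y _; exact: nnfun_muleindic_ge0.
transitivity (\int[m2]_x (\sum_(y \in range (h n))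
    (y * \1_(h n @^-1` [set y]) x)%:E * (f x)%:E)); last first.
  apply: eq_integral => x _.
  rewrite -ge0_mule_fsuml => [|y]; last exact: nnfun_muleindic_ge0.
  by rewrite fsumEFin // -(fimfunE _ x).
rewrite ge0_integral_fsum//; last 2 first.
  - by move=> y; exact: emeasurable_funM.
  - move=> m y _; apply: mule_ge0; last by rewrite lee_fin.
    exact: nnfun_muleindic_ge0.
apply: eq_fsbigr => r; rewrite inE => -[t _ rE].
have r0 : (0 <= r)%R by rewrite -rE.
under [LHS]eq_integral do rewrite EFinM.
rewrite integralZl_indic_nnsfun => //.
under [RHS]eq_integral do rewrite EFinM -muleA.
rewrite ge0_integralZl//.
- congr (_ * _); rewrite integral_indic// setIT m12// [LHS]integral_mkcond.
  apply: eq_integral => x _; rewrite patchE indicE.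
  by case: (x \in _); rewrite ?mul1e ?mul0e.
- by apply: emeasurable_funM => //; exact/measurable_EFinP.
- by move=> x _; rewrite mule_ge0// lee_fin.
Qed.

Lemma ge0_integral_mrestr (m : {measure set T -> \bar R}) D (mD : measurable D)
    (g : T -> \bar R) : measurable_fun setT g -> (forall x, 0 <= g x) ->
  \int[mrestr m mD]_x g x = \int[m]_(x in D) g x.
Proof.
move=> mg g0; rewrite (@ge0_integral_density _ m (\1_D))//.
- rewrite [RHS]integral_mkcond; apply: eq_integral => x _.
  by rewrite patchE indicE; case: (x \in D); rewrite ?mule1 ?mule0.
- by move=> A mA; rewrite integral_indic// setIC.
Qed.

End density.

(** The law of [X] under [P] restricted to [D] has density [f] with respect to [m]; probabilities
    known for every [B] thus become formulas for integrals. *)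
Lemma ge0_integral_restrict_law d (T : measurableType d) (R : realType)
    (P : {measure set T -> \bar R}) (m : {measure set R -> \bar R})
    (f : R -> R) (X : T -> R) D (phi : R -> \bar R) :
  measurable D -> measurable_fun setT X ->
  measurable_fun setT f -> (forall x, 0 <= f x) ->
  (forall B, measurable B ->
    P (D `&` X @^-1` B) = \int[m]_(x in B) (f x)%:E)%E ->
  measurable_fun setT phi -> (forall x, 0 <= phi x)%E ->
  (\int[P]_(w in D) phi (X w) = \int[m]_x (phi x * (f x)%:E))%E.
Proof.
move=> mD mX mf f0 DX mphi phi0.
pose X' : {mfun T >-> R} := mfun_Sub (mem_set mX).
rewrite -(ge0_integral_density (m1 := pushforward (mrestr P mD) X'))//; last first.
  by move=> B mB; rewrite -DX// setIC.
transitivity (\int[mrestr P mD]_x (phi \o X) x)%E.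
  exact/esym/(ge0_integral_mrestr P mD (measurableT_comp mphi mX)
    (fun x => phi0 (X x))).
by rewrite ge0_integral_pushforward.
Qed.

(** * Jump structure of the chain and independence of the blocks *)

Section chain.
Context d (T : measurableType d) (R : realType) (P : probability T R).
Variables (nu : probability R R) (p : R -> R).
Variables (W : int -> {RV P >-> R}) (xi : nat -> {RV P >-> bool}).
Hypothesis hp_meas : measurable_fun [set: R] p.
Hypothesis hp : forall x, 0 < p x < 1.
Hypothesis hxi : jump_indicators p nu W xi.

Local Notation F := (sigma_chain_jumps W xi).

Let p_ge0 x : 0 <= p x. Proof. by case/andP: (hp x) => /ltW. Qed.
Let p_le1 x : p x <= 1. Proof. by case/andP: (hp x) => _ /ltW. Qed.

Lemma sigma_algebra_chain n : sigma_algebra setT (F n).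
Proof. exact: smallest_sigma_algebra. Qed.

Lemma chain_measurable n A : F n A -> measurable A.
Proof.
apply: smallest_sub; first exact: sigma_algebra_measurable.
move=> _ [[i _ [B mB <-]]|[i _ [B mB <-]]]; rewrite -[X in measurable X]setTI;
  exact: measurable_funP.
Qed.

Lemma chain_mono n m : (n <= m)%N -> F n `<=` F m.
Proof.
move=> nm; apply: sub_smallest2r.
  exact: smallest_sigma_algebra.
move=> A [[i /= ni [B mB <-]]|[i /= /andP[i1 ni] [B mB <-]]].
  by left; exists i; [rewrite /= (le_trans ni)// lez_nat|exists B].
by right; exists i; [rewrite /= i1 (leq_trans ni)|exists B].
Qed.

Lemma sub_measurable_chain (i : int) n : i <= n%:Z -> sub_measurable (F n) (W i).
Proof.
move=> i_n B mB; apply: sub_gen_smallest; left.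
by exists i => //; exists B.
Qed.

Lemma sub_measurable_jump i n : (0 < i <= n)%N -> sub_measurable (F n) (xi i).
Proof.
move=> i_n B mB; apply: sub_gen_smallest; right.
by exists i => //; exists B.
Qed.

Lemma chainI n A B : F n A -> F n B -> F n (A `&` B).
Proof.
move=> FA FB; have [_ /(_ _)FC _] := sigma_algebra_chain n.
have := @measurableI _ (g_sigma_algebraType (F n)) A B.
rewrite /measurable/= sigma_algebra_id; last exact: sigma_algebra_chain.
exact.
Qed.

Lemma chain_xi n b : F n.+1 (xi n.+1 @^-1` [set b]).
Proof. by apply: sub_measurable_jump => //; rewrite /= leqnn. Qed.

(** Concerns the steps [n.+1] to [n + k], since [xi i.+1] governs the step out of [i]. *)
Definition no_jump n k : set T :=
  [set w | forall i, (i < k)%N -> xi (n + i).+1 w = false].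

Lemma no_jumpS n k : no_jump n k.+1 = no_jump n k `&` xi (n + k).+1 @^-1` [set false].
Proof.
apply/seteqP; split=> w /= h.
  by split=> [i ik|]; apply: h => //; exact: ltnW.
by case: h => h hk i; rewrite ltnS leq_eqVlt => /predU1P[->//|/h].
Qed.

Lemma no_jump0 n : no_jump n 0 = setT.
Proof. by apply/seteqP; split. Qed.

Lemma chain_no_jump n k m : (n + k <= m)%N -> F m (no_jump n k).
Proof.
elim: k => [|k IH] nkm.
  rewrite no_jump0; have := @measurableT _ (g_sigma_algebraType (F m)).
  by rewrite /measurable/= sigma_algebra_id//; exact: sigma_algebra_chain.
rewrite no_jumpS; apply: chainI; first by apply: IH; rewrite (leq_trans _ nkm)// addnS.
have nkm' : ((n + k).+1 <= m)%N by rewrite -addnS.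
by apply: (chain_mono nkm'); exact: chain_xi.
Qed.

(** Without a jump [W n.+1] equals [W n] almost surely, so only the conditional probability
    [p (W n)] of staying remains to be integrated. *)
Lemma integral_no_jump n A (phi : R -> \bar R) : F n A ->
  measurable_fun setT phi -> (forall x, 0 <= phi x)%E ->
  (\int[P]_(w in A `&` xi n.+1 @^-1` [set false]) phi (W n.+1 w) =
   \int[P]_(w in A) (phi (W n w) * (p (W n w))%:E))%E.
Proof.
move=> FA mphi phi0; have mA := chain_measurable FA.
have mE : measurable (xi n.+1 @^-1` [set false]) by apply: chain_measurable; exact: chain_xi.
have mAE := measurableI _ _ mA mE.
have mW i : measurable_fun setT (W i) by exact: measurable_funP.
have mphiW i : measurable_fun setT (phi \o W i) by exact: measurableT_comp.
transitivity (\int[P]_(w in A `&` xi n.+1 @^-1` [set false]) phi (W n w))%E.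
  apply: ge0_ae_eq_integral => //.
  - exact: (measurable_funTS (mphiW _)).
  - exact: (measurable_funTS (mphiW _)).
  have := no_jump_stay hxi n; apply: filterS => w stay [_ /= xi0].
  by rewrite stay.
(* The reference measure is the law of [W n] restricted to [A]; relative to it, staying has density
   [p]. *)
rewrite (ge0_integral_restrict_law (m := pushforward (mrestr P mA) (W n)) (f := p))//.
  rewrite ge0_integral_pushforward//=; last 2 first.
  - by apply: emeasurable_funM => //; exact/measurable_EFinP.
  - by move=> x _; rewrite mule_ge0// lee_fin.
  rewrite ge0_integral_mrestr//.
    apply: emeasurable_funM; first exact: mphiW.
    exact/measurable_EFinP/(measurableT_comp hp_meas).
  by move=> w; rewrite mule_ge0// lee_fin.
move=> B mB; rewrite ge0_integral_pushforward//=; last 2 first.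
- by apply/measurable_EFinP/measurable_funTS.
- by move=> x _; rewrite lee_fin.
have mWB : measurable (W n @^-1` B) by rewrite -[X in measurable X]setTI; exact: mW.
rewrite [RHS]integral_mkcond ge0_integral_mrestr//; last 2 first.
- apply/(measurable_restrictT _ _).1 => //; apply/measurable_funTS/measurable_EFinP.
  exact: (measurableT_comp hp_meas).
- by move=> w; apply: erestrict_ge0 => {}w _; rewrite lee_fin.
rewrite -integral_mkcondr -setIA [_ @^-1` _ `&` _]setIC setIA.
have [_ ->] // := no_jump_prob hxi n.
by apply: chainI => //; exact: sub_measurable_chain.
Qed.

(** [nu B] is constant and leaves the integral; the other factor is identified by taking [B] to be
    the whole line. *)
Lemma jump_draw_indep n A B : F n A -> measurable B ->
  (P ((A `&` xi n.+1 @^-1` [set true]) `&` W n.+1 @^-1` B) =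
   P (A `&` xi n.+1 @^-1` [set true]) * nu B)%E.
Proof.
move=> FA mB; rewrite -setIA.
have m1p : measurable_fun setT (fun w => (1 - p (W n w))%:E).
  apply/measurable_EFinP; apply: measurable_funB => //.
  by apply: (measurableT_comp hp_meas); exact: measurable_funP.
have E B' : measurable B' ->
    P (A `&` (xi n.+1 @^-1` [set true] `&` W n.+1 @^-1` B')) =
    (\int[P]_(w in A) (1 - p (W n w))%:E * nu B')%E.
  move=> mB'; have [_ ->//] := jump_draw hxi n mB'.
  rewrite ge0_integralZr//; first exact: chain_measurable FA.
  - exact: measurable_funTS.
  - by move=> w _; rewrite lee_fin subr_ge0.
rewrite E//; congr (_ * _)%E.
have := E setT measurableT; rewrite preimage_setT setIT => ->.
by rewrite [X in (_ * X)%E]probability_setT mule1.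
Qed.

Lemma integral_jump n A (phi : R -> \bar R) : F n A ->
  measurable_fun setT phi -> (forall x, 0 <= phi x)%E ->
  (\int[P]_(w in A `&` xi n.+1 @^-1` [set true]) phi (W n.+1 w) =
   P (A `&` xi n.+1 @^-1` [set true]) * \int[nu]_x phi x)%E.
Proof.
move=> FA mphi phi0; have mA := chain_measurable FA.
have mA1 : measurable (A `&` xi n.+1 @^-1` [set true]).
  by apply: measurableI => //; apply: chain_measurable; exact: chain_xi.
set A1 := A `&` _ in mA1 *.
have c0 : 0 <= fine (P A1) by rewrite fine_ge0.
have cE : P A1 = (fine (P A1))%:E by rewrite fineK// fin_num_measure.
rewrite (ge0_integral_restrict_law (m := nu) (f := fun=> fine (P A1)))//.
- rewrite ge0_integralZr//; first by rewrite muleC -cE.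
- move=> B mB; rewrite integral_cst//= -cE muleC; rewrite jump_draw_indep// muleC//.
Qed.

(** After a jump the state has law [nu] independently of [A], and each further step without jump
    contributes a factor [p], which the induction absorbs into [phi]. *)
Lemma integral_run n k A (phi : R -> \bar R) : F n A ->
  measurable_fun setT phi -> (forall x, 0 <= phi x)%E ->
  (\int[P]_(w in A `&` xi n.+1 @^-1` [set true] `&` no_jump n.+1 k)
     phi (W (n.+1 + k)%N w) =
   P (A `&` xi n.+1 @^-1` [set true]) * \int[nu]_x (phi x * (p x ^+ k)%:E))%E.
Proof.
move=> FA; set A1 := A `&` _.
have FA1 : F n.+1 A1.
  by apply: chainI; [exact: chain_mono FA|exact: chain_xi].
elim: k phi => [|k IH] phi mphi phi0.
  rewrite no_jump0 setIT addn0 integral_jump//.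
  by congr (_ * _)%E; apply: eq_integral => x _; rewrite expr0 mule1.
rewrite no_jumpS setIA addnS integral_no_jump//; last first.
  apply: chainI; last by apply: chain_no_jump.
  by apply: chain_mono FA1; rewrite leq_addr.
rewrite (IH (fun x => phi x * (p x)%:E)%E).
- congr (_ * _)%E; apply: eq_integral => x _.
  by rewrite -muleA -EFinM -exprS.
- by apply: emeasurable_funM => //; exact/measurable_EFinP.
- by move=> x; rewrite mule_ge0// lee_fin.
Qed.

Lemma integral_no_jumps n k A (phi : R -> \bar R) : F n A ->
  measurable_fun setT phi -> (forall x, 0 <= phi x)%E ->
  (\int[P]_(w in A `&` no_jump n k) phi (W (n + k)%N w) =
   \int[P]_(w in A) (phi (W n w) * (p (W n w) ^+ k)%:E))%E.
Proof.
move=> FA; elim: k phi => [|k IH] phi mphi phi0.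
  rewrite no_jump0 setIT addn0.
  by apply: eq_integral => x _; rewrite expr0 mule1.
rewrite no_jumpS setIA addnS integral_no_jump//; last first.
  apply: chainI; last by apply: chain_no_jump.
  by apply: chain_mono FA; rewrite leq_addr.
rewrite (IH (fun x => phi x * (p x)%:E)%E).
- apply: eq_integral => x _.
  by rewrite -muleA -EFinM -exprS.
- by apply: emeasurable_funM => //; exact/measurable_EFinP.
- by move=> x; rewrite mule_ge0// lee_fin.
Qed.

Lemma ae_measure_eq (A B : set T) : measurable A -> measurable B ->
  {ae P, forall w, A w <-> B w} -> P A = P B.
Proof.
move=> mA mB AB.
have E C : measurable C -> P C = (\int[P]_w (\1_C w)%:E)%E.
  by move=> mC; rewrite integral_indic// setIT.
rewrite !E//; apply: ge0_ae_eq_integral => //.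
- exact/measurable_EFinP.
- exact/measurable_EFinP.
apply: filterS AB => w [AB BA] _; congr (_%:E); rewrite !indicE; congr (_%:R).
by congr nat_of_bool; apply/idP/idP; rewrite !inE.
Qed.

Lemma measure_nat_partition (N : T -> nat) (S : set T) :
  (forall n, measurable [set w | N w = n]) -> measurable S ->
  (P S = \sum_(n <oo) P (S `&` [set w | N w = n]))%E.
Proof.
move=> mN mS.
have mSN n : measurable (S `&` [set w | N w = n]) by exact: measurableI.
rewrite -measure_semi_bigcup//.
- rewrite -setI_bigcupr; congr (P _); apply/esym/setIidPl => w _.
  by exists (N w).
- by move=> i j _ _ [w [[_ <-] [_ <-]]].
- exact: bigcupT_measurable.
Qed.

Lemma chain_measurableP n A :
  F n A <-> measurable (A : set (g_sigma_algebraType (F n))).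
Proof. by rewrite /measurable/= sigma_algebra_id//; exact: sigma_algebra_chain. Qed.

(** The almost sure event on which every jump time is a true minimum rather than a default value,
    and the state moves only at jumps. All pathwise arguments take place on it. *)
Definition good_path : set T :=
  [set w | (forall m, exists n, (m <= n)%N && xi n.+1 w) /\
    (forall n, xi n.+1 w = false -> W n.+1 w = W n w)].

(** The probability is the mean of [p (W m) ^+ k], and [p < 1] gives pointwise convergence under the
    bound 1. *)
Lemma measure_no_jump_cvg0 m : (P (no_jump m k) @[k --> \oo] --> 0)%E.
Proof.
have mpW : measurable_fun setT (fun w => p (W m w)).
  by apply: (measurableT_comp hp_meas); exact: measurable_funP.
have E k : P (no_jump m k) = (\int[P]_w (p (W m w) ^+ k)%:E)%E.
  have FT : F m setT by apply/chain_measurableP; exact: measurableT.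
  have := integral_no_jumps (n := m) k FT (measurable_cst (1%E : \bar R)).
  rewrite setTI integral_cst/= ?mul1e => [->//|].
    by apply: eq_integral => w _; rewrite mul1e.
  exact: chain_measurable (chain_no_jump (leqnn _)).
under eq_fun do rewrite E.
rewrite -(integral0 P setT).
have mpWk k : measurable_fun setT (fun w => (p (W m w) ^+ k)%:E).
  by apply/measurable_EFinP; exact: measurable_funX.
have p0 : {ae P, forall w, setT w -> (p (W m w) ^+ k)%:E @[k --> \oo] --> 0%E}.
  apply: aeW => w _; apply: cvg_EFin; first exact: nearW.
  by apply: cvg_expr; rewrite ger0_norm//; case/andP: (hp (W m w)).
have i1 : P.-integrable setT (cst (1%E : \bar R)).
  exact: (cst_integrable P 1).
have p1 : {ae P, forall w k, setT w -> `|(p (W m w) ^+ k)%:E| <= cst 1 w}%E.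
  by apply: aeW => w k _; rewrite lee_fin ger0_norm ?exprn_ge0// exprn_ile1.
by have [] := dominated_convergence measurableT mpWk
  (measurable_cst (0%E : \bar R)) p0 i1 p1.
Qed.

Lemma good_ae : {ae P, forall w, good_path w}.
Proof.
have jumps : {ae P, forall w m, exists n, (m <= n)%N && xi n.+1 w}.
  apply: ae_foralln => m.
  have mN : measurable (\bigcap_k no_jump m k).
    apply: bigcapT_measurable => k.
    exact: chain_measurable (chain_no_jump (leqnn _)).
  exists (\bigcap_k no_jump m k); split => //.
    apply/eqP; rewrite eq_le measure_ge0 andbT.
    apply: (cvge_ge _ (measure_no_jump_cvg0 m)); apply: nearW => k.
    apply: le_measure; rewrite ?inE//.
    - exact: chain_measurable (chain_no_jump (leqnn _)).
    - exact: bigcap_inf.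
  move=> w /= nex k _ i ik; apply/negP => xiw; apply: nex.
  by exists (m + i)%N; rewrite leq_addr.
have stays := ae_foralln (no_jump_stay hxi).
by near=> w; split; near: w.
Unshelve. all: by end_near. Qed.

Lemma first_jump_uniq a m n w : (a <= m)%N -> (a <= n)%N ->
  no_jump a (m - a) w -> no_jump a (n - a) w -> xi m.+1 w -> xi n.+1 w -> m = n.
Proof.
move=> am an nm nn xm xn; have [mn|nm'|//] := ltngtP m n.
- by have := nn (m - a)%N; rewrite ltn_sub2r ?(leq_ltn_trans am)// subnKC// xm => /(_ isT).
- by have := nm (n - a)%N; rewrite ltn_sub2r ?(leq_ltn_trans an)// subnKC// xn => /(_ isT).
Qed.

Lemma next_jumpP m w : (exists n, (m <= n)%N && xi n.+1 w) ->
  [/\ (m <= next_jump xi m w)%N, no_jump m (next_jump xi m w - m) w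
    & xi (next_jump xi m w).+1 w].
Proof.
move=> ex; rewrite /next_jump; case: pselect => // ex'.
case: ex_minnP => n /andP[mn xn] minn; split => // i.
rewrite ltn_subRL => i_n; apply/negP => xi1.
by have := minn (m + i)%N; rewrite leq_addr xi1 leqNgt i_n => /(_ isT).
Qed.

Local Notation tau := (jump_time xi).

Lemma jump_time0P w : good_path w -> no_jump 0 (tau 0 w) w /\ xi (tau 0 w).+1 w.
Proof. by move=> [jw _]; have [_] := next_jumpP (jw 0%N); rewrite subn0. Qed.

Lemma jump_timeSP j w : good_path w ->
  [/\ (tau j w < tau j.+1 w)%N,
      no_jump (tau j w).+1 (tau j.+1 w - (tau j w).+1) w
    & xi (tau j.+1 w).+1 w].
Proof. by move=> [jw _]; exact: next_jumpP. Qed.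

Lemma no_jump_const a k i w : good_path w -> no_jump a k w -> (i <= k)%N ->
  W (a + i)%N w = W a w.
Proof.
move=> [_ stay] nj; elim: i => [|i IH] ik; first by rewrite addn0.
by rewrite addnS stay ?IH// ?nj// ltnW.
Qed.

(** The part of [tau j = n] known at time [n]: exactly [j] jumps among the first [n] steps. The
    missing part is the jump at step [n.+1]; splitting it off gives an event of [F n], to which the
    law of the next draw applies. *)
Fixpoint jump_pre j n : set T :=
  if j is j'.+1 then
    \bigcup_(i in [set i | (i < n)%N])
      (jump_pre j' i `&` xi i.+1 @^-1` [set true] `&` no_jump i.+1 (n - i.+1))
  else no_jump 0 n.

Lemma chain_jump_pre j n : F n (jump_pre j n).
Proof.
elim: j n => [|j IH] n; first exact: chain_no_jump.
apply/chain_measurableP; apply: bigcup_measurable => i /= i_n.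
apply/chain_measurableP; apply: chainI; last by apply: chain_no_jump; rewrite subnKC.
apply: (chain_mono i_n); apply: chainI; last exact: chain_xi.
exact: (chain_mono (leqnSn i)).
Qed.

Lemma jump_preP j n w : good_path w -> tau j w = n <-> jump_pre j n w /\ xi n.+1 w.
Proof.
move=> gw; elim: j n => [|j IH] n /=.
  have [nj x0] := jump_time0P gw; split=> [<-//|[nj' x1]].
  by apply: (@first_jump_uniq 0 _ _ w) => //; rewrite subn0.
have [lt_tau nj x1] := jump_timeSP j gw; split=> [<-|[[i /= i_n [[pre xi1] nj'] xn]]].
  split=> //; exists (tau j w) => //; split => //.
  by have [/(_ erefl)] := IH (tau j w).
have ti : tau j w = i by apply/IH; split.
by subst i; exact: (@first_jump_uniq (tau j w).+1 _ _ w).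
Qed.

Lemma measurable_next_jump m n : measurable [set w | next_jump xi m w = n].
Proof.
have mx i : measurable [set w | xi i.+1 w].
  by have := measurable_funP (xi i.+1) measurableT [set true] I; rewrite setTI; exact.
have mnj k : measurable (no_jump m k).
  rewrite (_ : no_jump m k = ~` \bigcup_(i in [set i | (i < k)%N]) [set w | xi (m + i).+1 w]).
    by apply: measurableC; apply: bigcup_measurable => i _; exact: mx.
  rewrite setC_bigcup; apply/seteqP.
  split=> w /= nj i ik; have := nj i ik.
    by move=> xf; rewrite /setC /= xf.
  by move=> /negP/negbTE.
pose E : set T := \bigcup_(i in [set i | (m <= i)%N]) [set w | xi i.+1 w].
have mE : measurable E by apply: bigcup_measurable => i _; exact: mx.
have EP w : E w <-> exists i, (m <= i)%N && xi i.+1 w.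
  by split=> [[i mi xiw]|[i /andP[mi xiw]]]; exists i => //; apply/andP.
(* The second piece collects the paths without a later jump, where [next_jump] takes its default
   value 0. *)
rewrite (_ : mkset _ =
    (E `&` ([set w | xi n.+1 w] `&` no_jump m (n - m) `&` [set _ | (m <= n)%N])) `|`
    (~` E `&` [set _ | n = 0%N])); last first.
  apply/seteqP; split=> w /=.
    move=> <-; have [Ew|nEw] := pselect (E w); [left|right]; split => //.
      by have [] := next_jumpP ((EP w).1 Ew).
    rewrite /next_jump; case: pselect => // ex; exfalso; exact/nEw/EP.
  move=> [[Ew [[xn nj] mn]]|[nEw ->]].
    have [mm nj' x'] := next_jumpP ((EP w).1 Ew).
    exact: (@first_jump_uniq m _ _ w).
  by rewrite /next_jump; case: pselect => // ex; exfalso; exact/nEw/EP.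
apply: measurableU; apply: measurableI => //; last 2 first.
- exact: measurableC.
- by case: (eqVneq n 0%N) => [->|/eqP n0]; [rewrite (_ : mkset _ = setT)//|rewrite (_ : mkset _ = set0)//]; apply/seteqP; split.
apply: measurableI; last first.
  by case: (leqP m n) => mn; [rewrite (_ : mkset _ = setT)//|rewrite (_ : mkset _ = set0)//]; apply/seteqP; split.
exact: measurableI.
Qed.

Lemma measurable_jump_time_eq j n : measurable [set w | tau j w = n].
Proof.
elim: j n => [|j IH] n; first exact: measurable_next_jump.
rewrite (_ : mkset _ = \bigcup_i ([set w | tau j w = i] `&`
    [set w | next_jump xi i.+1 w = n])); last first.
  apply/seteqP; split=> w /=; first by move=> tn; exists (tau j w).
  by move=> [i _ [/= -> ->]].
by apply: bigcupT_measurable => i; apply: measurableI => //; exact: measurable_next_jump.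
Qed.

Lemma measurable_fun_nat_comp d' (T' : measurableType d') (N : T -> nat)
    (f : nat -> T -> T') :
  (forall n, measurable [set w | N w = n]) ->
  (forall n, measurable_fun setT (f n)) ->
  measurable_fun setT (fun w => f (N w) w).
Proof.
move=> mN mf _ B mB; rewrite setTI.
rewrite (_ : _ @^-1` B = \bigcup_n ([set w | N w = n] `&` f n @^-1` B)).
  apply: bigcupT_measurable => n; apply: measurableI => //.
  by rewrite -[X in measurable X]setTI; exact: mf.
apply/seteqP; split=> w /=; first by move=> Bw; exists (N w).
by move=> [n _ [/= <-]].
Qed.

(** Indices are shifted by one: gap and mark number [j] belong to the block ending at [tau j.+1], so
    the first full block has index 0. *)
Definition jump_gap j w : nat := (tau j.+1 w - tau j w)%N.

Definition jump_mark j w : R := W (tau j.+1 w) w.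

Lemma measurable_mark j : measurable_fun setT (jump_mark j).
Proof.
apply: (measurable_fun_nat_comp (f := fun n : nat => W n)) => [n|n].
  exact: measurable_jump_time_eq.
exact: measurable_funP.
Qed.

Lemma measurable_gap_eq j k : measurable [set w | jump_gap j w = k].
Proof.
rewrite (_ : mkset _ = \bigcup_n \bigcup_m ([set w | tau j.+1 w = n] `&`
    ([set w | tau j w = m] `&` [set _ | (n - m)%N = k]))); last first.
  apply/seteqP; split=> w /=; first by exists (tau j.+1 w) => //; exists (tau j w).
  by move=> [n _ [m _ [/= <- [<- ]]]].
apply: bigcupT_measurable => n; apply: bigcupT_measurable => m.
apply: measurableI; first exact: measurable_jump_time_eq.
apply: measurableI; first exact: measurable_jump_time_eq.
have [nmk|nmk] := pselect ((n - m)%N = k).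
  by rewrite (_ : mkset _ = setT)//; apply/seteqP; split.
by rewrite (_ : mkset _ = set0)//; apply/seteqP; split.
Qed.

Lemma measurable_gap_gt j k : measurable [set w | (k < jump_gap j w)%N].
Proof.
rewrite (_ : mkset _ = \bigcup_(n in [set n | (k < n)%N]) [set w | jump_gap j w = n]).
  by apply: bigcup_measurable => n _; exact: measurable_gap_eq.
apply/seteqP; split=> w /=; first by exists (jump_gap j w).
by move=> [n kn /= gn]; rewrite gn.
Qed.

(** The past of [tau j]. Since [tau j = n] involves [xi n.+1], its intersection with a past event
    need not lie in [F n]; the condition is therefore agreement with some event of [F n] on
    [tau j = n], and only along good paths. *)
Definition block_filtration j : set (set T) :=
  [set A | measurable A /\ forall n, exists2 A', F n A' &
    forall w, good_path w -> tau j w = n -> (A w <-> A' w)].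

Lemma sigma_algebra_block j : sigma_algebra setT (block_filtration j).
Proof.
split.
- split=> [|n]; first exact: measurable0.
  by exists set0 => //; apply/chain_measurableP; exact: measurable0.
- move=> A [mA hA]; split=> [|n]; first by rewrite setTD; exact: measurableC.
  have [A' FA' AA'] := hA n; exists (~` A').
    by apply/chain_measurableP/measurableC/chain_measurableP.
  move=> w gw tn; have [h1 h2] := AA' w gw tn.
  by split=> [[_ nA] /h2//|nA]; split=> // /h1.
- move=> A hA; split=> [|n].
    by apply: bigcupT_measurable => i; case: (hA i).
  have /choice[A' hA'] : forall i, exists A', F n A' /\
      forall w, good_path w -> tau j w = n -> (A i w <-> A' w).
    by move=> i; have [_ /(_ n)[A' ? ?]] := hA i; exists A'.
  exists (\bigcup_i A' i).
    apply/chain_measurableP; apply: bigcupT_measurable => i.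
    by apply/chain_measurableP; case: (hA' i).
  move=> w gw tn; split=> -[i _ Aw]; exists i => //;
    by have [_ /(_ w gw tn)[]] := hA' i; auto.
Qed.

Lemma block_filtration_measurable j A : block_filtration j A -> measurable A.
Proof. by case. Qed.

(** Here the conditioning on [W_0] enters: its events belong to the past of every jump time. *)
Lemma chain0_block j A : F 0 A -> block_filtration j A.
Proof.
move=> FA; split=> [|n]; first exact: chain_measurable FA.
by exists A => //; exact: chain_mono FA.
Qed.

Let chain_jump_pre_xi j i n : (i < n)%N ->
  F n (jump_pre j i `&` xi i.+1 @^-1` [set true]).
Proof.
move=> i_n; apply: (chain_mono i_n); apply: chainI; last exact: chain_xi.
by apply: (chain_mono (leqnSn i)); exact: chain_jump_pre.
Qed.

Lemma block_filtration_mono j : block_filtration j `<=` block_filtration j.+1.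
Proof.
move=> A [mA hA]; split=> // n.
have /choice[A' hA'] : forall i, exists A', F i A' /\
    forall w, good_path w -> tau j w = i -> (A w <-> A' w).
  by move=> i; have [A' ? ?] := hA i; exists A'.
(* The union runs over the possible values [i] of [tau j]; [jump_pre j i] and the jump at [i.+1] are
   already known at time [n]. *)
exists (\bigcup_(i in [set i | (i < n)%N])
    (A' i `&` (jump_pre j i `&` xi i.+1 @^-1` [set true]))).
  apply/chain_measurableP; apply: bigcup_measurable => i /= i_n.
  apply/chain_measurableP; apply: chainI; last exact: chain_jump_pre_xi.
  by apply: (chain_mono (ltnW i_n)); case: (hA' i).
move=> w gw tn; have [lt_tau _ _] := jump_timeSP j gw; rewrite tn in lt_tau.
split=> [Aw|[i /= i_n [A'w [pre xi1]]]].
  exists (tau j w) => //; split.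
    by have [_ /(_ w gw erefl)[]] := hA' (tau j w); auto.
  by have [/(_ erefl)] := jump_preP j (tau j w) gw.
have ti : tau j w = i by apply/(jump_preP j i gw).
by have [_ /(_ w gw ti)[]] := hA' i; auto.
Qed.

Lemma block_filtration_gap_mark j k B : measurable B ->
  block_filtration j.+1 ([set w | jump_gap j w = k] `&` jump_mark j @^-1` B).
Proof.
move=> mB; split=> [|n].
  apply: measurableI; first exact: measurable_gap_eq.
  by rewrite -[X in measurable X]setTI; exact: measurable_mark.
exists (\bigcup_(i in [set i | (i < n)%N && ((n - i)%N == k)])
    (jump_pre j i `&` xi i.+1 @^-1` [set true] `&` W n @^-1` B)).
  apply/chain_measurableP; apply: bigcup_measurable => i /= /andP[i_n _].
  apply/chain_measurableP; apply: chainI; first exact: chain_jump_pre_xi.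
  exact: sub_measurable_chain.
move=> w gw tn; have [lt_tau _ _] := jump_timeSP j gw; rewrite tn in lt_tau.
rewrite /= /jump_gap /jump_mark tn; split=> [[gk Bw]|[i /= /andP[i_n /eqP ik] [[pre xi1] Bw]]].
  exists (tau j w); first by rewrite /= lt_tau gk eqxx.
  by split=> //; have [/(_ erefl)] := jump_preP j (tau j w) gw.
by have -> : tau j w = i by apply/(jump_preP j i gw).
Qed.

(** The jump out of [n] accounts for the first unit of the gap, so [gap > k] means [k] quiet steps
    starting from [n.+1]. *)
Lemma good_gap_gt j k n w : good_path w -> tau j w = n ->
  (k < jump_gap j w)%N <-> no_jump n.+1 k w.
Proof.
move=> gw <-; have [lt_tau nj xm] := jump_timeSP j gw; rewrite /jump_gap; split.
  move=> kg i ik; apply: nj.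
  by lia.
move=> nj'; rewrite ltnNge; apply/negP => gk.
have := nj' (tau j.+1 w - (tau j w).+1)%N; rewrite subnKC//.
have -> : (tau j.+1 w - (tau j w).+1 < k)%N by lia.
by move=> /(_ isT); rewrite xm.
Qed.

(** The state is constant along a block, so the mark can be read at a time fixed by [tau j] and [k]
    instead of at the random end of the block. *)
Lemma good_mark j k w : good_path w -> (k < jump_gap j w)%N ->
  jump_mark j w = W ((tau j w).+1 + k)%N w.
Proof.
move=> gw kg; have [lt_tau nj xm] := jump_timeSP j gw; rewrite /jump_mark.
have {1}-> : tau j.+1 w = ((tau j w).+1 + (tau j.+1 w - (tau j w).+1))%N by rewrite subnKC.
rewrite (no_jump_const gw nj)// (no_jump_const gw nj)//.
by rewrite /jump_gap in kg; lia.
Qed.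

(** Strong Markov property at [tau j], obtained by summing over its values: on each, a past event
    followed by a jump, a draw from [nu] and [k] quiet steps is the situation of [integral_run]. *)
Lemma gap_mark_law j k A B : block_filtration j A -> measurable B ->
  (P (A `&` ([set w | (k < jump_gap j w)%N] `&` jump_mark j @^-1` B)) =
   P A * \int[nu]_(x in B) (p x ^+ k)%:E)%E.
Proof.
move=> GA mB; have mA := block_filtration_measurable GA.
have mMB : measurable (jump_mark j @^-1` B).
  by rewrite -[X in measurable X]setTI; exact: measurable_mark.
set S := _ `&` jump_mark j @^-1` B.
have mS : measurable S by apply: measurableI => //; exact: measurable_gap_gt.
have mt := measurable_jump_time_eq j.
rewrite (measure_nat_partition mt)//; last exact: measurableI.
rewrite [in RHS](measure_nat_partition mt)//.
set c := (\int[nu]_(x in B) _)%E.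
have pk0 x : 0 <= p x ^+ k by rewrite exprn_ge0.
have mpk : measurable_fun setT (fun x => (p x ^+ k)%:E).
  by apply/measurable_EFinP; exact: measurable_funX.
have cfin : c \is a fin_num.
  rewrite ge0_fin_numE; last by apply: integral_ge0 => x _; rewrite lee_fin.
  apply: (@le_lt_trans _ _ (\int[nu]_(x in B) 1)%E); last first.
    by rewrite integral_cst// mul1e -ge0_fin_numE// fin_num_measure.
  apply: ge0_le_integral => //.
  - by move=> x _; rewrite lee_fin.
  - exact: measurable_funTS.
  - by move=> x _; rewrite lee_fin exprn_ile1.
rewrite muleC -[c]fineK// -nneseriesZl//.
apply: eq_eseriesr => n _; rewrite fineK//.
have [_ /(_ n)[A' FA' AA']] := GA.
(* [D] is known at time [n]; together with the jump at [n.+1] it reproduces [A] and [tau j = n] up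
   to a null event. *)
pose D := A' `&` jump_pre j n.
have FD : F n D by apply: chainI => //; exact: chain_jump_pre.
pose D1 := D `&` xi n.+1 @^-1` [set true].
have FD1 : F n.+1 D1.
  by apply: chainI; [exact: chain_mono FD|exact: chain_xi].
have -> : P (A `&` [set w | tau j w = n]) = P D1.
  apply: ae_measure_eq; [exact: measurableI|exact: chain_measurable FD1|].
  apply: filterS good_ae => w gw; split=> [[Aw tn]|[[A'w pre] xi1]].
    by have [/(_ tn)[pre x1] _] := jump_preP j n gw; split=> //; split=> //; apply/AA'.
  have tn : tau j w = n by apply/jump_preP.
  by split=> //; apply/(AA' w gw tn).
have mW : measurable (W (n.+1 + k)%N @^-1` B).
  by rewrite -[X in measurable X]setTI; exact: measurable_funP.
have FDk : F (n.+1 + k)%N (D1 `&` no_jump n.+1 k).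
  by apply: chainI; [apply: chain_mono FD1; exact: leq_addr|exact: chain_no_jump].
have mDk := chain_measurable FDk.
have -> : P (A `&` S `&` [set w | tau j w = n]) =
    P (D1 `&` no_jump n.+1 k `&` W (n.+1 + k)%N @^-1` B).
  apply: ae_measure_eq; [by apply: measurableI => //; exact: measurableI|exact: measurableI|].
  apply: filterS good_ae => w gw; split=> [[[Aw [kg Bw]] tn]|[[[[A'w pre] xi1] nj] Bw]].
    have [/(_ tn)[pre x1] _] := jump_preP j n gw.
    split; last by move: Bw; rewrite /= (good_mark gw kg) tn.
    split; last exact/(good_gap_gt k gw tn).
    by split=> //; split=> //; apply/AA'.
  have tn : tau j w = n by apply/jump_preP.
  have kg : (k < jump_gap j w)%N by apply/(good_gap_gt k gw tn).
  split=> //; split; first exact/(AA' w gw tn).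
  by split=> //; rewrite /= (good_mark gw kg) tn.
have := @integral_run n k D (fun x => (\1_B x)%:E) FD.
rewrite -/D1 => /(_ _ _).
have -> : (\int[P]_(w in D1 `&` no_jump n.+1 k) (\1_B (W (n.+1 + k)%N w))%:E)%E =
    P (D1 `&` no_jump n.+1 k `&` W (n.+1 + k)%N @^-1` B).
  transitivity (\int[P]_(w in D1 `&` no_jump n.+1 k)
      (\1_(W (n.+1 + k)%N @^-1` B) w)%:E)%E => //.
  by rewrite integral_indic// setIC.
move=> ->.
- rewrite muleC; congr (_ * _)%E; rewrite /c [RHS]integral_mkcond.
  apply: eq_integral => x _; rewrite patchE indicE.
  by case: (x \in B); rewrite ?mul1e ?mul0e.
- exact/measurable_EFinP.
- by move=> x; rewrite lee_fin.
Qed.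

Lemma block_filtrationT j : block_filtration j setT.
Proof.
split=> // n; exists setT => //.
by apply/chain_measurableP; exact: measurableT.
Qed.

Lemma gap_mark_indep j k A B : block_filtration j A -> measurable B ->
  (P (A `&` ([set w | jump_gap j w = k] `&` jump_mark j @^-1` B)) =
   P A * P ([set w | jump_gap 0 w = k] `&` jump_mark 0 @^-1` B))%E.
Proof.
move=> GA mB.
have mA := block_filtration_measurable GA.
have mM i : measurable (jump_mark i @^-1` B).
  by rewrite -[X in measurable X]setTI; exact: measurable_mark.
have mS i l : measurable ([set w | (l < jump_gap i w)%N] `&` jump_mark i @^-1` B).
  by apply: measurableI => //; exact: measurable_gap_gt.
have mE i l : measurable ([set w | jump_gap i w = l] `&` jump_mark i @^-1` B).
  by apply: measurableI => //; exact: measurable_gap_eq.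
case: k => [|k].
  have gap0 i : P ([set w | jump_gap i w = 0%N] `&` jump_mark i @^-1` B) = 0%E.
    rewrite -(measure0 P); apply: ae_measure_eq => //.
    apply: filterS good_ae => w gw; split=> // -[/= g0 _].
    have [lt_tau _ _] := jump_timeSP i gw.
    by move: g0; rewrite /jump_gap; lia.
  rewrite gap0 mule0; apply/eqP; rewrite eq_le measure_ge0 andbT.
  by rewrite -(gap0 j) le_measure ?inE//; exact: measurableI.
(* A gap equal to [k.+1] is the difference of the tails [> k] and [> k.+1], both given by
   [gap_mark_law]. *)
have decomp i C : measurable C -> block_filtration i C ->
    P (C `&` ([set w | jump_gap i w = k.+1] `&` jump_mark i @^-1` B)) =
    (P C * \int[nu]_(x in B) (p x ^+ k)%:E -
     P C * \int[nu]_(x in B) (p x ^+ k.+1)%:E)%E.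
  move=> mC GC; rewrite -!(gap_mark_law _ GC)//.
  set S := fun l => C `&` ([set w | (l < jump_gap i w)%N] `&` jump_mark i @^-1` B).
  have mSl l : measurable (S l) by exact: measurableI.
  have -> : C `&` ([set w | jump_gap i w = k.+1] `&` jump_mark i @^-1` B) = S k `\` S k.+1.
    apply/seteqP; split=> w /=.
      move=> [Cw [gk Bw]]; split; first by split=> //; split=> //=; rewrite gk.
      by move=> [_ [/= + _]]; rewrite gk ltnn.
    move=> [[Cw [/= kg Bw]] nS]; split=> //; split=> //.
    by apply/eqP; rewrite eqn_leq kg andbT leqNgt; apply/negP => kg'; apply: nS.
  rewrite measureD//; last by rewrite ltey_eq fin_num_measure.
  congr (_ - P _)%E; apply/setIidPr => w [Cw [/= kg Bw]].
  by split=> //; split=> //=; exact: ltn_trans kg.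
rewrite decomp//.
have := decomp 0%N setT measurableT (block_filtrationT 0).
have PT : P setT = 1%E := probability_setT P.
rewrite setTI PT !mul1e => ->.
have : (\int[nu]_(x in B) (p x ^+ k.+1)%:E)%E \is a fin_num.
  have := gap_mark_law k.+1 (block_filtrationT 0) mB.
  by rewrite PT mul1e => <-; apply: fin_num_measure; rewrite setTI.
move: (integral _ _ _) (integral _ _ _) => a b bfin.
by rewrite muleBr ?fin_num_measure//; apply: fin_num_adde_defl; rewrite fin_numN.
Qed.

(** A general function of gap and mark, so that block sums and centred gaps share one independence
    statement. *)
Definition block_value (f : nat -> R -> R) j w := f (jump_gap j w) (jump_mark j w).

Lemma measurable_block_value f j : (forall k, measurable_fun setT (f k)) ->
  measurable_fun setT (block_value f j).
Proof.
move=> mf; apply: (measurable_fun_nat_comp (f := fun k w => f k (jump_mark j w))).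
  exact: measurable_gap_eq.
by move=> k; apply: (measurableT_comp (mf k)); exact: measurable_mark.
Qed.

Lemma block_value_preimage f j B : block_value f j @^-1` B =
  \bigcup_k ([set w | jump_gap j w = k] `&` jump_mark j @^-1` (f k @^-1` B)).
Proof.
apply/seteqP; split=> w /=; first by exists (jump_gap j w).
by move=> [k _ [/= <-]].
Qed.

Lemma iid_block_value f : (forall k, measurable_fun setT (f k)) ->
  iid_adapted P block_filtration (block_value f 0) (block_value f).
Proof.
move=> mf.
have mfB k B : measurable B -> measurable (f k @^-1` B).
  by move=> mB; rewrite -[X in measurable X]setTI; exact: mf.
have mbv j B : measurable B -> measurable (block_value f j @^-1` B).
  by move=> mB; rewrite -[X in measurable X]setTI; exact: measurable_block_value.
split.
- exact: sigma_algebra_block.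
- by move=> j A; exact: block_filtration_measurable.
- exact: block_filtration_mono.
- exact: measurable_block_value.
- move=> j B mB; rewrite block_value_preimage.
  have [_ _] := sigma_algebra_block j.+1; apply => k.
  by apply: block_filtration_gap_mark; exact: mfB.
move=> j A B GA mB; have mA := block_filtration_measurable GA.
have split_gap i C k : C `&` block_value f i @^-1` B `&` [set w | jump_gap i w = k] =
    C `&` ([set w | jump_gap i w = k] `&` jump_mark i @^-1` (f k @^-1` B)).
  rewrite -setIA; congr (_ `&` _); rewrite /block_value.
  by apply/seteqP; split=> w /= [] => [Bw <-|<- Bw].
rewrite (measure_nat_partition (measurable_gap_eq j)); last first.
  by apply: measurableI => //; exact: mbv.
rewrite (measure_nat_partition (measurable_gap_eq 0) (mbv 0%N _ mB)).
rewrite -[X in (X * _)%E]fineK ?fin_num_measure// -nneseriesZl//.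
apply: eq_eseriesr => k _; rewrite fineK ?fin_num_measure//.
rewrite split_gap gap_mark_indep//; last exact: mfB.
by congr (_ * _)%E; have := split_gap 0%N setT k; rewrite !setTI => <-.
Qed.

Lemma eseries_const_prefix (n : nat) (c : \bar R) : (0 <= c)%E ->
  (\sum_(k <oo) (if (k < n)%N then c else 0) = n%:R%:E * c)%E.
Proof.
move=> c0; rewrite (nneseries_split 0 n)/=; last by move=> k _; case: ifP.
rewrite eseries0 => [|k nk _]; last by rewrite ltnNge nk.
rewrite adde0 add0n big_nat (eq_bigr (fun=> c)) => [|k /andP[_ ->]//].
rewrite -big_nat; elim: n => [|n IH]; first by rewrite big_geq// mul0e.
rewrite big_nat_recr//= IH -[n.+1%:R]natr1 EFinD ge0_muleDl ?mul1e ?lee_fin//.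
Qed.

(** Writing the gap as the sum over [k] of the indicators of [gap > k] turns the mean into the
    geometric series of [p]. *)
Lemma gap_mean (f : R -> R) : measurable_fun setT f -> (forall x, 0 <= f x) ->
  (\int[P]_w ((jump_gap 0 w)%:R * f (jump_mark 0 w))%:E =
   \int[nu]_x (f x / (1 - p x))%:E)%E.
Proof.
move=> mf f0; pose phi := EFin \o f.
have mphi : measurable_fun setT phi by exact/measurable_EFinP.
have phi0 x : (0 <= phi x)%E by rewrite lee_fin.
have mphim : measurable_fun setT (fun w => phi (jump_mark 0 w)).
  exact: (measurableT_comp mphi (measurable_mark 0)).
have mpk k : measurable_fun setT (fun x => (p x ^+ k)%:E).
  by apply/measurable_EFinP; exact: measurable_funX.
pose S k : set T := [set w | (k < jump_gap 0 w)%N].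
have mS k : measurable (S k) by exact: measurable_gap_gt.
have geo x : (\sum_(k <oo) (p x ^+ k)%:E = ((1 - p x)^-1)%:E)%E.
  apply/cvg_lim => //.
  rewrite (_ : (fun n => _) = EFin \o series (geometric 1 (p x))); last first.
    apply/funext => n; rewrite /= /series /= -sumEFin; apply: eq_bigr => k _.
    by rewrite /geometric /= mul1r.
  apply: cvg_EFin; first exact: nearW.
  rewrite -[X in _ --> X]mul1r.
  by apply: cvg_geometric_series; rewrite ger0_norm//; case/andP: (hp x).
transitivity (\sum_(k <oo) \int[P]_w ((phi \o jump_mark 0) \_ (S k)) w)%E.
  rewrite -integral_nneseries//; last 2 first.
  - by move=> k; apply/(measurable_restrictT _ _).1 => //; exact: measurable_funTS.
  - by move=> k w _; apply: erestrict_ge0 => t _; exact: phi0.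
  apply: eq_integral => w _; rewrite EFinM -(eseries_const_prefix _ (phi0 _)).
  apply: eq_eseriesr => k _; rewrite patchE /S.
  by case: ifPn => [kg|/negP kg]; [rewrite mem_set|rewrite memNset].
under [RHS]eq_integral => x _.
  rewrite EFinM -geo; over.
transitivity (\sum_(k <oo) \int[nu]_x (phi x * (p x ^+ k)%:E))%E.
  apply: eq_eseriesr => k _; rewrite -integral_mkcond.
  rewrite (ge0_integral_restrict_law (m := nu) (f := fun x => p x ^+ k))//.
  - exact: measurable_mark.
  - exact: measurable_funX.
  - by move=> x; rewrite exprn_ge0.
  - move=> B mB; have := gap_mark_law k (block_filtrationT 0) mB.
    by rewrite setTI [X in (_ = X * _)%E -> _]probability_setT mul1e.
rewrite -integral_nneseries//; last 2 first.
- by move=> k; exact: emeasurable_funM.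
- by move=> k x _; rewrite mule_ge0// lee_fin exprn_ge0.
apply: eq_integral => x _; rewrite -nneseriesZl// => k _.
by rewrite lee_fin exprn_ge0.
Qed.

End chain.

(** * Tail estimates from slow variation *)

Section slow_variation.
Context d (T : measurableType d) (R : realType) (P : probability T R).

Lemma Rintegral_dominated_cvg0 (f : nat -> T -> R) (g : T -> R) :
  (forall n, measurable_fun setT (f n)) -> P.-integrable setT (EFin \o g) ->
  (forall n w, `|f n w| <= g w) -> (forall w, f n w @[n --> \oo] --> 0) ->
  \int[P]_w f n w @[n --> \oo] --> 0.
Proof.
move=> mf ig fg f0.
have mfE n : measurable_fun setT (EFin \o f n) by exact/measurable_EFinP.
have f0E : {ae P, forall w, setT w -> (EFin \o f n) w @[n --> \oo] --> cst 0%E w}.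
  by apply: aeW => w _; apply: cvg_EFin; [exact: nearW|exact: f0].
have fgE : {ae P, forall w n, setT w -> `|(EFin \o f n) w| <= (EFin \o g) w}%E.
  by apply: aeW => w n _; rewrite lee_fin.
have [_ _] := dominated_convergence measurableT mfE
  (measurable_cst (0%E : \bar R)) f0E ig fgE.
rewrite (_ : (\int[P]_x cst 0 x)%E = 0%E); last by rewrite integral_cst// mul0e.
by move/fine_cvg.
Qed.

Variables (X : T -> R) (mX : measurable_fun setT X).
Hypothesis iX : P.-integrable setT (EFin \o X).

Local Notation H := (truncated_second_moment P X).

Let mN : measurable_fun setT (fun w => `|X w|).
Proof. exact: measurableT_comp. Qed.

Let tail (y : R) w : R := if y < `|X w| then `|X w| else 0.
Let trunc (y : R) w : R := if `|X w| <= y then X w ^+ 2 else 0.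

Let mtail y : measurable_fun setT (tail y).
Proof. by apply: measurable_fun_ifT => //; exact: measurable_fun_ltr. Qed.

Let tail_le y w : `|tail y w| <= `|X w|.
Proof. by rewrite /tail; case: ifP => _; rewrite ?normr0// normr_id. Qed.

Let itail y : P.-integrable setT (EFin \o tail y).
Proof.
apply: (le_integrable _ _ _ (integrable_norm iX)) => //.
  exact/measurable_EFinP.
by move=> w _; rewrite /= lee_fin normr_id.
Qed.

Let itrunc y : P.-integrable setT (EFin \o trunc y).
Proof. exact: trunc_integrable. Qed.

Let HE y : H y = \int[P]_w trunc y w.
Proof. exact: truncated_second_momentE. Qed.

Let Tl y := \int[P]_w tail y w.

Let Tl_cvg0 e : 0 < e -> exists n0 : nat, forall y, n0%:R <= y -> Tl y <= e.
Proof.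
move=> e0; have : Tl n%:R @[n --> \oo] --> 0.
  apply: (Rintegral_dominated_cvg0 _ (integrable_norm iX)) => // w.
  apply: cvg_near_cst; near=> n; rewrite /tail ltNge.
  suff -> : `|X w| <= n%:R by [].
  by near: n; exact: nbhs_infty_ger.
move=> /cvgrPdist_le/(_ e e0)[n0 _ hn0]; exists n0 => y n0y.
have := hn0 n0 (leqnn _); rewrite sub0r normrN => h.
apply: le_trans (le_trans (ler_norm _) h).
apply: le_Rintegral => // w _; rewrite /tail.
case: ltP => yX; last by case: ifP.
by rewrite (le_lt_trans n0y).
Unshelve. all: by end_near. Qed.

(** Between [y] and [2 y] one has [|X| <= X^2 / y], so this part of the first moment is bounded by
    an increment of [H]. *)
Let Tl_double y : 0 < y -> Tl y <= Tl (2 * y) + y^-1 * (H (2 * y) - H y).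
Proof.
move=> y0; rewrite !HE -RintegralB// -RintegralZl//; last exact: integrable_sub.
rewrite -RintegralD//; last exact/integrable_scale/integrable_sub.
apply: le_Rintegral => //.
  by apply: integrable_add => //; exact/integrable_scale/integrable_sub.
move=> w _; rewrite /tail /trunc.
have X0 := normr_ge0 (X w); have yV0 : 0 < y^-1 by rewrite invr_gt0.
have yy : y * y^-1 = 1 by rewrite divff// gt_eqF.
rewrite -(real_normK (num_real (X w))) !(leNgt `|X w|).
move: `|X w| X0 => u u0.
have [yu|yu] := ltP y u; have [y2u|y2u] /= := ltP (2 * y) u; try lra.
  suff : y^-1 * y * u <= y^-1 * u ^+ 2 by rewrite mulVf ?gt_eqF//; lra.
  by rewrite -mulrA ler_pM2l// expr2 ler_wpM2r// ltW.
Qed.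

(** Iterated doubling; the last tail vanishes since [X] is integrable. One doubling at [z] costs
    [e H z / z] and the later ones [4 e H (2 z) / (2 z) <= 2 e (1 + e) H z / z]; the sum is below
    [4 e H z / z] because [e < 1/2], so the constant 4 reproduces itself. *)
Let small_tail (e y0 : R) : 0 < e -> e < 2^-1 -> 0 < y0 ->
  (forall y, y0 <= y -> 0 < H y /\ H (2 * y) <= (1 + e) * H y) ->
  forall y, y0 <= y -> Tl y <= 4 * e * (H y / y).
Proof.
move=> e0 e2 y00 hH y y0y; apply/ler_addgt0Pr => d1 d10.
have [n0 hn0] := Tl_cvg0 d10.
suff main K z : y0 <= z -> Tl z <= Tl (2 ^+ K * z) + 4 * e * (H z / z).
  have [K hK] : exists K, n0%:R <= 2 ^+ K * y.
    have [K _ hK] := @nbhs_infty_ger R (n0%:R / y).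
    exists K; rewrite -ler_pdivrMr; last exact: lt_le_trans y0y.
    apply: (le_trans (hK K (leqnn _))).
    by rewrite -natrX ler_nat ltnW// ltn_expl.
  by rewrite addrC; apply: (le_trans (main K y y0y)); rewrite lerD2r hn0.
elim: K z => [|K IH] z y0z.
  have [Hz _] := hH z y0z; rewrite expr0 mul1r lerDl.
  by rewrite !mulr_ge0// ?ltW// ?invr_gt0 (lt_le_trans y00).
have z0 : 0 < z by exact: lt_le_trans y0z.
have [Hz H2z] := hH z y0z.
have y02z : y0 <= 2 * z by lra.
have := IH _ y02z; rewrite mulrA -exprSr => h1.
have h2 := Tl_double z0; apply: (le_trans h2).
apply: (le_trans (lerD h1 (lexx _))); rewrite -addrA lerD2l.
rewrite invfM; set v := z^-1; have v0 : 0 < v by rewrite invr_gt0.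
have -> : 4 * e * (H (2 * z) * (2^-1 * v)) = v * (2 * e * H (2 * z)) by field.
have -> : 4 * e * (H z * v) = v * (4 * e * H z) by ring.
rewrite -mulrDr ler_pM2l//.
have hA : 2 * e * H (2 * z) <= 2 * e * ((1 + e) * H z) by rewrite ler_wpM2l// mulr_ge0// ltW.
have hB : e * (e * H z) <= 2^-1 * (e * H z).
  by rewrite ler_wpM2r// ?ltW// mulr_gt0.
lra.
Qed.

(** The cubic part is split at [a y]: below, one factor [|X| / y] is at most [a]; above, it is at
    most 1 and only the increment [H y - H (a y)] is charged, which slow variation makes small. *)
Let third_le (a y : R) : 0 < a -> a < 1 -> 0 < y ->
  tail_mass P X y <= y^-1 * Tl y + (y ^+ 2)^-1 * (a * H y + (H y - H (a * y))).
Proof.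
move=> a0 a1 y0; rewrite !HE -RintegralB//.
rewrite -(RintegralZl a)// -RintegralD//; first last.
- exact: integrable_sub.
- exact: integrable_scale.
have i1 : P.-integrable setT
    (EFin \o (fun w => a * trunc y w + (trunc y w - trunc (a * y) w))).
  by apply: integrable_add; [exact: integrable_scale|exact: integrable_sub].
rewrite -RintegralZl// -RintegralZl// -RintegralD//; first last.
- exact: integrable_scale.
- exact: integrable_scale.
apply: le_Rintegral => //.
- exact: tail_weight_integrable.
- by apply: integrable_add; exact: integrable_scale.
move=> w _; rewrite /tail_weight /tail /trunc.
have X0 := normr_ge0 (X w).
rewrite -(real_normK (num_real (X w))) !(leNgt `|X w|).
move: `|X w| X0 => u u0.
have [yu|yu] /= := ltP y u.
  by rewrite (lt_trans _ yu) ?gtr_pMl//= subrr mulr0 addr0 mulr0 addr0 mulrC.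
rewrite mulr0 add0r -exprVn; set v := y^-1.
have v0 : 0 < v by rewrite invr_gt0.
have t0 : 0 <= u * v by rewrite mulr_ge0// ltW.
have t1 : u * v <= 1 by rewrite ler_pdivrMr// mul1r.
have [yau|yau] /= := ltP (a * y) u.
  rewrite subr0 (_ : v ^+ 2 * _ = (1 + a) * (u * v) ^+ 2); last by ring.
  rewrite exprS ler_wpM2r ?sqr_ge0//; lra.
rewrite subrr addr0 (_ : v ^+ 2 * _ = a * (u * v) ^+ 2); last by ring.
by rewrite exprS ler_wpM2r ?sqr_ge0// ler_pdivrMr.
Qed.

Hypothesis sv : slowly_varying H.

Lemma tail_mass_slowly_varying (eta : R) : 0 < eta ->
  exists y0, forall y, y0 <= y -> 0 < H y /\ tail_mass P X y <= eta * (H y / y ^+ 2).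
Proof.
(* The linear part costs [4 e] and the cubic part [e] twice, hence [eta / 6]; the bound [1/4]
   secures [e < 1/2] for the doubling. The same [e] is the ratio of the split. *)
move=> eta0; pose e := Num.min (eta / 6) 4^-1.
have e0 : 0 < e by rewrite lt_min divr_gt0//= invr_gt0.
have e4 : e <= 4^-1 by rewrite ge_min lexx orbT.
have e6 : 6 * e <= eta by rewrite -ler_pdivlMl// mulrC ge_min lexx.
have [Hpos Hrat] := sv.
have [y1 hy1] : exists y1, forall y, y1 <= y ->
    0 < y /\ 0 < H y /\ H (2 * y) <= (1 + e) * H y /\ (1 - e) * H y <= H (e * y).
  have near1 : \forall y \near +oo, 0 < y /\ 0 < H y /\
      H (2 * y) <= (1 + e) * H y /\ (1 - e) * H y <= H (e * y).
    have /cvgrPdist_le/(_ e e0) r2 := Hrat 2 (ltr0n _ 2).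
    have /cvgrPdist_le/(_ e e0) re := Hrat e e0.
    near=> y; have Hy : 0 < H y by near: y.
    split; first by near: y; exact: nbhs_pinfty_gt.
    split=> //; split.
      have : `|1 - H (2 * y) / H y| <= e by near: y.
      rewrite ler_norml -ler_pdivrMr// => /andP[h _]; lra.
    have : `|1 - H (e * y) / H y| <= e by near: y.
    rewrite ler_norml -ler_pdivlMr// => /andP[_ h]; lra.
  case: near1 => M [Mr hM]; exists (M + 1) => y My; apply: hM.
  by rewrite (lt_le_trans _ My)// ltrDl.
have y10 : 0 < y1 by have [] := hy1 y1 (lexx _).
exists y1 => y y1y; have [y0 [Hy [H2 He]]] := hy1 y y1y; split=> //.
have st : Tl y <= 4 * e * (H y / y).
  apply: (small_tail e0 _ y10) => //; first lra.
  by move=> z y1z; have [_ [? []]] := hy1 z y1z.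
have e1 : e < 1 by lra.
apply: (le_trans (third_le e0 e1 y0)).
rewrite -exprVn; set v := y^-1; have v0 : 0 < v by rewrite invr_gt0.
apply: (@le_trans _ _ (v * (4 * e * (H y * v)) + v ^+ 2 * (e * H y + e * H y))).
  apply: lerD; first by rewrite ler_wpM2l// ltW.
  rewrite ler_wpM2l ?sqr_ge0//; lra.
have -> : v * (4 * e * (H y * v)) + v ^+ 2 * (e * H y + e * H y) =
    6 * e * (H y * v ^+ 2) by ring.
by rewrite ler_wpM2r// mulr_ge0 ?sqr_ge0// ltW.
Unshelve. all: by end_near. Qed.

Variable gamma : nat -> R.
Hypothesis gamma_pos : forall m, (0 < m)%N -> 0 < gamma m.
Hypothesis gamma_infty : gamma m @[m --> \oo] --> +oo.
Hypothesis gamma_equiv :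
  asymp_equiv (fun m => gamma m ^+ 2) (fun m => m%:R * H (gamma m)).

Lemma normalized_variance_cvg1 :
  m%:R * H (gamma m) / gamma m ^+ 2 @[m --> \oo] --> (1 : R).
Proof.
have h := cvgV (oner_neq0 R) gamma_equiv; rewrite invr1 in h.
apply: cvg_trans (h _); apply: near_eq_cvg; apply: nearW => m.
by rewrite /= invf_div.
Qed.

Lemma normalized_tail_mass_cvg0 :
  m%:R * tail_mass P X (gamma m) @[m --> \oo] --> (0 : R).
Proof.
apply/cvgrPdist_le => eta eta0.
(* [eta / 2] suffices because the normalized variance is eventually at most 2. *)
have [y0 hy0] := tail_mass_slowly_varying (divr_gt0 eta0 (ltr0n R 2)).
have /cvgrPdist_le/(_ 1 ltr01) := normalized_variance_cvg1.
move=> nv; near=> m.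
have m0 : (0 < m)%N by near: m; exact: nbhs_infty_gt.
have g0 := gamma_pos m0.
have gy : y0 <= gamma m by near: m; move/cvgryPge : gamma_infty; apply.
have [Hg tg] := hy0 _ gy.
have : `|1 - m%:R * H (gamma m) / gamma m ^+ 2| <= 1 by near: m.
rewrite ler_norml => /andP[h _].
rewrite sub0r normrN ger0_norm; last by rewrite mulr_ge0// tail_mass_ge0.
apply: (@le_trans _ _ (m%:R * (eta / 2 * (H (gamma m) / gamma m ^+ 2)))).
  by rewrite ler_wpM2l.
rewrite mulrCA [m%:R * _]mulrA.
set q := m%:R * H (gamma m) / gamma m ^+ 2 in h *; have q2 : q <= 2 by lra.
have eta2 : 0 <= eta / 2 by rewrite divr_ge0// ltW.
have := ler_wpM2l eta2 q2; lra.
Unshelve. all: by end_near. Qed.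

End slow_variation.

(** * Gaussian moment integrals on the half-line *)

Section gaussian_integrals.
Context (R : realType) (c : R).
Hypothesis c0 : 0 < c.
Local Notation mu := (@lebesgue_measure R).

Definition gauss_kernel (z : R) : R := expR (- (c * z ^+ 2)).
Local Notation E := gauss_kernel.

Instance is_derive_gauss_kernel (z : R) :
  is_derive z (1 : R) E (- (2 * c * z) * E z).
Proof.
rewrite /gauss_kernel; apply: is_derive_eq.
rewrite /GRing.scale /=; ring.
Qed.

Lemma continuous_gauss_kernel : continuous E.
Proof. by move=> z; apply: differentiable_continuous; apply/derivable1_diffP. Qed.

Lemma gauss_kernel_ge0 z : 0 <= E z. Proof. exact: expR_ge0. Qed.

(** From [exp u >= u^2 / 2] at [u = c z^2]. The fourth power leaves a decay of [1 / z] for every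
    [z^k] with [k <= 3]. *)
Let E_bound z : 0 < z -> z ^+ 4 * E z <= 2 / c ^+ 2.
Proof.
move=> z0; have := @expR_ge1Dxn R (c * z ^+ 2) 1.
rewrite (mulr_ge0 (ltW c0) (sqr_ge0 z)) => /(_ isT).
rewrite /E expRN ler_pdivrMr ?expR_gt0// => h.
apply: (@le_trans _ _ (2 / c ^+ 2 * ((c * z ^+ 2) ^+ 2 / 2))); last first.
  rewrite ler_wpM2l ?divr_ge0 ?sqr_ge0//; apply: le_trans h.
  by rewrite (_ : 2`! = 2)// lerDr.
rewrite le_eqVlt; apply/orP; left; apply/eqP; field.
by rewrite gt_eqF.
Qed.

Let cvg_poly_E k : (k <= 3)%N -> z ^+ k * E z @[z --> +oo] --> (0 : R).
Proof.
move=> k3; apply: (@squeeze_cvgr _ _ _ _ (cst 0) (fun z => 2 / c ^+ 2 * z^-1)).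
- near=> z; have z1 : 1 <= z by near: z; exact: nbhs_pinfty_ge.
  have z0 : 0 < z by lra.
  rewrite mulr_ge0 ?exprn_ge0 ?(ltW z0) ?gauss_kernel_ge0//=.
  rewrite ler_pdivlMr//; apply: le_trans (E_bound z0).
  rewrite mulrAC -exprSr ler_wpM2r ?gauss_kernel_ge0//.
  by rewrite ler_weXn2l.
- exact: cvg_cst.
- rewrite -[X in _ --> X](mulr0 (2 / c ^+ 2)); apply: cvgMr.
  apply/gtr0_cvgV0; last exact: cvg_id.
  exact: nbhs_pinfty_gt.
Unshelve. all: by end_near. Qed.

Lemma integral_gauss_third :
  (\int[mu]_(z in `[0%R, +oo[) (z ^+ 3 * E z)%:E = ((2 * c ^+ 2)^-1)%:E)%E.
Proof.
pose F (z : R) := - ((2 * c)^-1 * z ^+ 2 + (2 * c ^+ 2)^-1) * E z.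
have dF (z : R) : is_derive z (1 : R) F (z ^+ 3 * E z).
  rewrite /F; apply: is_derive_eq; rewrite /GRing.scale /=.
  by field; rewrite gt_eqF.
have cF : continuous F.
  by move=> z; apply: differentiable_continuous; apply/derivable1_diffP.
rewrite (@ge0_continuous_FTC2y _ _ F 0 0).
- have -> : F 0 = - (2 * c ^+ 2)^-1.
    by rewrite /F /gauss_kernel expr0n /= !mulr0 oppr0 expR0 add0r mulr1.
  by rewrite -EFinB sub0r opprK.
- by move=> z z0; rewrite mulr_ge0 ?exprn_ge0 ?gauss_kernel_ge0.
- apply: continuous_subspaceT => z; apply: cvgM; last exact: continuous_gauss_kernel.
  exact: exprn_continuous.
- rewrite (_ : F = (fun z => - (2 * c)^-1 * (z ^+ 2 * E z) -
      (2 * c ^+ 2)^-1 * (z ^+ 0 * E z))); last first.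
    by apply/funext => z; rewrite /F expr0; ring.
  rewrite -[X in _ --> X](subr0 0) -[X in _ --> X - _](mulr0 (- (2 * c)^-1)).
  rewrite -[X in _ --> _ - X](mulr0 (2 * c ^+ 2)^-1).
  by apply: cvgB; apply: cvgMr; exact: cvg_poly_E.
- by move=> z _; exact: ex_derive.
- exact: cvg_at_right_filter (cF 0).
- by move=> z _; rewrite derive1E derive_val.
Qed.

(** [k z E z] is an antiderivative of [(k - z^2) E z], which changes sign at [z0 = sqrt k]. The two
    sides of [z0] are treated separately so that all integrands are nonnegative, and the boundary
    value [F z0] then occurs on both sides of the identity. *)
Lemma integral_gauss_second :
  (\int[mu]_(z in `[0%R, +oo[) (z ^+ 2 * E z)%:E =
   ((2 * c)^-1)%:E * \int[mu]_(z in `[0%R, +oo[) (E z)%:E)%E.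
Proof.
pose k := (2 * c)^-1; have k0 : 0 < k by rewrite invr_gt0 mulr_gt0.
have ck : 2 * c * k = 1 by rewrite divff// mulf_neq0// gt_eqF.
pose z0 := Num.sqrt k; have z00 : 0 < z0 by rewrite sqrtr_gt0.
have z0k : z0 ^+ 2 = k by rewrite sqr_sqrtr// ltW.
pose F z := k * z * E z; pose f z := k * E z - z ^+ 2 * E z.
have dF (z : R) : is_derive z (1 : R) F (f z).
  rewrite /F /f; apply: is_derive_eq; rewrite /GRing.scale /=.
  transitivity (k * E z - (2 * c * k) * z ^+ 2 * E z); first by ring.
  by rewrite ck mul1r.
have cF : continuous F.
  by move=> z; apply: differentiable_continuous; apply/derivable1_diffP.
have cz2 : continuous (fun z : R => z ^+ 2 * E z).
  by move=> z; apply: cvgM; [exact: exprn_continuous|exact: continuous_gauss_kernel].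
have ckE : continuous (fun z : R => k * E z).
  by move=> z; apply: cvgMr; exact: continuous_gauss_kernel.
have cf : continuous f by move=> z; apply: cvgB; [exact: ckE|exact: cz2].
have E0 := gauss_kernel_ge0.
have mz2 D : measurable_fun D (fun z : R => (z ^+ 2 * E z)%:E).
  by apply: measurable_funTS; apply/measurable_EFinP; exact: continuous_measurable_fun.
have mkE D : measurable_fun D (fun z : R => (k * E z)%:E).
  by apply: measurable_funTS; apply/measurable_EFinP; exact: continuous_measurable_fun.
have mf D : measurable_fun D (EFin \o f).
  by apply: measurable_funTS; apply/measurable_EFinP; exact: continuous_measurable_fun.
have I1 : (\int[mu]_(z in `[0%R, z0]) (f z)%:E = (F z0)%:E)%E.
  rewrite (@continuous_FTC2 _ f F 0 z0)//.
  - by rewrite {2}/F mulr0 mul0r sube0.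
  - exact: continuous_subspaceT.
  - split.
    + by move=> z _; exact: ex_derive.
    + exact: cvg_at_right_filter (cF 0).
    + exact: cvg_at_left_filter (cF z0).
  - by move=> z _; rewrite derive1E derive_val.
have I2 : (\int[mu]_(z in `[z0, +oo[) (- f z)%:E = (F z0)%:E)%E.
  rewrite (@ge0_continuous_FTC2y _ (fun z => - f z) (fun z => - F z) z0 0)//.
  - by rewrite EFinN oppeK add0e.
  - move=> z z0z; rewrite opprB subr_ge0 ler_wpM2r// -z0k.
    by rewrite lerXn2r// nnegrE ltW// (lt_le_trans z00).
  - by apply: continuous_subspaceT => z; apply: cvgN; exact: cf.
  - rewrite -[X in _ --> X]oppr0; apply: cvgN.
    rewrite (_ : F = (fun z => k * (z ^+ 1 * E z))); last first.
      by apply/funext => z; rewrite /F expr1 mulrA.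
    by rewrite -[X in _ --> X](mulr0 k); apply: cvgMr; exact: cvg_poly_E.
  - by apply: cvgN; exact: cvg_at_right_filter (cF z0).
  - by move=> z _; rewrite derive1E derive_val.
have splitI (h : R -> R) : continuous h -> (forall z, 0 <= h z) ->
    (\int[mu]_(z in `[0%R, +oo[) (h z)%:E =
     \int[mu]_(z in `[0%R, z0]) (h z)%:E + \int[mu]_(z in `[z0, +oo[) (h z)%:E)%E.
  move=> ch h0; have mh D : measurable_fun D (EFin \o h).
    by apply: measurable_funTS; apply/measurable_EFinP; exact: continuous_measurable_fun.
  rewrite (@itv_bndbnd_setU _ _ _ (BRight z0))//; last by rewrite bnd_simp ltW.
  rewrite ge0_integral_setU//=.
  - by rewrite integral_itv_obnd_cbnd.
  - exact: mh.
  - by move=> z _; rewrite lee_fin.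
  - apply/disj_setPS => z [/=]; rewrite !in_itv/= andbT => /andP[_ zz0].
    by rewrite ltNge zz0.
rewrite -ge0_integralZl//; first last.
- by rewrite lee_fin ltW.
- by move=> z _; rewrite lee_fin.
- apply: measurable_funTS; apply/measurable_EFinP.
  exact: (continuous_measurable_fun continuous_gauss_kernel).
under [RHS]eq_integral do rewrite -EFinM.
have kE0 z : 0 <= k * E z by rewrite mulr_ge0// ltW.
have z2E0 z : 0 <= z ^+ 2 * E z by rewrite mulr_ge0// sqr_ge0.
rewrite -/k !splitI//.
have -> : (\int[mu]_(z in `[0%R, z0]) (k * E z)%:E =
    \int[mu]_(z in `[0%R, z0]) (z ^+ 2 * E z)%:E + (F z0)%:E)%E.
  rewrite -I1 -ge0_integralD//=.
  - by apply: eq_integral => z _; rewrite -EFinD /f addrC subrK.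
  - by move=> z _; rewrite lee_fin.
  - exact: mz2.
  - move=> z; rewrite in_itv/= => /andP[zz zz0]; rewrite lee_fin subr_ge0.
    by rewrite ler_wpM2r// -z0k lerXn2r// nnegrE// ltW.
  - exact: mf.
have -> : (\int[mu]_(z in `[z0, +oo[) (z ^+ 2 * E z)%:E =
    \int[mu]_(z in `[z0, +oo[) (k * E z)%:E + (F z0)%:E)%E.
  rewrite -I2 -ge0_integralD//=.
  - by apply: eq_integral => z _; rewrite -EFinD /f opprB addrC subrK.
  - by move=> z _; rewrite lee_fin.
  - exact: mkE.
  - move=> z; rewrite in_itv/= andbT => z0z; rewrite lee_fin opprB subr_ge0.
    by rewrite ler_wpM2r// -z0k lerXn2r// nnegrE ltW// (lt_le_trans z00).
  - by apply: measurable_funTS; apply/measurable_EFinP/measurableT_comp => //; exact: continuous_measurable_fun.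
by rewrite -[RHS]addeA; congr (_ + _)%E; exact: addeC.
Qed.

End gaussian_integrals.

(** * The centred normal law: moments and convolution *)

Section normal.
Context (R : realType).
Local Notation mu := (@lebesgue_measure R).

(* [normal_prob] lives on [measurableTypeR R], which is not the canonical
   measurable structure on [R]; [borel_id] transports it. *)
Definition borel_id : measurableTypeR R -> R := fun x => x.

Lemma measurable_borel_id : measurable_fun setT borel_id.
Proof. by move=> _ B mB; rewrite setTI. Qed.

HB.instance Definition _ :=
  isMeasurableFun.Build _ _ (measurableTypeR R) R borel_id measurable_borel_id.

Definition normal_law (s : R) : probability R R :=
  distribution (normal_prob 0 s) borel_id.

Local Notation N := normal_law.

Lemma ge0_integral_lebesgue_shift (f : R -> \bar R) (c : R) :
  measurable_fun setT f -> (forall x, 0 <= f x)%E ->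
  (\int[mu]_x f (x + c)%R = \int[mu]_x f x)%E.
Proof.
move=> mf f0.
have mphi : @measurable_fun _ _ (measurableTypeR R) (measurableTypeR R) setT
    (fun x : R => x + c) by exact: (@measurable_funD _ R).
pose phi := @mfun_Sub _ _ (measurableTypeR R) (measurableTypeR R)
  (fun x : R => x + c) (mem_set mphi).
rewrite [RHS](eq_measure_integral (pushforward mu phi)); last first.
  move=> A mA _; apply: lebesgue_measure_unique => //= _ [[a b]] _ <-.
  rewrite /pushforward /= (_ : _ @^-1` _ = `](a - c), (b - c)]%classic).
    rewrite !lebesgue_measure_itv/= !lte_fin ltrD2r -!EFinB.
    by rewrite opprB addrA subrK.
  by apply/seteqP; split=> x /=; rewrite !in_itv/= ltrBlDr lerBrDr.
by rewrite ge0_integral_pushforward.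
Qed.

Lemma ge0_integral_lebesgue_opp (f : R -> \bar R) :
  measurable_fun setT f -> (forall x, 0 <= f x)%E ->
  (\int[mu]_x f (- x)%R = \int[mu]_x f x)%E.
Proof.
move=> mf f0.
rewrite [RHS](eq_measure_integral
  (pushforward mu (-%R : _ -> measurableTypeR R))); last first.
  by move=> A mA _; exact/esym/lebesgue_measureN.
by rewrite ge0_integral_pushforward.
Qed.

Lemma ge0_integral_normal (s : R) (f : R -> \bar R) :
  measurable_fun setT f -> (forall x, 0 <= f x)%E ->
  (\int[N s]_x f x = \int[mu]_x (f x * (normal_pdf 0 s x)%:E))%E.
Proof.
move=> mf f0; rewrite ge0_integral_distribution//.
apply: (@ge0_integral_density _ _ _ (normal_prob 0 s)) => //.
- exact: measurable_normal_pdf.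
- by move=> x; exact: normal_pdf_ge0.
Qed.

Lemma normal_pdf_opp (s x : R) : s != 0 -> normal_pdf 0 s (- x) = normal_pdf 0 s x.
Proof. by move=> s0; rewrite !normal_pdfE// /normal_fun !subr0 sqrrN. Qed.

Lemma ge0_integral_normal_opp (s : R) (f : R -> \bar R) : s != 0 ->
  measurable_fun setT f -> (forall x, 0 <= f x)%E ->
  (\int[N s]_x f (- x)%R = \int[N s]_x f x)%E.
Proof.
move=> s0 mf f0; rewrite !ge0_integral_normal//; last exact: measurableT_comp.
rewrite -(@ge0_integral_lebesgue_opp (fun x => f x * (normal_pdf 0 s x)%:E)%E).
- by apply: eq_integral => x _; rewrite normal_pdf_opp.
- by apply: emeasurable_funM => //; apply/measurable_EFinP; exact: measurable_normal_pdf.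
- by move=> x; rewrite mule_ge0// lee_fin normal_pdf_ge0.
Qed.

Lemma normal_peakE (s : R) : 0 < s ->
  normal_peak s = s^-1 * (Num.sqrt (pi *+ 2))^-1.
Proof.
move=> s0; rewrite /normal_peak -mulrnAr sqrtrM ?sqr_ge0// sqrtr_sqr.
by rewrite gtr0_norm// invfM.
Qed.

(** Completing the square: the joint density of [y] and the sum [u] is the density of [u] times the
    conditional density of [y] given [u]. The latter integrates to 1, which yields the convolution
    formula. *)
Lemma normal_pdf_convolution (s t u y : R) : 0 < s -> 0 < t ->
  let r := Num.sqrt (s ^+ 2 + t ^+ 2) in
  normal_pdf 0 t y * normal_pdf 0 s (u - y) =
  normal_pdf 0 r u * normal_pdf (u * t ^+ 2 / r ^+ 2) (s * t / r) y.
Proof.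
move=> s0 t0 r.
have st0 : 0 < s ^+ 2 + t ^+ 2 by rewrite addr_gt0// exprn_gt0.
have r0 : 0 < r by rewrite sqrtr_gt0.
have rE : r ^+ 2 = s ^+ 2 + t ^+ 2 by rewrite sqr_sqrtr// ltW.
have q0 : 0 < s * t / r by rewrite divr_gt0// mulr_gt0.
rewrite !normal_pdfE ?gt_eqF// !normal_peakE// /normal_fun !subr0.
set k := (Num.sqrt _)^-1.
rewrite [LHS]mulrACA [RHS]mulrACA -!expRD; congr (_ * expR _).
  by field; rewrite !gt_eqF.
rewrite !expr_div_n !mulr2n !rE.
by field; rewrite !gt_eqF//= ?addr_gt0 ?exprn_gt0 ?mulr_gt0.
Qed.

Lemma ge0_normal_convolution (s t : R) (h : R -> \bar R) : 0 < s -> 0 < t ->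
  measurable_fun setT h -> (forall x, 0 <= h x)%E ->
  (\int[N t]_y \int[N s]_z h (y + z)%R =
   \int[N (Num.sqrt (s ^+ 2 + t ^+ 2))]_u h u)%E.
Proof.
move=> s0 t0 mh h0.
have pdf0 a m x : (0 <= (normal_pdf m a x : R)%:E)%E by rewrite lee_fin normal_pdf_ge0.
have mpdf a m : measurable_fun setT (fun x : R => (normal_pdf m a x)%:E).
  by apply/measurable_EFinP; exact: measurable_normal_pdf.
have inner y : (\int[N s]_z h (y + z)%R = \int[mu]_u (h u * (normal_pdf 0 s (u - y))%:E))%E.
  have mhy : measurable_fun setT (fun z => h (y + z)).
    by apply: (measurableT_comp mh); exact: measurable_funD.
  rewrite (ge0_integral_normal s mhy (fun z => h0 (y + z))).
  rewrite -(@ge0_integral_lebesgue_shift (fun u => h u * (normal_pdf 0 s (u - y))%:E)%E y).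
  - by apply: eq_integral => z _; rewrite addrK addrC.
  - apply: emeasurable_funM => //; apply: (measurableT_comp (mpdf s 0)).
    exact: measurable_funB.
  - by move=> u; rewrite mule_ge0.
under eq_integral do rewrite inner.
pose F (z : R * R) : \bar R :=
  (h z.2 * (normal_pdf 0 s (z.2 - z.1))%:E * (normal_pdf 0 t z.1)%:E)%E.
have F0 z : (0 <= F z)%E by rewrite !mule_ge0.
have mF : measurable_fun setT F.
  apply: emeasurable_funM; last exact: (measurableT_comp (mpdf t 0)).
  apply: emeasurable_funM; first exact: (measurableT_comp mh).
  by apply: (measurableT_comp (mpdf s 0)); exact: measurable_funB.
transitivity (\int[mu]_y \int[mu]_u F (y, u))%E.
  rewrite ge0_integral_normal; last 2 first.
  - pose F' (z : R * R) : \bar R := (h z.2 * (normal_pdf 0 s (z.2 - z.1))%:E)%E.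
    apply: (@measurable_fun_fubini_tonelli_F _ _ _ _ _ mu F').
      apply: emeasurable_funM; first exact: (measurableT_comp mh).
      by apply: (measurableT_comp (mpdf s 0)); exact: measurable_funB.
    by move=> z; rewrite mule_ge0.
  - by move=> y; apply: integral_ge0 => u _; rewrite mule_ge0.
  apply: eq_integral => y _; rewrite -ge0_integralZr//.
  - apply: emeasurable_funM => //; apply: (measurableT_comp (mpdf s 0)).
    exact: measurable_funB.
  - by move=> u _; rewrite mule_ge0.
rewrite (@fubini_tonelli _ _ _ _ _ mu mu F mF F0).
rewrite ge0_integral_normal//; apply: eq_integral => u _.
under eq_integral => y _.
  rewrite /F /= -muleA -EFinM [(_ * normal_pdf 0 t y)%R]mulrC normal_pdf_convolution// EFinM muleA.
  over.
rewrite ge0_integralZl//; [|exact: mpdf|by rewrite mule_ge0].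
by rewrite integral_normal_pdf mule1.
Qed.

Lemma ge0_integral_normal_even (s : R) (f : R -> R) : 0 < s -> continuous f ->
  (forall x, 0 <= f x) -> (forall x, f (- x) = f x) ->
  (\int[N s]_x (f x)%:E = (2 * normal_peak s)%:E *
    \int[mu]_(x in `[0%R, +oo[) (f x * gauss_kernel (2 * s ^+ 2)^-1 x)%:E)%E.
Proof.
move=> s0 cf f0 fN; have s00 : s != 0 by rewrite gt_eqF.
have mf : measurable_fun setT f by exact: continuous_measurable_fun.
have cg : continuous (gauss_kernel (2 * s ^+ 2)^-1) by exact: continuous_gauss_kernel.
have g0 := gauss_kernel_ge0 (2 * s ^+ 2)^-1.
have p0 : 0 <= normal_peak s by exact: normal_peak_ge0.
rewrite ge0_integral_normal//; last exact/measurable_EFinP.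
pose G x := f x * (normal_peak s * gauss_kernel (2 * s ^+ 2)^-1 x).
have pdfE x : normal_pdf 0 s x = normal_peak s * gauss_kernel (2 * s ^+ 2)^-1 x.
  rewrite normal_pdfE// /normal_fun subr0; congr (_ * expR _).
  by rewrite mulNr mulrC -mulr_natl.
have cG : continuous G.
  by move=> x; apply: cvgM; [exact: cf|apply: cvgMr; exact: cg].
transitivity (\int[mu]_x (G x)%:E)%E.
  by apply: eq_integral => x _; rewrite -EFinM pdfE.
rewrite ge0_symfun_integralT//; last 2 first.
- by move=> x; rewrite !mulr_ge0.
- by move=> x; rewrite /G /= fN /gauss_kernel sqrrN.
rewrite -set_itvcy EFinM -muleA; congr (_ * _)%E.
rewrite -ge0_integralZl//.
- by apply: eq_integral => x _; rewrite -EFinM /G mulrCA.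
- apply: measurable_funTS; apply/measurable_EFinP; apply: measurable_funM => //.
  exact: continuous_measurable_fun.
- by move=> x _; rewrite lee_fin mulr_ge0.
Qed.

Lemma normal_second_moment (s : R) : 0 < s ->
  (\int[N s]_x (x ^+ 2)%:E = (s ^+ 2)%:E)%E.
Proof.
move=> s0; set c := (2 * s ^+ 2)^-1.
have c0 : 0 < c by rewrite invr_gt0 mulr_gt0// exprn_gt0.
rewrite ge0_integral_normal_even//; first last.
- by move=> x; rewrite sqrrN.
- by move=> x; rewrite sqr_ge0.
- exact: exprn_continuous.
rewrite -/c integral_gauss_second//.
(* The same formula for the constant 1 expresses the mass of the kernel, so its closed form is never
   computed here. *)
have := @ge0_integral_normal_even s (fun=> 1) s0 (fun x => cvg_cst _)
  (fun=> ler01) (fun=> erefl).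
rewrite integral_cst//= [X in (1 * X)%E]probability_setT mule1 -/c.
under eq_integral do rewrite mul1r.
move=> I1; rewrite muleCA -I1 mule1; congr (_%:E).
by rewrite /c; field; rewrite gt_eqF.
Qed.

(** The third absolute moment of the standard normal law, [2 sqrt (2 / pi)]. *)
Definition abs3_normal : R := 4 * (Num.sqrt (pi *+ 2))^-1.

Lemma normal_third_moment (s : R) : 0 < s ->
  (\int[N s]_x (`|x| ^+ 3)%:E = (abs3_normal * s ^+ 3)%:E)%E.
Proof.
move=> s0; set c := (2 * s ^+ 2)^-1.
have c0 : 0 < c by rewrite invr_gt0 mulr_gt0// exprn_gt0.
rewrite ge0_integral_normal_even//; first last.
- by move=> x; rewrite normrN.
- move=> x; apply: (@continuous_comp _ _ _ (fun x : R => `|x|) (fun x => x ^+ 3)).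
    exact: norm_continuous.
  exact: exprn_continuous.
transitivity ((2 * normal_peak s)%:E *
    \int[mu]_(x in `[0%R, +oo[) (x ^+ 3 * gauss_kernel c x)%:E)%E.
  congr (_ * _)%E; apply: eq_integral => x; rewrite inE /= in_itv/= andbT => x0.
  by rewrite ger0_norm.
rewrite integral_gauss_third// -EFinM normal_peakE// /abs3_normal /c.
have r0 : 0 < Num.sqrt (pi *+ 2 : R) by rewrite sqrtr_gt0 mulrn_wgt0// pi_gt0.
by congr (_%:E); field; rewrite !gt_eqF.
Qed.

Lemma normal_integrable_id (s : R) : 0 < s ->
  (N s).-integrable setT (EFin \o (fun x : R => x)).
Proof.
move=> s0.
have i2 : (N s).-integrable setT (EFin \o (fun x : R => 1 + x ^+ 2)).
  apply: integrable_add; first exact: cst_integrable.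
  apply/integrableP; split; first by apply/measurable_EFinP; exact: measurable_funX.
  under eq_integral => x _ do rewrite /= ger0_norm ?sqr_ge0//.
  by rewrite normal_second_moment// ltry.
apply: (le_integrable _ _ _ i2) => //; first exact/measurable_EFinP.
move=> x _; rewrite /= lee_fin [leRHS]ger0_norm ?addr_ge0 ?sqr_ge0//.
by rewrite -(real_normK (num_real x)); have := normr_ge0 x; nra.
Qed.

Lemma normal_mean0 (s : R) : 0 < s -> \int[N s]_x x = 0.
Proof.
move=> s0; rewrite /Rintegral; have s00 : s != 0 by rewrite gt_eqF.
have ii := normal_integrable_id s0.
rewrite integralE.
have -> : (\int[N s]_x (fun x : R => x%:E)^\- x = \int[N s]_x (fun x : R => x%:E)^\+ x)%E.
  rewrite -[RHS]ge0_integral_normal_opp//.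
    by apply: eq_integral => x _; rewrite funenegE funeposE EFinN.
  by apply: measurable_funepos; apply/measurable_EFinP.
rewrite subee//.
exact: (integrable_pos_fin_num _ ii).
Qed.

(** The Gaussian counterpart of [step_taylor]: in the difference of the two, the quadratic terms
    cancel up to the mismatch of the variances. *)
Lemma normal_step (s C : R) (h h1 h2 : R -> R) (x : R) : 0 < s -> taylor2 C h h1 h2 ->
  `|average (N s) h x - h x - h2 x / 2 * s ^+ 2| <= C * (abs3_normal * s ^+ 3).
Proof.
move=> s0 [mh mh1 mh2 hC h1C h2C hrem].
have C0 : 0 <= C by exact: le_trans (normr_ge0 _) (hC 0).
have mhx : measurable_fun setT (fun z : R => h (x + z)).
  by apply: (measurableT_comp mh); exact: measurable_funD.
have ih : (N s).-integrable setT (EFin \o (fun z : R => h (x + z))).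
  exact: (@bounded_integrable _ _ _ _ _ C).
have i2 : (N s).-integrable setT (EFin \o (fun z : R => z ^+ 2)).
  apply/integrableP; split; first by apply/measurable_EFinP; exact: measurable_funX.
  under eq_integral => z _ do rewrite /= ger0_norm ?sqr_ge0//.
  by rewrite normal_second_moment// ltry.
have i3 : (N s).-integrable setT (EFin \o (fun z : R => `|z| ^+ 3)).
  apply/integrableP; split.
    apply/measurable_EFinP; apply: measurable_funX.
    by apply: continuous_measurable_fun; exact: norm_continuous.
  under eq_integral => z _ do rewrite /= ger0_norm ?exprn_ge0//.
  by rewrite normal_third_moment// ltry.
have ihx := cst_integrable (N s) (h x).
have i1' := integrable_scale (h1 x) (normal_integrable_id s0).
have i2' := integrable_scale (h2 x / 2) i2.
have iA := integrable_sub ih ihx; have iB := integrable_sub iA i1'.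
have iD := integrable_sub iB i2'.
have -> : average (N s) h x - h x - h2 x / 2 * s ^+ 2 =
    \int[N s]_z (h (x + z) - h x - h1 x * z - h2 x / 2 * z ^+ 2).
  rewrite RintegralB// RintegralB// RintegralB// Rintegral_prob_cst.
  rewrite RintegralZl//; last exact: normal_integrable_id.
  rewrite normal_mean0// mulr0 subr0 RintegralZl//.
  by rewrite /Rintegral normal_second_moment.
apply: (le_trans (le_normr_Rintegral _ iD)) => //.
rewrite (_ : abs3_normal * _ = \int[N s]_z `|z| ^+ 3); last first.
  by rewrite /Rintegral normal_third_moment.
rewrite -RintegralZl//; apply: le_Rintegral => //.
- exact: (integrable_norm iD).
- exact: integrable_scale.
Qed.

Lemma average_convolution (s t C : R) (h : R -> R) (x : R) : 0 < s -> 0 < t ->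
  measurable_fun setT h -> (forall x, `|h x| <= C) ->
  average (N t) (average (N s) h) x =
  average (N (Num.sqrt (s ^+ 2 + t ^+ 2))) h x.
Proof.
move=> s0 t0 mh hC.
have mhC : measurable_fun setT (fun z => h (x + z) + C).
  apply: measurable_funD => //.
  by apply: (measurableT_comp mh); exact: measurable_funD.
have hC0 u : 0 <= h u + C by have := hC u; rewrite ler_norml; lra.
have ish (Q : probability R R) u : Q.-integrable setT (EFin \o (fun z : R => h (u + z))).
  apply: (@bounded_integrable _ _ _ _ _ C) => //.
  by apply: (measurableT_comp mh); exact: measurable_funD.
have addC (Q : probability R R) u : average Q h u + C = \int[Q]_z (h (u + z) + C).
  rewrite RintegralD//; [|exact: ish|exact: cst_integrable].
  by rewrite Rintegral_prob_cst.
have ma := measurable_average (N s) mh hC.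
have aC u : `|average (N s) h u| <= C.
  apply: Rintegral_bound => //.
  by apply: (measurableT_comp mh); exact: measurable_funD.
have iav : (N t).-integrable setT (EFin \o (fun y : R => average (N s) h (x + y))).
  apply: (@bounded_integrable _ _ _ _ _ C) => //.
  by apply: (measurableT_comp ma); exact: measurable_funD.
have addCt : \int[N t]_y (average (N s) h (x + y) + C) =
    average (N t) (average (N s) h) x + C.
  have iC := cst_integrable (N t) C.
  have -> := RintegralD measurableT iav iC.
  by rewrite (Rintegral_prob_cst (N t) C).
suff : \int[N t]_y (average (N s) h (x + y) + C) =
    \int[N (Num.sqrt (s ^+ 2 + t ^+ 2))]_u (h (x + u) + C).
  by rewrite addCt -(addC (N (Num.sqrt (s ^+ 2 + t ^+ 2))) x) => /addIr.
clear addCt.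
have mhE : measurable_fun setT (fun u => (h (x + u) + C)%:E).
  exact/measurable_EFinP.
have := @ge0_normal_convolution s t _ s0 t0 mhE (fun u => hC0 (x + u)).
rewrite {2}/Rintegral => <-; congr (fine _).
apply: eq_integral => y _; rewrite (addC (N s) (x + y)) /Rintegral fineK.
  by apply: eq_integral => z _; rewrite addrA.
apply: integrable_fin_num => //.
exact: (integrable_add (ish (N s) (x + y)) (cst_integrable (N s) C)).
Qed.

(** Variances add, so deviations grow like the square root of the number of averages. The count
    starts at one because the convolution formula requires positive deviations. *)
Lemma iter_average_normal (t C : R) (h : R -> R) m (x : R) : 0 < t ->
  measurable_fun setT h -> (forall x, `|h x| <= C) ->
  iter m.+1 (average (N t)) h x = average (N (t * Num.sqrt m.+1%:R)) h x.
Proof.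
move=> t0 mh hC; elim: m x => [|m IH] x; first by rewrite /= sqrtr1 mulr1.
rewrite iterS.
transitivity (average (N t) (average (N (t * Num.sqrt m.+1%:R)) h) x).
  by apply: eq_Rintegral => z _; rewrite IH.
have ts0 : 0 < t * Num.sqrt m.+1%:R by rewrite mulr_gt0// sqrtr_gt0 ltr0n.
rewrite (average_convolution x ts0 t0 mh hC).
congr (average (N _) h x).
rewrite exprMn sqr_sqrtr// -[m.+2%:R]natr1 -[X in Num.sqrt (_ + X)]mulr1 -mulrDr.
by rewrite sqrtrM ?sqr_ge0// sqrtr_sqr gtr0_norm.
Qed.

End normal.

(** * Smooth test functions built from the logistic function *)

Section test_functions.
Context (R : realType).
Implicit Types (h F : R -> R) (C : R) (q : {poly R}).

Lemma is_derive_continuous (F F' : R -> R) :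
  (forall z, is_derive z (1 : R) F (F' z)) -> continuous F.
Proof.
by move=> dF z; apply: differentiable_continuous; apply/derivable1_diffP; case: (dF z).
Qed.

Lemma MVT_norm (F F' : R -> R) (B y : R) :
  (forall z, is_derive z (1 : R) F (F' z)) ->
  (forall z, `|z| <= `|y| -> `|F' z| <= B) -> `|F y - F 0| <= B * `|y|.
Proof.
move=> dF dB; have cF := is_derive_continuous dF.
have [y0|y0] := leP 0 y.
  have [z] := MVT_segment y0 (fun z _ => dF z) (continuous_subspaceT cF).
  rewrite in_itv/= => /andP[z0 zy] ->; rewrite subr0 normrM ler_wpM2r//.
  by apply: dB; rewrite !ger0_norm.
have [z] := MVT_segment (ltW y0) (fun z _ => dF z) (continuous_subspaceT cF).
rewrite in_itv/= => /andP[z0 zy] zE; rewrite distrC zE sub0r normrM normrN ler_wpM2r//.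
by apply: dB; rewrite !ler0_norm ?lerN2// ltW.
Qed.

(** Three applications of [MVT_norm] raise the order of the remainder by one each; the factor [1/6]
    of the sharp bound is given up. *)
Lemma taylor2_derive C (h h1 h2 h3 : R -> R) :
  (forall z, is_derive z (1 : R) h (h1 z)) ->
  (forall z, is_derive z (1 : R) h1 (h2 z)) ->
  (forall z, is_derive z (1 : R) h2 (h3 z)) ->
  (forall z, `|h z| <= C) -> (forall z, `|h1 z| <= C) ->
  (forall z, `|h2 z| <= C) -> (forall z, `|h3 z| <= C) ->
  taylor2 C h h1 h2.
Proof.
move=> d1 d2 d3 hC h1C h2C h3C.
have C0 : 0 <= C by exact: le_trans (normr_ge0 _) (hC 0).
have md (F F' : R -> R) : (forall z, is_derive z (1 : R) F (F' z)) ->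
    measurable_fun setT F.
  by move=> /is_derive_continuous/continuous_measurable_fun.
apply: Build_taylor2; [exact: md d1|exact: md d2|exact: md d3|done|done|done|] => x y.
have shift (F F' : R -> R) : (forall z, is_derive z (1 : R) F (F' z)) ->
    forall z, is_derive z (1 : R) (fun z => F (x + z)) (F' (x + z)).
  move=> dF z; have := dF (x + z) => dFz; apply: is_derive_eq.
  by rewrite add0r mulr1.
have e2 z : `|h2 (x + z) - h2 x| <= C * `|z|.
  by have := MVT_norm (shift _ _ d3) (fun t (_ : `|t| <= `|z|) => h3C (x + t)); rewrite addr0.
have e1 z : `|h1 (x + z) - h1 x - h2 x * z| <= C * `|z| ^+ 2.
  pose F t := h1 (x + t) - h1 x - h2 x * t.
  have dF t : is_derive t (1 : R) F (h2 (x + t) - h2 x).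
    have := shift _ _ d2 t => dt; apply: is_derive_eq.
    by rewrite /GRing.scale /= subr0 mulr1.
  have := @MVT_norm F _ (C * `|z|) z dF.
  rewrite {2}/F addr0 subrr mulr0 !subr0 expr2 mulrA; apply=> t tz.
  by apply: le_trans (e2 t) _; rewrite ler_wpM2l.
pose F t := h (x + t) - h x - h1 x * t - h2 x / 2 * t ^+ 2.
have dF t : is_derive t (1 : R) F (h1 (x + t) - h1 x - h2 x * t).
  have := shift _ _ d1 t => dt; apply: is_derive_eq.
  by rewrite /GRing.scale /=; field.
have := @MVT_norm F _ (C * `|y| ^+ 2) y dF.
rewrite {2}/F addr0 subrr expr0n /= !mulr0 !subr0 -mulrA -exprSr; apply=> t tz.
by apply: le_trans (e1 t) _; rewrite ler_wpM2l// lerXn2r ?nnegrE.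
Qed.

Lemma taylor2_affine C (h h1 h2 : R -> R) (k b : R) : taylor2 C h h1 h2 ->
  taylor2 (C * (1 + `|k|) ^+ 3) (fun y => h (k * y + b))
    (fun y => k * h1 (k * y + b)) (fun y => k ^+ 2 * h2 (k * y + b)).
Proof.
case=> mh mh1 mh2 hC h1C h2C hrem.
have C0 : 0 <= C by exact: le_trans (normr_ge0 _) (hC 0).
have mk : measurable_fun setT (fun y : R => k * y + b).
  by apply: measurable_funD => //; exact: mulrl_measurable.
have ck n : (n <= 3)%N -> `|k| ^+ n <= (1 + `|k|) ^+ 3.
  move=> n3; apply: (@le_trans _ _ ((1 + `|k|) ^+ n)).
    by rewrite lerXn2r ?nnegrE ?addr_ge0// lerDr.
  by rewrite ler_weXn2l// lerDl.
split.
- exact: (measurableT_comp mh).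
- by apply: measurable_funM => //; exact: (measurableT_comp mh1).
- by apply: measurable_funM => //; exact: (measurableT_comp mh2).
- move=> x; apply: le_trans (hC _) _; rewrite ler_peMr//.
  by have := ck 0%N isT; rewrite expr0.
- by move=> x; rewrite normrM mulrC ler_pM// (ck 1%N).
- by move=> x; rewrite normrM normrX mulrC ler_pM// (ck 2%N).
- move=> x y; rewrite mulrDr (addrAC (k * x)).
  have := hrem (k * x + b) (k * y).
  rewrite (_ : h2 _ / 2 * (k * y) ^+ 2 = k ^+ 2 * h2 (k * x + b) / 2 * y ^+ 2); last by field.
  rewrite (_ : h1 _ * (k * y) = k * h1 (k * x + b) * y); last by ring.
  move=> /le_trans; apply; rewrite normrM exprMn -mulrA ler_wpM2l//.
  by rewrite ler_wpM2r// (ck 3%N).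
Qed.

(** A decreasing sigmoid with [l' = l^2 - l]. Derivatives of a polynomial in [l] are again
    polynomials in [l], and [l] lies between 0 and 1, so all of them are bounded. *)
Definition logistic (y : R) : R := (1 + expR y)^-1.

Lemma logistic_gt0 y : 0 < logistic y.
Proof. by rewrite invr_gt0 addr_gt0// expR_gt0. Qed.

Lemma logistic_lt1 y : logistic y < 1.
Proof. by rewrite invf_lt1 ?ltrDl ?expR_gt0// addr_gt0// expR_gt0. Qed.

Lemma logistic_decr x y : x <= y -> logistic y <= logistic x.
Proof.
by move=> xy; rewrite lef_pV2 ?posrE ?addr_gt0 ?expR_gt0// lerD2l ler_expR.
Qed.

Lemma logistic0 : logistic 0 = 2^-1.
Proof. by rewrite /logistic expR0. Qed.

Lemma logistic_opp y : logistic (- y) = 1 - logistic y.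
Proof.
have := expR_gt0 y => y0; rewrite /logistic expRN; field.
by rewrite !gt_eqF// addr_gt0.
Qed.

Lemma logistic_le y : 0 < y -> logistic y <= y^-1.
Proof.
move=> y0; rewrite lef_pV2 ?posrE ?addr_gt0 ?expR_gt0//.
by have := expR_ge1Dx y; lra.
Qed.

Lemma is_derive_logistic_poly q y :
  is_derive y (1 : R) (fun z => q.[logistic z])
    (q^`() * ('X ^+ 2 - 'X)).[logistic y].
Proof.
have e0 : 1 + expR y != 0 by rewrite gt_eqF// addr_gt0// expR_gt0.
have dl : is_derive y (1 : R) logistic (logistic y ^+ 2 - logistic y).
  have : is_derive y (1 : R) (fun z : R => 1 + expR z) (expR y).
    by apply: is_derive_eq (is_deriveD _ _) _; rewrite add0r.
  move=> d1; have := is_deriveV (f := fun z : R => 1 + expR z) e0 d1 => dV.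
  apply: is_derive_eq.
  by rewrite /GRing.scale /= /logistic; field.
have := is_derive_poly q (logistic y) => dq.
by apply: is_derive_eq; rewrite hornerM !hornerE mulrC.
Qed.

Lemma poly_bound01 q : exists C, forall u : R, 0 <= u <= 1 -> `|q.[u]| <= C.
Proof.
exists (\sum_(i < size q) `|q`_i|) => u /andP[u0 u1].
rewrite horner_coef; apply: le_trans (ler_norm_sum _ _ _) _.
apply: ler_sum => i _; rewrite normrM ler_piMr// normrX exprn_ile1//.
by rewrite ger0_norm.
Qed.

Lemma taylor2_logistic_poly q : exists C, exists h1 h2,
  taylor2 C (fun y => q.[logistic y]) h1 h2.
Proof.
pose D (r : {poly R}) := r^`() * ('X ^+ 2 - 'X).
have dD r z : is_derive z (1 : R) (fun y => r.[logistic y]) (D r).[logistic z].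
  exact: is_derive_logistic_poly.
clearbody D.
have l01 y : 0 <= logistic y <= 1 by rewrite !ltW ?logistic_gt0 ?logistic_lt1.
have bnd r : exists C, forall y, `|r.[logistic y]| <= C.
  by have [C hC] := poly_bound01 r; exists C => y; exact: hC.
have [C0 B0] := bnd q; have [C1 B1] := bnd (D q).
have [C2 B2] := bnd (D (D q)); have [C3 B3] := bnd (D (D (D q))).
exists (Num.max (Num.max C0 C1) (Num.max C2 C3)).
exists (fun y => (D q).[logistic y]), (fun y => (D (D q)).[logistic y]).
apply: (taylor2_derive (dD q) (dD (D q)) (dD (D (D q)))) => z.
- by rewrite !le_max B0.
- by rewrite !le_max B1 orbT.
- by rewrite !le_max B2 orbT.
- by rewrite !le_max B3 !orbT.
Qed.

Lemma smooth_step (x delta eta : R) : 0 < delta -> 0 < eta ->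
  exists C h h1 h2, [/\ taylor2 C h h1 h2, (forall v, 0 <= h v <= 1),
    (forall v, v <= x -> 1 - eta <= h v) &
    (forall v, x + delta <= v -> h v <= eta)].
Proof.
move=> d0 eta0; have [C [h1 [h2 th]]] := taylor2_logistic_poly 'X.
(* The step is centred at [x + delta / 2] and its slope gives [k delta / 2 = 1 / eta]: at distance
   [delta / 2] from the centre, the bound [l y <= 1 / y] already yields [eta]. *)
pose k := 2 / (delta * eta); pose b := - k * (x + delta / 2).
have k0 : 0 < k by rewrite divr_gt0// mulr_gt0.
have kd : k * (delta / 2) = eta^-1.
  by rewrite /k; field; rewrite !gt_eqF.
have le_eta y : eta^-1 <= y -> logistic y <= eta.
  move=> ey; have y0 : 0 < y by apply: lt_le_trans ey; rewrite invr_gt0.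
  by apply: (le_trans (logistic_le y0)); rewrite invf_ple.
have := taylor2_affine k b th => th'.
do 4 eexists; split; first exact: th'.
- by move=> v /=; rewrite hornerX !ltW ?logistic_gt0 ?logistic_lt1.
- move=> v vx /=; rewrite hornerX -[k * v + b]opprK logistic_opp lerB//.
  apply: le_eta; rewrite -kd /b.
  rewrite (_ : - (k * v + _) = k * (x - v + delta / 2)); last by ring.
  by rewrite ler_wpM2l ?(ltW k0)// lerDr subr_ge0.
- move=> v xv /=; rewrite hornerX; apply: le_eta; rewrite -kd /b.
  rewrite (_ : k * v + _ = k * (v - x - delta / 2)); last by ring.
  by rewrite ler_wpM2l ?(ltW k0)//; lra.
Qed.

(** The well is [tanh^2 (y / 2)], written as the polynomial [(1 - 2 l)^2] in the logistic function;
    it is even and increases with [|y|]. *)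
Lemma smooth_well (e : R) : 0 < e ->
  exists C f f1 f2 c, [/\ taylor2 C f f1 f2, f 0 = 0, (forall x, 0 <= f x), 0 < c &
    (forall x, e <= `|x| -> c <= f x)].
Proof.
move=> e0; have [C [f1 [f2 tf]]] := taylor2_logistic_poly ((1 - 2 *: 'X) ^+ 2).
have E y : ((1 - 2 *: 'X) ^+ 2).[logistic y] = (1 - 2 * logistic y) ^+ 2.
  by rewrite !hornerE.
have le0 : logistic e < 2^-1.
  rewrite ltf_pV2 ?posrE ?addr_gt0 ?expR_gt0// ltrD2l.
  by have := expR_gt1Dx; rewrite -[X in X < _]expR0 ltr_expR.
exists C, (fun y => ((1 - 2 *: 'X) ^+ 2).[logistic y]), f1, f2.
exists ((1 - 2 * logistic e) ^+ 2); split=> //.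
- by rewrite E logistic0 divff// subrr expr0n.
- by move=> x; rewrite E sqr_ge0.
- by rewrite exprn_gt0//; lra.
- move=> x; rewrite E; have [x0|x0] := leP 0 x.
    rewrite ger0_norm// => ex; have := logistic_decr ex => lx.
    by rewrite lerXn2r ?nnegrE//; lra.
  rewrite ltr0_norm// => ex; have := logistic_decr ex.
  rewrite logistic_opp => lx.
  rewrite -[leRHS]sqrrN lerXn2r ?nnegrE//; lra.
Qed.

End test_functions.

(** * Distribution function of the normal law *)

Section normal_cdf.
Context (R : realType).

Lemma normal_law_itv_le (s a b : R) : 0 < s -> a <= b ->
  (normal_law s `]a, b]%classic <= (normal_peak s * (b - a))%:E)%E.
Proof.
move=> s0 ab; have s00 : s != 0 by rewrite gt_eqF.
change (normal_law s `]a, b]%classic) with (normal_prob 0 s `]a, b]%classic).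
rewrite /normal_prob.
apply: (@le_trans _ _ (\int[@lebesgue_measure R]_(x in `]a, b]%classic) (normal_peak s)%:E)%E).
  apply: ge0_le_integral => //.
  - by move=> x _; rewrite lee_fin normal_pdf_ge0.
  - by apply: measurable_funTS; apply/measurable_EFinP; exact: measurable_normal_pdf.
  - by move=> x _; rewrite lee_fin normal_pdf_ub.
rewrite integral_cst//= lebesgue_measure_itv/= lte_fin.
case: ltP => [_|ba]; first by rewrite -EFinB -EFinM.
by rewrite mule0 lee_fin mulr_ge0 ?normal_peak_ge0 ?subr_ge0.
Qed.

Lemma normal_cdf_incr (s a b : R) : 0 < s -> a <= b ->
  (normal_law s `]-oo, b]%classic <= normal_law s `]-oo, a]%classic + (normal_peak s * (b - a))%:E)%E.
Proof.
move=> s0 ab; rewrite (@itv_bndbnd_setU _ _ -oo%O (BRight a))// ?bnd_simp//.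
apply: le_trans (measureU2 _ _ _) _ => //.
by rewrite leeD2l// normal_law_itv_le.
Qed.

Lemma normal_cdf_tails (s e : R) : 0 < e ->
  exists a b : R, [/\ a < b, (normal_law s `]-oo, a]%classic <= e%:E)%E &
    ((1 - e)%:E <= normal_law s `]-oo, b]%classic)%E].
Proof.
move=> e0.
have c0 := @fine_cvg _ _ _ _ _ _ (cvg_cdfNy0 (@borel_id R : {RV (normal_prob 0 s) >-> R})).
have c1 := @fine_cvg _ _ _ _ _ _ (cvg_cdfy1 (@borel_id R : {RV (normal_prob 0 s) >-> R})).
have : \forall a \near -oo%R, a < 0 /\ (normal_law s `]-oo, a]%classic <= e%:E)%E.
  near=> a; split; first by near: a; exact: nbhs_ninfty_lt.
  rewrite -[X in (X <= _)%E]fineK ?fin_num_measure// lee_fin ltW//.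
  by near: a; exact: (cvgr_lt _ (c0 _)).
move=> /filter_ex[a [a0 ae]].
have : \forall b \near +oo%R, 0 < b /\ ((1 - e)%:E <= normal_law s `]-oo, b]%classic)%E.
  near=> b; split; first by near: b; exact: nbhs_pinfty_gt.
  rewrite -[X in (_ <= X)%E]fineK ?fin_num_measure// lee_fin ltW//.
  by near: b; apply: (cvgr_gt _ (c1 _)); rewrite /= gtrBl.
move=> /filter_ex[b [b0 be]].
by exists a, b; split => //; exact: lt_trans b0.
Unshelve. all: by end_near. Qed.

End normal_cdf.

(** The distribution function is Lipschitz, with the peak of the density as constant. *)
Lemma normal_cdf_continuous (R : realType) (s e : R) : 0 < s -> 0 < e ->
  exists2 delta, 0 < delta & forall x,
    fine (normal_law s `]-oo, (x + delta)%R]%classic) <=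
      fine (normal_law s `]-oo, x]%classic) + e /\
    fine (normal_law s `]-oo, x]%classic) - e <=
      fine (normal_law s `]-oo, (x - delta)%R]%classic).
Proof.
move=> s0 e0; have pk0 : 0 < normal_peak s by apply: normal_peak_gt0; rewrite gt_eqF.
have incr a b : a <= b -> fine (normal_law s `]-oo, b]%classic) <=
    fine (normal_law s `]-oo, a]%classic) + normal_peak s * (b - a).
  by move=> /(normal_cdf_incr s0); rewrite -lee_fin EFinD !fineK ?fin_num_measure.
exists (e / normal_peak s) => [|x]; first by rewrite divr_gt0.
set del := e / _; have del0 : 0 <= del by rewrite ltW// divr_gt0.
have pd : normal_peak s * del = e by rewrite /del mulrC divfK// gt_eqF.
split.
  have /incr : x <= x + del by rewrite lerDl.
  by rewrite [x + del - x]addrC addKr pd.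
have /incr : x - del <= x by rewrite gerBl.
by rewrite subKr pd lerBlDr.
Qed.

(** * Integer parts of [v n] *)

Section truncated_ratio.
Context (R : realType) (v : R).
Hypothesis v0 : 0 < v.

Lemma truncn_mul_bounds n : v * n%:R - 1 < (Num.truncn (v * n%:R))%:R <= v * n%:R.
Proof.
have vn0 : 0 <= v * n%:R by rewrite mulr_ge0// ltW.
have /andP[le1 lt2] := truncn_itv vn0.
by rewrite le1 andbT ltrBlDr natr1.
Qed.

Lemma truncn_mul_cvg_pinfty : (Num.truncn (v * n%:R))%:R @[n --> \oo] --> (+oo : set_system R).
Proof.
apply/cvgryPge => A; near=> n.
have /andP[lt1 _] := truncn_mul_bounds n.
apply/ltW/(le_lt_trans _ lt1); rewrite lerBrDr -ler_pdivrMl//.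
by near: n; exact: nbhs_infty_ger.
Unshelve. all: by end_near. Qed.

Lemma truncn_mul_ratio_cvg : (Num.truncn (v * n%:R))%:R / n%:R @[n --> \oo] --> v.
Proof.
apply: (@squeeze_cvgr _ _ _ _ (fun n => v - n%:R^-1) (cst v)); last exact: cvg_cst.
- near=> n; have n0 : (0 : R) < n%:R by near: n; exact: nbhs_infty_gtr.
  have /andP[/ltW le1 le2] := truncn_mul_bounds n.
  rewrite ler_pdivrMr// le2 andbT ler_pdivlMr// mulrBl mulVf ?gt_eqF//.
- rewrite -[X in _ --> X]subr0; apply: cvgB; first exact: cvg_cst.
  apply/gtr0_cvgV0; last exact: cvgr_idn.
  by near=> n; near: n; exact: nbhs_infty_gtr.
Unshelve. all: by end_near. Qed.

End truncated_ratio.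

Lemma cvg_inv_sqrt (R : realType) (u : nat -> R) : u n @[n --> \oo] --> +oo ->
  (Num.sqrt (u n))^-1 @[n --> \oo] --> (0 : R).
Proof.
move=> /cvgryPge uoo; apply/cvgrPdist_le => e e0; near=> n.
rewrite sub0r normrN ger0_norm ?invr_ge0 ?sqrtr_ge0//.
have un : (e^-1) ^+ 2 <= u n by near: n; exact: uoo.
have h : e^-1 <= Num.sqrt (u n).
  by rewrite -[leLHS]ger0_norm ?invr_ge0 ?(ltW e0)// -sqrtr_sqr ler_wsqrtr.
by rewrite invf_ple ?posrE// (lt_le_trans _ h)// invr_gt0.
Unshelve. all: by end_near. Qed.

(** * Limit theorems for independent increments *)

Section iid_limits.
Context d (T : measurableType d) (R : realType) (P : probability T R).
Variables (G : nat -> set (set T)) (X : T -> R) (Y : nat -> T -> R).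
Hypothesis iidY : iid_adapted P G X Y.
Hypothesis iX : P.-integrable setT (EFin \o X).
Hypothesis X0 : \int[P]_w X w = 0.

Let mX := iid_law_measurable iidY.

Lemma probability_norm_ge_cvg0 (Z : T -> R) (c : nat -> R) :
  measurable_fun setT Z -> c n @[n --> \oo] --> +oo ->
  fine (P [set w | c n <= `|Z w|]) @[n --> \oo] --> 0.
Proof.
move=> mZ /cvgryPgt coo.
have mA n : measurable [set w | c n <= `|Z w|].
  by apply: measurable_set_ge; exact: measurableT_comp.
rewrite (_ : (fun n => _) = fun n => \int[P]_w \1_[set w | c n <= `|Z w|] w); last first.
  by apply/funext => n; rewrite /Rintegral integral_indic// setIT.
apply: (Rintegral_dominated_cvg0 _ (cst_integrable P 1)) => [n|n w|w].
- exact: measurable_indic.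
- by rewrite ger0_norm ?indic_ge0// indicE; case: (_ \in _).
- apply: cvg_near_cst; near=> n.
  rewrite indicE memNset//=; apply/negP; rewrite -ltNge.
  by near: n; exact: coo.
Unshelve. all: by end_near. Qed.

(** At level [n] both integrands are dominated by [|X|] and vanish pointwise, so the first moment
    controls both. *)
Lemma tail_second_moment_cvg0 :
  n%:R * tail_mass P X n%:R @[n --> \oo] --> (0 : R) /\
  truncated_second_moment P X n%:R / n%:R @[n --> \oo] --> (0 : R).
Proof.
have mN : measurable_fun setT (fun w => `|X w|) by exact: measurableT_comp.
have iN := integrable_norm iX.
have to0 (w : T) (k : nat) : `|X w| ^+ k / n%:R @[n --> \oo] --> (0 : R).
  rewrite -[X in _ --> X](mulr0 (`|X w| ^+ k)); apply: cvgMr.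
  apply/gtr0_cvgV0; last exact: cvgr_idn.
  by near=> n; near: n; exact: nbhs_infty_gtr.
split.
  have E n : n%:R * tail_mass P X n%:R = \int[P]_w (n%:R * tail_weight X n%:R w).
    have [->|n0] := posnP n.
      by rewrite mul0r; under eq_Rintegral do rewrite mul0r; rewrite Rintegral_cst// mul0r.
    by rewrite RintegralZl//; apply: tail_weight_integrable; rewrite ?ltr0n.
  under eq_fun do rewrite E.
  apply: (Rintegral_dominated_cvg0 _ iN) => [n|n w|w].
  - by apply: measurable_funM => //; exact: measurable_tail_weight.
  - rewrite /= /tail_weight; have [->|n0] := posnP n.
      by rewrite mul0r normr0.
    have nR0 : (0 : R) < n%:R by rewrite ltr0n.
    case: ltP => [_|Xn]; first by rewrite mulrC divfK ?gt_eqF// normr_id.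
    have q1 : `|X w| / n%:R <= 1 by rewrite ler_pdivrMr// mul1r.
    have q0 : 0 <= `|X w| / n%:R by rewrite divr_ge0.
    rewrite ger0_norm ?mulr_ge0 ?exprn_ge0// exprS mulrA [n%:R * _]mulrC divfK ?gt_eqF//.
    by rewrite ler_piMr// exprn_ile1.
  - apply: (@squeeze_cvgr _ _ _ _ (cst 0) (fun n => `|X w| ^+ 3 / n%:R)) => //.
      near=> n; have n0 : (0 < n)%N by near: n; exact: nbhs_infty_gt.
      have nR1 : (1 : R) <= n%:R by rewrite ler1n.
      have nR0 : (0 : R) < n%:R by rewrite ltr0n.
      have Xn : `|X w| <= n%:R by near: n; exact: nbhs_infty_ger.
      rewrite /tail_weight ltNge Xn /= mulr_ge0 ?exprn_ge0 ?divr_ge0//=.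
      rewrite (_ : n%:R * _ = `|X w| ^+ 3 / n%:R * n%:R^-1); last first.
        by field; rewrite gt_eqF.
      by rewrite ler_piMr ?divr_ge0 ?exprn_ge0// invf_le1.
    exact: cvg_cst.
have E n : truncated_second_moment P X n%:R / n%:R =
    \int[P]_w ((n%:R^-1) * (if `|X w| <= n%:R then X w ^+ 2 else 0)).
  rewrite truncated_second_momentE// RintegralZl//; first by rewrite mulrC.
  exact: trunc_integrable.
under eq_fun do rewrite E.
apply: (Rintegral_dominated_cvg0 _ iN) => [n|n w|w].
- apply: measurable_funM => //; apply: measurable_fun_ifT => //.
  + exact: measurable_fun_ler.
  + exact: measurable_funX.
- rewrite /=; case: ifPn => [Xn|_]; last by rewrite mulr0 normr0.
  have [->|n0] := posnP n; first by rewrite invr0 mul0r normr0.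
  have nR0 : (0 : R) < n%:R by rewrite ltr0n.
  rewrite normrM normrX ger0_norm ?invr_ge0// ler_pdivrMl// expr2.
  by rewrite ler_wpM2r.
- apply: (@squeeze_cvgr _ _ _ _ (cst 0) (fun n => `|X w| ^+ 2 / n%:R)) => //.
    apply: nearW => n; rewrite real_normK ?num_real// mulrC.
    case: ifP => _; first by rewrite lexx andbT divr_ge0 ?sqr_ge0.
    by rewrite mul0r lexx divr_ge0 ?sqr_ge0.
  exact: cvg_cst.
Unshelve. all: by end_near. Qed.

(** The maximal inequality with scale [n] over [L n] steps. Uniformity in [k] later allows [n] to be
    located between two jump times. *)
Lemma iid_weak_law (L e eta : R) : 0 < L -> 0 < e -> 0 < eta ->
  \forall n \near \oo, (P [set w | exists2 k, (k <= Num.truncn (L * n%:R))%N &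
    (e * n%:R <= `|\sum_(i < k) Y i w|)%R] <= eta%:E)%E.
Proof.
move=> L0 e0 eta0.
have [C [f [f1 [f2 [c [tf f0 fge0 c0 fc]]]]]] := smooth_well e0.
have mN : measurable_fun setT (fun w => `|X w|) by exact: measurableT_comp.
have iN := integrable_norm iX.
have [t0 h0] := tail_second_moment_cvg0.
have B0 : L * (C * (3 * (n%:R * tail_mass P X n%:R) +
    truncated_second_moment P X n%:R / n%:R)) / c @[n --> \oo] --> (0 : R).
  rewrite -[X in _ --> X](mul0r c^-1); apply: cvgMl.
  rewrite -[X in _ --> X](mulr0 L); apply: cvgMr.
  rewrite -[X in _ --> X](mulr0 C); apply: cvgMr.
  rewrite -[X in _ --> X](addr0 0); apply: cvgD => //.
  by rewrite -[X in _ --> X](mulr0 3); apply: cvgMr.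
near=> n.
have n0 : (0 : R) < n%:R by near: n; exact: nbhs_infty_gtr.
apply: le_trans (maximal_partial_sum_le iidY iX X0 n0 _ tf f0 fge0 c0 fc) _.
rewrite lee_fin.
apply: (@le_trans _ _ (L * (C * (3 * (n%:R * tail_mass P X n%:R) +
    truncated_second_moment P X n%:R / n%:R)) / c)).
  rewrite ler_pM2r ?invr_gt0//.
  have /andP[_ le2] := truncn_mul_bounds L0 n.
  have C0 : 0 <= C by exact: le_trans (normr_ge0 _) (taylor2_bound tf 0).
  have H0 : 0 <= truncated_second_moment P X n%:R.
    by apply: Rintegral_ge0 => w _; exact: sqr_ge0.
  have B1 : 0 <= C * (3 * tail_mass P X n%:R + truncated_second_moment P X n%:R / n%:R ^+ 2).
    by rewrite mulr_ge0// addr_ge0 ?mulr_ge0 ?tail_mass_ge0// divr_ge0// sqr_ge0.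
  apply: (le_trans (ler_wpM2r B1 le2)).
  rewrite le_eqVlt; apply/orP; left; apply/eqP; field.
  by rewrite gt_eqF.
near: n; move/cvgrPdist_le : B0 => /(_ _ eta0); apply: filterS => n.
by rewrite sub0r normrN; apply: le_trans; exact: ler_norm.
Unshelve. all: by end_near. Qed.

Section normalization.
Variable gamma : nat -> R.
Hypothesis sv : slowly_varying (truncated_second_moment P X).
Hypothesis gamma_pos : forall m, (0 < m)%N -> 0 < gamma m.
Hypothesis gamma_infty : gamma m @[m --> \oo] --> +oo.
Hypothesis gamma_equiv : asymp_equiv (fun m => gamma m ^+ 2)
  (fun m => m%:R * truncated_second_moment P X (gamma m)).

Let H n := truncated_second_moment P X (gamma n).
Let nv := normalized_variance_cvg1 gamma_equiv.
Let nt := normalized_tail_mass_cvg0 mX iX sv gamma_pos gamma_infty gamma_equiv.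

(** The bound is proportional to [K / n] and independent of the starting index, so a window whose
    length is a small multiple of [n] has small fluctuation wherever it lies. *)
Lemma iid_fluctuation (e : R) : 0 < e -> exists2 C : R, 0 < C &
  \forall n \near \oo, forall a K,
    (P [set w | exists2 k, (k <= K)%N &
      (e * gamma n <= `|\sum_(i < k) Y (a + i)%N w|)%R] <=
      (C * (K%:R / n%:R))%:E)%E.
Proof.
move=> e0; have [C [f [f1 [f2 [c [tf f0 fge0 c0 fc]]]]]] := smooth_well e0.
have C0 : 0 <= C by exact: le_trans (normr_ge0 _) (taylor2_bound tf 0).
(* The 5 is three times the eventual bound 1 on the normalized tail mass plus the eventual bound 2
   on the normalized variance; the added 1 keeps the constant positive. *)
exists (C * 5 / c + 1); first by rewrite ltr_pwDr// divr_ge0 ?(ltW c0)// mulr_ge0.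
near=> n => a K.
have n0 : (0 < n)%N by near: n; exact: nbhs_infty_gt.
have nR0 : (0 : R) < n%:R by rewrite ltr0n.
have g0 := gamma_pos n0.
apply: le_trans (maximal_partial_sum_le (iid_shift iidY a) iX X0 g0 _ tf f0 fge0 c0 fc) _.
rewrite lee_fin.
have t1 : n%:R * tail_mass P X (gamma n) <= 1.
  near: n; move/cvgrPdist_le : nt => /(_ _ ltr01); apply: filterS => n.
  by rewrite sub0r normrN; apply: le_trans; exact: ler_norm.
have v2 : n%:R * H n / gamma n ^+ 2 <= 2.
  near: n; move/cvgrPdist_le : nv => /(_ _ ltr01); apply: filterS => n.
  by rewrite -/(H n) ler_norml => /andP[h _]; lra.
apply: (@le_trans _ _ (K%:R / n%:R * (C * 5 / c))); last first.
  by rewrite mulrC ler_wpM2r ?divr_ge0// lerDl.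
rewrite (_ : K%:R * _ / c = K%:R / n%:R * (C * (3 * (n%:R * tail_mass P X (gamma n)) +
  n%:R * H n / gamma n ^+ 2) / c)); last first.
  by rewrite /H; field; rewrite !gt_eqF.
rewrite ler_wpM2l ?divr_ge0// ler_wpM2r ?invr_ge0 ?(ltW c0)// ler_wpM2l//; lra.
Unshelve. all: by end_near. Qed.

(** The replacing normal steps have deviation [t = sqrt v / sqrt m], so that [m] of them compose
    exactly to the limit law. *)
Lemma normal_approximation (v C : R) (h h1 h2 : R -> R) : 0 < v -> taylor2 C h h1 h2 ->
  forall e : R, 0 < e -> \forall n \near \oo, forall A, G 0%N A ->
    `|\int[P]_(w in A) h ((\sum_(i < Num.truncn (v * n%:R)) Y i w) / gamma n) -
      fine (P A) * \int[normal_law (Num.sqrt v)]_z h z| <= e.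
Proof.
move=> v0 th e e0.
pose m n := Num.truncn (v * n%:R).
have sv0 : 0 < Num.sqrt v by rewrite sqrtr_gt0.
(* [r n] is [m n] times the one-step error [delta], arranged so that each piece has a visible limit:
   tail mass, mismatch of variances, and the Gaussian third moment, of order [1 / sqrt m]. *)
pose r n := C * (3 * ((m n)%:R / n%:R * (n%:R * tail_mass P X (gamma n))) +
  `|(m n)%:R / n%:R * (n%:R * H n / gamma n ^+ 2) - v| / 2 +
  abs3_normal R * Num.sqrt v ^+ 3 * (Num.sqrt (m n)%:R)^-1).
have r0 : r n @[n --> \oo] --> 0.
  have mv := truncn_mul_ratio_cvg v0.
  rewrite -[X in _ --> X](mulr0 C); apply: cvgMr.
  rewrite -[X in _ --> X](addr0 0); apply: cvgD; last first.
    rewrite -[X in _ --> X](mulr0 (abs3_normal R * Num.sqrt v ^+ 3)); apply: cvgMr.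
    exact: cvg_inv_sqrt (truncn_mul_cvg_pinfty v0).
  rewrite -[X in _ --> X](addr0 0); apply: cvgD.
    rewrite -[X in _ --> X](mulr0 3); apply: cvgMr.
    by rewrite -[X in _ --> X](mulr0 v); apply: cvgM.
  rewrite -[X in _ --> X](mul0r 2^-1); apply: cvgMl.
  rewrite -[X in _ --> X](normr0 R); apply: cvg_norm.
  rewrite -[X in _ --> X](subrr v); apply: cvgB; last exact: cvg_cst.
  by rewrite -[X in _ --> X](mulr1 v); apply: cvgM.
near=> n => A GA.
have n0 : (0 < n)%N by near: n; exact: nbhs_infty_gt.
have nR0 : (0 : R) < n%:R by rewrite ltr0n.
have g0 := gamma_pos n0.
have m0 : (0 < m n)%N.
  rewrite -(ltr0n R); near: n; move/cvgryPgt : (truncn_mul_cvg_pinfty v0); exact.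
have mR0 : (0 : R) < (m n)%:R by rewrite ltr0n.
have q0 : 0 < Num.sqrt (m n)%:R :> R by rewrite sqrtr_gt0.
pose t := Num.sqrt v / Num.sqrt (m n)%:R.
have t0 : 0 < t by rewrite divr_gt0.
have q2 : (Num.sqrt (m n)%:R) ^+ 2 = (m n)%:R :> R by rewrite sqr_sqrtr.
have v2 : (Num.sqrt v) ^+ 2 = v by rewrite sqr_sqrtr// ltW.
pose delta := C * (3 * tail_mass P X (gamma n) + `|H n / gamma n ^+ 2 - t ^+ 2| / 2 +
  abs3_normal R * t ^+ 3).
have close k k1 k2 : taylor2 C k k1 k2 -> forall x,
    `|\int[P]_w k (x + X w / gamma n) - average (normal_law t) k x| <= delta.
  move=> tk x; have s1 := step_taylor mX iX X0 x g0 tk.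
  have s2 := normal_step x t0 tk.
  have s3 : `|k2 x / 2 * (H n / gamma n ^+ 2) - k2 x / 2 * t ^+ 2| <=
      C * (`|H n / gamma n ^+ 2 - t ^+ 2| / 2).
    rewrite -mulrBr normrM [leRHS]mulrCA [leRHS]mulrC ler_wpM2r//.
    by rewrite normrM (@ger0_norm _ 2^-1)// ler_wpM2r// (taylor2_bound2 tk).
  move: s1 s2 s3; rewrite -/(H n) /delta; set I := \int[P]_w _; set J := average _ _ _.
  rewrite !mulrDr !ler_norml => /andP[? ?] /andP[? ?] /andP[? ?].
  by apply/andP; split; lra.
have := lindeberg iidY GA close (m n) th.
have -> : iter (m n) (average (normal_law t)) h 0 = \int[normal_law (Num.sqrt v)]_z h z.
  have mE : m n = (m n).-1.+1 by rewrite prednK.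
  rewrite {1}mE (iter_average_normal _ _ t0 (taylor2_mfun th) (taylor2_bound th)) -mE.
  rewrite /t divfK ?gt_eqF// /average.
  by apply: eq_Rintegral => z _; rewrite add0r.
move=> /le_trans; apply.
rewrite (_ : _ * delta = r n).
  near: n; move/cvgrPdist_le : r0 => /(_ _ e0); apply: filterS => n.
  by rewrite sub0r normrN; apply: le_trans; exact: ler_norm.
rewrite /delta /r mulrCA; congr (C * _); rewrite !mulrDr; congr (_ + _ + _).
- by field; rewrite gt_eqF.
- rewrite mulrA -[X in X * `|_|](@ger0_norm _ (m n)%:R)// -normrM; congr (`|_| / 2).
  by rewrite /t expr_div_n q2 v2; field; rewrite !gt_eqF.
- rewrite /t expr_div_n; set q := Num.sqrt (m n)%:R in q0 q2 *.
  by rewrite -q2; field; rewrite gt_eqF.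
Unshelve. all: by end_near. Qed.

End normalization.
End iid_limits.

Lemma measurable_fun_invr_gt0 d (T : measurableType d) (R : realType) (f : T -> R) :
  measurable_fun setT f -> (forall x, 0 < f x) ->
  measurable_fun setT (fun x => (f x)^-1).
Proof.
move=> mf f0; rewrite (_ : (fun x => _) = (fun x => x `^ (-1)) \o f).
  by apply: measurableT_comp => //; exact: measurable_powR.
by apply/funext => x /=; rewrite powR_inv1// ltW.
Qed.

(** * Means of gaps and block sums *)

Section blocks.
Context d (T : measurableType d) (R : realType) (P : probability T R).
Variables (nu mu : probability R R) (p : R -> R) (theta : R).
Variables (W : int -> {RV P >-> R}) (xi : nat -> {RV P >-> bool}).
Hypothesis hp_meas : measurable_fun [set: R] p.
Hypothesis hp : forall x, 0 < p x < 1.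
Hypothesis htheta : (\int[nu]_x ((1 - p x)^-1)%:E = theta%:E)%E.
Hypothesis hmu : forall B : set R, measurable B ->
  mu B = (\int[nu]_(x in B) ((theta * (1 - p x))^-1)%:E)%E.
Hypothesis hxi : jump_indicators p nu W xi.

Local Notation tau := (jump_time xi).
Local Notation gap := (jump_gap xi).
Local Notation mark := (jump_mark W xi).
Local Notation good := (good_path W xi).

Let q_gt0 x : 0 < 1 - p x. Proof. by rewrite subr_gt0; case/andP: (hp x). Qed.

Lemma mean_gap_ge1 : 1 <= theta.
Proof.
rewrite -lee_fin -htheta -(@probability_setT _ _ _ nu) -[leLHS]mul1e.
rewrite -(@integral_cst _ _ _ nu _ measurableT 1) /=.
apply: ge0_le_integral => //.
- apply/measurable_EFinP; apply: measurable_fun_invr_gt0 => //.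
  exact: measurable_funB.
- move=> x _; rewrite lee_fin invf_ge1//.
  by rewrite gerBl; case/andP: (hp x) => /ltW.
Qed.

Let theta0 : 0 < theta. Proof. exact: lt_le_trans ltr01 mean_gap_ge1. Qed.

(** The stationary law is [nu] weighted by the mean holding time [1 / (1 - p)] and normalized by
    [theta]. *)
Lemma gap_mean_stationary (f : R -> R) : measurable_fun setT f -> (forall x, 0 <= f x) ->
  (\int[P]_w ((gap 0 w)%:R * f (mark 0 w))%:E = theta%:E * \int[mu]_x (f x)%:E)%E.
Proof.
move=> mf f0; rewrite (gap_mean hp_meas hp hxi mf f0).
have mq : measurable_fun setT (fun x => (theta * (1 - p x))^-1).
  apply: measurable_fun_invr_gt0 => [|x]; last by rewrite mulr_gt0.
  by apply: measurable_funM => //; exact: measurable_funB.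
have q0 x : 0 <= (theta * (1 - p x))^-1 by rewrite invr_ge0 mulr_ge0 ?ltW.
rewrite (@ge0_integral_density _ _ _ mu nu _ (EFin \o f) mq q0 hmu)//; first last.
- exact/measurable_EFinP.
rewrite -ge0_integralZl//; first last.
- by rewrite lee_fin ltW.
- by move=> x _; rewrite mule_ge0 ?lee_fin.
- by apply: emeasurable_funM; exact/measurable_EFinP.
apply: eq_integral => x _; rewrite -!EFinM; congr (_%:E).
by field; rewrite !gt_eqF.
Qed.

Definition block_term (g : R -> R) (k : nat) (z : R) : R := k%:R * g z.

Local Notation X g := (block_value W xi (block_term g) 0).

Lemma measurable_block_term g k : measurable_fun setT g -> measurable_fun setT (block_term g k).
Proof. by move=> mg; exact: measurable_funM. Qed.

Lemma block_integrable g : mu.-integrable setT (EFin \o g) ->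
  P.-integrable setT (EFin \o X g).
Proof.
move=> /integrableP[/measurable_EFinP mg ig]; apply/integrableP; split.
  apply/measurable_EFinP; apply: measurable_block_value => k.
  exact: measurable_block_term.
rewrite (_ : (\int[P]_w _)%E = (\int[P]_w ((gap 0 w)%:R * `|g (mark 0 w)|)%:E)%E); last first.
  by apply: eq_integral => w _; rewrite /= normrM ger0_norm.
rewrite (@gap_mean_stationary (fun x => `|g x|))//; last exact: measurableT_comp.
by rewrite lte_mul_pinfty// lee_fin ltW.
Qed.

Lemma block_mean g : mu.-integrable setT (EFin \o g) ->
  \int[P]_w X g w = theta * \int[mu]_x g x.
Proof.
have pos f : mu.-integrable setT (EFin \o f) -> (forall x, 0 <= f x) ->
    \int[P]_w X f w = theta * \int[mu]_x f x.
  move=> fi f0; have /integrableP[/measurable_EFinP mf _] := fi.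
  rewrite /Rintegral (gap_mean_stationary mf f0) fineM//.
  exact: integrable_fin_num.
move=> ig; pose g1 x := Num.max (g x) 0; pose g2 x := Num.max (- g x) 0.
have gE x : g x = g1 x - g2 x.
  by rewrite /g1 /g2; case: (leP (g x) 0) => ?; case: (leP (- g x) 0) => ?; lra.
have /integrableP[/measurable_EFinP mg _] := ig.
have i1 : mu.-integrable setT (EFin \o g1).
  apply: (le_integrable _ _ _ ig) => //.
    by apply/measurable_EFinP; exact: measurable_maxr.
  move=> x _; rewrite /= lee_fin /g1 ger0_norm ?le_max ?lexx ?orbT// ge_max ler_norm//=.
have i2 : mu.-integrable setT (EFin \o g2).
  apply: (le_integrable _ _ _ ig) => //.
    by apply/measurable_EFinP; apply: measurable_maxr => //; exact: measurableT_comp.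
  move=> x _; rewrite /= lee_fin /g2 ger0_norm ?le_max ?lexx ?orbT// ge_max -normrN ler_norm//=.
have -> : \int[P]_w X g w = \int[P]_w (X g1 w - X g2 w).
  by apply: eq_Rintegral => w _; rewrite /block_value /block_term -mulrBr gE.
rewrite RintegralB//; try exact: block_integrable.
rewrite !pos//; try by move=> x; rewrite le_max lexx orbT.
rewrite -mulrBr -RintegralB//; congr (_ * _).
by apply: eq_Rintegral => x _; rewrite -gE.
Qed.

Lemma gap_integrable : P.-integrable setT (EFin \o (fun w => (gap 0 w)%:R - theta)).
Proof.
apply: integrable_sub; last exact: cst_integrable.
(* The gap is the block sum of the constant function 1. *)
rewrite (_ : (fun w => _) = X (cst 1)); last first.
  by apply/funext => w; rewrite /block_value /block_term mulr1.
exact/block_integrable/cst_integrable.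
Qed.

Lemma gap_centered : \int[P]_w ((gap 0 w)%:R - theta) = 0.
Proof.
have E : (fun w => (gap 0 w)%:R) = X (cst 1).
  by apply/funext => w; rewrite /block_value /block_term mulr1.
have i1 := block_integrable (cst_integrable mu 1).
rewrite -E in i1.
rewrite RintegralB//; last exact: cst_integrable.
rewrite Rintegral_prob_cst E block_mean; last exact: cst_integrable.
by rewrite Rintegral_prob_cst mulr1 subrr.
Qed.

End blocks.

(** * Pathwise decomposition of the partial sums into blocks *)

Section block_sums.
Context d (T : measurableType d) (R : realType) (P : probability T R).
Variables (W : int -> {RV P >-> R}) (xi : nat -> {RV P >-> bool}) (g : R -> R).

Local Notation tau := (jump_time xi).
Local Notation gap := (jump_gap xi).
Local Notation mark := (jump_mark W xi).
Local Notation good := (good_path W xi).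
Local Notation Y := (block_value W xi (block_term g)).

Lemma sum_gap k w : good w -> \sum_(i < k) (gap i w)%:R = (tau k w)%:R - (tau 0 w)%:R :> R.
Proof.
move=> gw; elim: k => [|k IH]; first by rewrite big_ord0 subrr.
rewrite big_ord_recr /= IH; have [lt_tau _ _] := jump_timeSP k gw.
by rewrite /jump_gap natrB 1?ltnW//; ring.
Qed.

Lemma blockE j w : good w -> block W xi g j.+1 w = Y j w.
Proof.
move=> gw; rewrite /block /block_value /block_term; have [lt_tau _ _] := jump_timeSP j gw.
by rewrite /jump_gap natrB// ltnW.
Qed.

Lemma partial_sumS n w : partial_sum W g n.+1 w = partial_sum W g n w + g (W n.+1 w).
Proof. by rewrite /partial_sum big_nat_recr. Qed.

Lemma partial_sum_in_block j r w : good w -> (r <= gap j w)%N ->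
  partial_sum W g (tau j w + r)%N w = partial_sum W g (tau j w) w + r%:R * g (mark j w).
Proof.
move=> gw; elim: r => [|r IH] rg; first by rewrite addn0 mul0r addr0.
rewrite addnS partial_sumS IH 1?ltnW// (good_mark gw rg) addSn.
by rewrite -[r.+1%:R]natr1; ring.
Qed.

Lemma partial_sum_jump_time k w : good w -> partial_sum W g (tau k w) w =
  (tau 0 w)%:R * g (W 0 w) + \sum_(i < k) Y i w.
Proof.
move=> gw; elim: k => [|k IH].
  rewrite big_ord0 addr0; have [nj _] := jump_time0P gw.
  suff main r : (r <= tau 0 w)%N -> partial_sum W g r w = r%:R * g (W 0 w) by exact: main.
  elim: r => [|r IH] rt; first by rewrite /partial_sum big_geq// mul0r.
  rewrite partial_sumS IH 1?ltnW//; have := no_jump_const gw nj rt; rewrite add0n => ->.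
  by rewrite -[r.+1%:R]natr1; ring.
have [lt_tau _ _] := jump_timeSP k gw.
have := partial_sum_in_block gw (leqnn (gap k w)).
rewrite {1}/jump_gap subnKC 1?ltnW// => ->.
by rewrite IH big_ord_recr /= addrA.
Qed.

Lemma jump_time_between (a b n : nat) w : (tau a w <= n)%N -> (n < tau b w)%N ->
  (a <= b)%N ->
  exists N, [/\ (a <= N < b)%N, (tau N w <= n)%N & (n < tau N.+1 w)%N].
Proof.
move=> ta; elim: b => [|b IH] tb ab.
  by move: ab ta tb; rewrite leqn0 => /eqP ->; rewrite ltnNge => ->.
have [nb|nb] := ltnP n (tau b w); last first.
  exists b; split=> //; rewrite leqnn andbT -ltnS ltn_neqAle ab andbT.
  by apply: contraTneq ta => ->; rewrite -ltnNge.
have ab' : (a <= b)%N.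
  rewrite -ltnS ltn_neqAle ab andbT; apply: contraTneq ta => ->.
  by rewrite -ltnNge.
have [N [/andP[aN Nb] tN nt]] := IH nb ab'.
by exists N; split=> //; rewrite aN ltnW.
Qed.

(** The chain is constant along a block, so apart from the initial stretch the partial sum at [n] is
    a convex combination of two consecutive block sums; no separate bound on the incomplete block is
    called for. The factor 2 comes from comparing both this value and the sum up to [m] with the sum
    up to [a]. *)
Lemma partial_sum_close (a b m n : nat) (s : R) w : good w ->
  (a <= m <= b)%N -> (tau a w <= n)%N -> (n < tau b w)%N ->
  (forall k, (k <= b - a)%N -> `|\sum_(i < k) Y (a + i)%N w| < s) ->
  `|partial_sum W g n w - (tau 0 w)%:R * g (W 0 w) - \sum_(i < m) Y i w| < 2 * s.
Proof.
move=> gw /andP[am mb] ta tb small; have ab := leq_trans am mb.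
have [N [/andP[aN Nb] tN nt]] := jump_time_between ta tb ab.
have V k : (a <= k <= b)%N -> `|\sum_(i < k) Y i w - \sum_(i < a) Y i w| < s.
  move=> /andP[ak kb]; have := small (k - a)%N; rewrite leq_sub2r// => /(_ isT).
  rewrite (_ : \sum_(i < k) Y i w = \sum_(i < a) Y i w + \sum_(i < k - a) Y (a + i) w).
    by rewrite [X in `|X - _|]addrC addrK.
  by rewrite -[in LHS](subnKC ak) big_split_ord.
have Vm := V m; rewrite am mb in Vm.
have VN := V N; rewrite aN (ltnW Nb) in VN.
have VN1 := V N.+1; rewrite Nb (leq_trans aN (leqnSn N)) in VN1.
have [lt_tau _ _] := jump_timeSP N gw.
have g0 : (0 : R) < (gap N w)%:R by rewrite ltr0n subn_gt0.
have rg : (n - tau N w <= gap N w)%N by rewrite leq_sub2r// ltnW.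
have := partial_sum_in_block gw rg; rewrite subnKC// partial_sum_jump_time// => ->.
set r := (n - tau N w)%N in rg *.
have r0 : 0 <= r%:R / (gap N w)%:R :> R by rewrite divr_ge0.
have r1 : r%:R / (gap N w)%:R <= 1 :> R by rewrite ler_pdivrMr// mul1r ler_nat.
rewrite big_ord_recr /= in VN1.
(* The elapsed fraction of the block is the interpolation weight. *)
have -> : r%:R * g (mark N w) = r%:R / (gap N w)%:R * Y N w.
  by rewrite /block_value /block_term; field; rewrite gt_eqF.
move: r0 r1 (Vm isT) (VN isT) (VN1 isT); clear -R.
set l := _ / _; set S := \sum_(i < N) _; set A := \sum_(i < a) _; set M := \sum_(i < m) _.
set y := Y N w; rewrite !ltr_norml => l0 l1 /andP[m1 m2] /andP[n1 n2] /andP[k1 k2].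
by apply/andP; split; nra.
Qed.

End block_sums.
(** The condition [rho v n >= 2] absorbs the integer parts, as the window is shorter than
    [2 rho v n + 2]. The [.+1] in [b] makes the last inequality strict, and the [+ 1] in the factor
    of the third bound leaves room for it once [n >= 1]. *)
Lemma index_window (R : realType) (v rho : R) (n : nat) :
  0 < v -> 0 < rho -> rho <= 2^-1 -> 1 <= n%:R :> R -> 2 <= rho * v * n%:R ->
  let a := Num.truncn (v * (1 - rho) * n%:R) in
  let b := (Num.truncn (v * (1 + rho) * n%:R)).+1 in
  let m := Num.truncn (v * n%:R) in
  [/\ (a <= m <= b)%N, (b - a)%:R <= 3 * rho * v * n%:R,
    (b <= Num.truncn ((v * (1 + rho) + 1) * n%:R))%N,
    a%:R <= v * (1 - rho) * n%:R & v * (1 + rho) * n%:R < b%:R].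
Proof.
move=> v0 rho0 rho2 nR1 nlarge a b m; have nR0 : (0 : R) < n%:R by lra.
have va0 : 0 < v * (1 - rho) by rewrite mulr_gt0//; lra.
have vb0 : 0 < v * (1 + rho) by rewrite mulr_gt0//; lra.
have /andP[a1 a2] := truncn_mul_bounds va0 n; rewrite -/a in a1 a2.
have /andP[b1 b2] := truncn_mul_bounds vb0 n.
have bE : b%:R = (Num.truncn (v * (1 + rho) * n%:R))%:R + 1 :> R by rewrite /b -natr1.
have am : (a <= m)%N.
  by apply: le_truncn; rewrite ler_pM2r// ler_piMr ?(ltW v0)//; lra.
have mb : (m <= b)%N.
  by apply/leqW/le_truncn; rewrite ler_pM2r// ler_peMr ?(ltW v0)//; lra.
split.
- by rewrite am.
- by rewrite natrB ?(leq_trans am mb)// bE; nra.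
- by rewrite truncn_ge_nat ?mulr_ge0 ?addr_ge0 ?(ltW vb0)// bE mulrDl mul1r; lra.
- exact: a2.
- by rewrite bE; lra.
Qed.

Lemma measurable_jump_time d (T : measurableType d) (R : realType) (P : probability T R)
    (xi : nat -> {RV P >-> bool}) j :
  measurable_fun setT (fun w => (jump_time xi j w)%:R : R).
Proof.
apply: (measurable_fun_nat_comp (f := fun (n : nat) (_ : T) => n%:R : R)) => [n|n] //.
exact: measurable_jump_time_eq.
Qed.

(** * Replacing [S_n] by a sum over a fixed number of blocks *)

Section remainder.
Context d (T : measurableType d) (R : realType) (P : probability T R).
Variables (nu mu : probability R R) (p : R -> R) (theta : R).
Variables (W : int -> {RV P >-> R}) (xi : nat -> {RV P >-> bool}) (g : R -> R).
Hypothesis hp_meas : measurable_fun [set: R] p.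
Hypothesis hp : forall x, 0 < p x < 1.
Hypothesis htheta : (\int[nu]_x ((1 - p x)^-1)%:E = theta%:E)%E.
Hypothesis hmu : forall B : set R, measurable B ->
  mu B = (\int[nu]_(x in B) ((theta * (1 - p x))^-1)%:E)%E.
Hypothesis hxi : jump_indicators p nu W xi.
Hypothesis ig : mu.-integrable setT (EFin \o g).
Hypothesis g0 : (\int[mu]_x (g x)%:E = 0)%E.

Local Notation tau := (jump_time xi).
Local Notation gap := (jump_gap xi).
Local Notation mark := (jump_mark W xi).
Local Notation good := (good_path W xi).
Local Notation X := (block_value W xi (block_term g) 0).
Local Notation Y := (block_value W xi (block_term g)).

Let mg : measurable_fun setT g.
Proof. by have /integrableP[/measurable_EFinP] := ig. Qed.

Lemma iid_blocks : iid_adapted P (block_filtration W xi) X Y.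
Proof. exact: (iid_block_value hp_meas hp hxi (fun k => measurable_block_term k mg)). Qed.

Lemma iid_gaps : iid_adapted P (block_filtration W xi)
  (fun w => (gap 0 w)%:R - theta) (fun j w => (gap j w)%:R - theta).
Proof.
have mf (k : nat) : measurable_fun setT (fun _ : R => k%:R - theta : R) by [].
exact: (iid_block_value hp_meas hp hxi mf).
Qed.

Lemma block_centered : \int[P]_w X w = 0.
Proof.
rewrite (block_mean hp_meas hp htheta hmu hxi ig).
by rewrite /Rintegral g0 mulr0.
Qed.

Variable gamma : nat -> R.
Hypothesis sv : slowly_varying (truncated_second_moment P X).
Hypothesis gamma_pos : forall m, (0 < m)%N -> 0 < gamma m.
Hypothesis gamma_infty : gamma m @[m --> \oo] --> +oo.
Hypothesis gamma_equiv : asymp_equiv (fun m => gamma m ^+ 2)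
  (fun m => m%:R * truncated_second_moment P X (gamma m)).

Let theta0 : 0 < theta. Proof. exact: lt_le_trans ltr01 (mean_gap_ge1 hp_meas hp htheta). Qed.

(** The exceptional set is a null set together with four events of probability at most [eta / 4]:
    the initial stretch is long, its sum is large, the weak law for the gaps fails, or the block
    sums fluctuate over the window between [a] and [b]. *)
Lemma partial_sum_approximation (delta eta : R) : 0 < delta -> 0 < eta ->
  \forall n \near \oo, exists B, [/\ measurable B, (P B <= eta%:E)%E &
    forall w, ~ B w -> `|partial_sum W g n w / gamma n -
      (\sum_(i < Num.truncn (theta^-1 * n%:R)) Y i w) / gamma n| <= delta].
Proof.
move=> d0 eta0; pose v := theta^-1; have v0 : 0 < v by rewrite invr_gt0.
have iX := block_integrable hp_meas hp htheta hmu hxi ig.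
have d4 : 0 < delta / 4 by rewrite divr_gt0.
have e4 : 0 < eta / 4 by rewrite divr_gt0.
have [C C0 fluct] := iid_fluctuation iid_blocks iX block_centered sv gamma_pos gamma_infty gamma_equiv d4.
(* The window has length at most [3 rho v n], so its fluctuation event has probability at most
   [3 rho v C]; setting this to the share [eta / 4] gives the 12. *)
pose rho := Num.min 2^-1 (eta / (12 * v * C)).
have rho0 : 0 < rho by rewrite lt_min invr_gt0 ltr0n/= divr_gt0// !mulr_gt0.
have rho2 : rho <= 2^-1 by rewrite ge_min lexx.
have rhoC : 3 * rho * v * C <= eta / 4.
  have : rho <= eta / (12 * v * C) by rewrite ge_min lexx orbT.
  rewrite ler_pdivlMr ?mulr_gt0// => h.
  by rewrite ler_pdivlMr//; apply: le_trans h; rewrite le_eqVlt; apply/orP; left; apply/eqP; ring.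
have r20 : 0 < rho / 2 by rewrite divr_gt0.
pose L := v * (1 + rho) + 1; have L0 : 0 < L.
  by rewrite addr_gt0// mulr_gt0// addr_gt0.
have weak := iid_weak_law iid_gaps (gap_integrable hp_meas hp htheta hmu hxi)
  (gap_centered hp_meas hp htheta hmu hxi) L0 r20 e4.
have [N0 [mN0 PN0 badN0]] := good_ae hp_meas hp hxi.
have mt := measurable_jump_time xi 0.
have mt2 : measurable_fun setT (fun w => (tau 0 w)%:R * g (W 0 w)).
  by apply: measurable_funM => //; apply: (measurableT_comp mg); exact: measurable_funP.
have mul_pinfty (k : R) (u : nat -> R) : 0 < k -> u n @[n --> \oo] --> +oo ->
    k * u n @[n --> \oo] --> +oo.
  move=> k0 /cvgryPge uoo; apply/cvgryPge => A; apply: filterS (uoo (k^-1 * A)) => n.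
  by rewrite ler_pdivrMl.
have c1 : rho / 2 * n%:R @[n --> \oo] --> +oo by apply: mul_pinfty => //; exact: cvgr_idn.
have c2 : delta / 2 * gamma n @[n --> \oo] --> +oo.
  by apply: mul_pinfty => //; rewrite divr_gt0.
have fin_le (Z : T -> R) (c : nat -> R) : measurable_fun setT Z ->
    c n @[n --> \oo] --> +oo ->
    \forall n \near \oo, (P [set w | (c n <= `|Z w|)%R] <= (eta / 4)%:E)%E.
  move=> mZ coo.
  have /cvgrPdist_le/(_ _ e4) := probability_norm_ge_cvg0 P mZ coo.
  apply: filterS => n; rewrite sub0r normrN => /(le_trans (ler_norm _)) h.
  rewrite -[leLHS]fineK ?lee_fin// fin_num_measure//.
  by apply: measurable_set_ge; exact: measurableT_comp.
have p1 := fin_le _ _ mt c1.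
have p2 := fin_le _ _ mt2 c2.
near=> n.
have PB1 : (P [set w | (rho / 2 * n%:R <= `|(tau 0 w)%:R : R|)%R] <= (eta / 4)%:E)%E.
  by near: n.
have PB2 : (P [set w | (delta / 2 * gamma n <= `|(tau 0 w)%:R * g (W 0 w)|)%R] <=
    (eta / 4)%:E)%E by near: n.
have PB3 : (P [set w | exists2 k, (k <= Num.truncn (L * n%:R))%N &
    (rho / 2 * n%:R <= `|\sum_(i < k) ((gap i w)%:R - theta)|)%R] <= (eta / 4)%:E)%E.
  by near: n.
have fl : forall a K, (P [set w | exists2 k, (k <= K)%N &
    (delta / 4 * gamma n <= `|\sum_(i < k) Y (a + i)%N w|)%R] <=
    (C * (K%:R / n%:R))%:E)%E by near: n.
have n0 : (0 < n)%N by near: n; exact: nbhs_infty_gt.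
have nR0 : (0 : R) < n%:R by rewrite ltr0n.
have nR1 : (1 : R) <= n%:R by rewrite ler1n.
have g_gt0 := gamma_pos n0.
have nlarge : 2 <= rho * v * n%:R.
  by rewrite -ler_pdivrMl ?mulr_gt0//; near: n; exact: nbhs_infty_ger.
pose a := Num.truncn (v * (1 - rho) * n%:R).
pose b := (Num.truncn (v * (1 + rho) * n%:R)).+1.
pose m := Num.truncn (v * n%:R).
have [/andP[am mb] ba bL a2 b1] : [/\ (a <= m <= b)%N,
    (b - a)%:R <= 3 * rho * v * n%:R, (b <= Num.truncn (L * n%:R))%N,
    a%:R <= v * (1 - rho) * n%:R & v * (1 + rho) * n%:R < b%:R].
  exact: index_window.
pose B1 := [set w | rho / 2 * n%:R <= `|(tau 0 w)%:R : R|].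
pose B2 := [set w | delta / 2 * gamma n <= `|(tau 0 w)%:R * g (W 0 w)|].
pose B3 := [set w | exists2 k, (k <= Num.truncn (L * n%:R))%N &
  rho / 2 * n%:R <= `|\sum_(i < k) ((gap i w)%:R - theta)|].
pose B4 := [set w | exists2 k, (k <= b - a)%N &
  delta / 4 * gamma n <= `|\sum_(i < k) Y (a + i)%N w|].
have mB1 : measurable B1 by apply: measurable_set_ge; exact: measurableT_comp.
have mB2 : measurable B2 by apply: measurable_set_ge; exact: measurableT_comp.
have mB3 : measurable B3 by exact: measurable_max_partial_sum iid_gaps _ _ _.
have mB4 : measurable B4.
  exact: measurable_max_partial_sum (iid_shift iid_blocks a) _ _ _.
have PB4 : (P B4 <= (eta / 4)%:E)%E.
  apply: le_trans (fl a (b - a)%N) _.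
  rewrite lee_fin; apply: le_trans rhoC; rewrite mulrC ler_pM2r// ler_pdivrMr//.
exists (N0 `|` (B1 `|` B2 `|` (B3 `|` B4))); split.
- by apply: measurableU => //; apply: measurableU; apply: measurableU.
- have PN0' : (P N0 <= (0 : R)%:E)%E.
    by rewrite le_eqVlt; apply/orP; left; apply/eqP; exact: PN0.
  have PU A B (x y : R) : measurable A -> measurable B ->
      (P A <= x%:E)%E -> (P B <= y%:E)%E -> (P (A `|` B) <= (x + y)%:E)%E.
    by move=> mA mB Ax By; apply: le_trans (measureU2 _ mA mB) _; rewrite EFinD leeD.
  have -> : eta = 0 + (eta / 4 + eta / 4 + (eta / 4 + eta / 4)) by lra.
  have m12 := measurableU _ _ mB1 mB2; have m34 := measurableU _ _ mB3 mB4.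
  have m14 := measurableU _ _ m12 m34.
  by apply: (PU _ _ _ _ mN0 m14 PN0'); apply: (PU _ _ _ _ m12 m34); exact: PU.
move=> w /not_orP[nN0 /not_orP[/not_orP[nB1 nB2] /not_orP[nB3 nB4]]].
have gw : good w by apply: contrapT => ngw; apply: nN0; exact: badN0.
have {}nB1 : (tau 0 w)%:R < rho / 2 * n%:R :> R.
  by move/negP : nB1; rewrite -ltNge ger0_norm.
have {}nB2 : `|(tau 0 w)%:R * g (W 0 w)| < delta / 2 * gamma n.
  by move/negP : nB2; rewrite -ltNge.
have {}nB3 k : (k <= b)%N -> `|(tau k w)%:R - (tau 0 w)%:R - theta * k%:R| < rho / 2 * n%:R.
  move=> kb; rewrite ltNge; apply/negP => h; apply: nB3; exists k.
    exact: leq_trans kb bL.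
  by rewrite sumrB (sum_gap k gw) sumr_const card_ord -[theta *+ k]mulr_natr.
have {}nB4 k : (k <= b - a)%N -> `|\sum_(i < k) Y (a + i)%N w| < delta / 4 * gamma n.
  by move=> kb; rewrite ltNge; apply/negP => h; apply: nB4; exists k.
have thv : theta * v = 1 by rewrite /v divff// gt_eqF.
(* The weak law errs by at most [rho n / 2] and [tau 0] is below [rho n / 2]; together they use up
   the margin [rho n] left by the choice of [a]. *)
have ta : (tau a w <= n)%N.
  rewrite -(ler_nat R); have := nB3 a (leq_trans am mb).
  rewrite ltr_norml => /andP[_ h].
  have : theta * a%:R <= theta * (v * (1 - rho) * n%:R) by rewrite ler_pM2l.
  rewrite !mulrA thv; lra.
have tb : (n < tau b w)%N.
  rewrite -(ltr_nat R); have := nB3 b (leqnn b); rewrite ltr_norml => /andP[h _].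
  have : theta * (v * (1 + rho) * n%:R) < theta * b%:R by rewrite ltr_pM2l//; lra.
  have := ler0n R (tau 0 w).
  by rewrite !mulrA thv; lra.
have amb : (a <= m <= b)%N by rewrite am.
(* The threshold [delta / 4] is doubled here; the initial stretch takes the other [delta / 2]. *)
have := partial_sum_close gw amb ta tb nB4.
rewrite -mulrBl normrM normfV (gtr0_norm g_gt0) ler_pdivrMr//.
move: nB2; rewrite -/m; set S := partial_sum _ _ _ _; set M := \sum_(i < m) _.
set t := (tau 0 w)%:R * _; rewrite !ltr_norml => /andP[? ?] /andP[? ?].
by rewrite ler_norml; apply/andP; split; lra.
Unshelve. all: by end_near. Qed.

End remainder.

(** * The Levy distance: countable description and control on a grid *)

Section levy_distance.
Context (R : realType).
Implicit Types F G : set R -> \bar R.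

Definition levy_close F G (e : R) : Prop := forall x : R,
  (F `]-oo, (x - e)%R]%classic - e%:E <= G `]-oo, x]%classic /\
   G `]-oo, x]%classic <= F `]-oo, (x + e)%R]%classic + e%:E)%E.

Lemma levy_dist_le F G (e : R) : 0 < e -> levy_close F G e -> levy_dist F G <= e.
Proof. by move=> e0 c; apply: ge_inf => //; exists 0 => x [/ltW]. Qed.

Lemma measure_itv_le (m : {measure set R -> \bar R}) (x y : R) : x <= y ->
  (m `]-oo, x]%classic <= m `]-oo, y]%classic)%E.
Proof.
move=> xy; apply: le_measure; rewrite ?inE//.
by apply: subset_itvl; rewrite bnd_simp.
Qed.

Variables (m G : {measure set R -> \bar R}).
Hypotheses (m1 : (m setT <= 1)%E) (G1 : (G setT <= 1)%E).

Let m_le1 x : (m `]-oo, x]%classic <= 1)%E.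
Proof. by apply: le_trans m1; apply: le_measure; rewrite ?inE. Qed.

Let G_le1 x : (G `]-oo, x]%classic <= 1)%E.
Proof. by apply: le_trans G1; apply: le_measure; rewrite ?inE. Qed.

(** Monotonicity moves a real point to a nearby rational one at the expense of the slack between [q]
    and [e]. The countable form is what makes the distance to a random measure measurable. *)
Lemma levy_dist_lt (e : R) :
  levy_dist m G < e <-> exists2 q : rat, (0 : R) < ratr q < e &
    forall x : rat, (m `]-oo, (ratr x - ratr q)%R]%classic - (ratr q)%:E <=
        G `]-oo, ratr x]%classic)%E /\
      (G `]-oo, ratr x]%classic <= m `]-oo, (ratr x + ratr q)%R]%classic + (ratr q)%:E)%E.
Proof.
split=> [lt_e|[q /andP[q0 qe] hq]].
  have hinf : has_inf [set e : R | 0 < e /\ levy_close m G e].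
    split; last by exists 0 => x [/ltW].
    exists 1; split=> // x; split.
      by rewrite leeBlDr//; apply: le_trans (m_le1 _) _; rewrite leeDr.
    by apply: le_trans (G_le1 _) _; rewrite leeDr.
  have [r [r0 cr] re] := inf_lt hinf.1 lt_e.
  have [q] := rat_in_itvoo re.
  rewrite in_itv => /andP[rq qe]; rewrite /= in rq qe; exists q; first by rewrite (lt_trans r0 rq).
  move=> x; have [c1 c2] := cr (ratr x); split.
    apply: le_trans c1; apply: leeB; last by rewrite lee_fin ltW.
    by apply: measure_itv_le; rewrite lerB// ltW.
  apply: (le_trans c2); apply: leeD; last by rewrite lee_fin ltW.
  by apply: measure_itv_le; rewrite lerD// ltW.
have [r /andP[qr re]] : exists r : R, ratr q < r < e.
  by exists ((ratr q + e) / 2); apply/andP; split; lra.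
apply: le_lt_trans re; apply: levy_dist_le => [|x]; first exact: lt_trans q0 qr.
split.
  have : x - (r - ratr q) < x by rewrite ltrBlDr ltrDl subr_gt0.
  move=> /rat_in_itvoo[y]; rewrite in_itv => /andP[xy yx]; rewrite /= in xy yx.
  have [c1 _] := hq y.
  apply: le_trans (measure_itv_le G (ltW yx)); apply: le_trans c1.
  apply: leeB; last by rewrite lee_fin ltW.
  by apply: measure_itv_le; lra.
have : x < x + (r - ratr q) by rewrite ltrDl subr_gt0.
move=> /rat_in_itvoo[y]; rewrite in_itv => /andP[xy yx]; rewrite /= in xy yx.
have [_ c2] := hq y.
apply: (le_trans (measure_itv_le G (ltW xy))); apply: (le_trans c2).
apply: leeD; last by rewrite lee_fin ltW.
by apply: measure_itv_le; lra.
Qed.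

(** A point inside the grid is compared at the next grid point, at distance at most [e], which the
    shift in the Levy inequalities allows; on either side of the grid [G] has mass at most
    [e / 2]. *)
Lemma levy_dist_grid (e a : R) (K : nat) : 0 < e ->
  (G `]-oo, a]%classic <= (e / 2)%:E)%E ->
  ((1 - e / 2)%:E <= G `]-oo, (a + K%:R * e)%R]%classic)%E ->
  (forall i, (i <= K)%N ->
    (m `]-oo, (a + i%:R * e)%R]%classic <= G `]-oo, (a + i%:R * e)%R]%classic + (e / 2)%:E)%E /\
    (G `]-oo, (a + i%:R * e)%R]%classic <= m `]-oo, (a + i%:R * e)%R]%classic + (e / 2)%:E)%E) ->
  levy_dist m G <= e.
Proof.
move=> e0 Ga GK grid; pose x_ i := a + i%:R * e.
have e20 : 0 <= e / 2 by rewrite divr_ge0// ltW.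
have locate y : a < y -> (exists i, (i <= K)%N /\ y <= x_ i <= y + e) \/ x_ K <= y.
  move=> ay; pose i := Num.truncn ((y - a) / e).
  have z0 : 0 <= (y - a) / e by rewrite divr_ge0 ?subr_ge0// ltW.
  have /andP[i1 i2] := truncn_itv z0; rewrite -/i in i1 i2.
  move: i1 i2; rewrite ler_pdivlMr// ltr_pdivrMr// => i1 i2.
  have [iK|Ki] := ltnP i K.
    left; exists i.+1; split=> //; rewrite /x_; apply/andP; split; first lra.
    by rewrite -natr1 mulrDl; lra.
  right; rewrite /x_; have : K%:R * e <= i%:R * e by rewrite ler_pM2r// ler_nat.
  lra.
have le_half (u v : \bar R) : (u <= v + (e / 2)%:E)%E -> (u <= v + e%:E)%E.
  by move=> /le_trans; apply; apply: leeD => //; rewrite lee_fin; lra.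
have twoD : e%:E = ((e / 2)%:E + (e / 2)%:E)%E by rewrite -EFinD; congr (_%:E); lra.
have G0 y : (0 <= G `]-oo, y]%classic)%E by [].
have m0 y : (0 <= m `]-oo, y]%classic)%E by [].
have GK' : (1%:E <= G `]-oo, x_ K]%classic + (e / 2)%:E)%E.
  by rewrite -leeBlDr// -EFinB.
apply: levy_dist_le => // x; split.
  rewrite leeBlDr//; have [xa|ax] := leP (x - e) a.
    apply: le_trans (measure_itv_le m xa) _.
    have [+ _] := grid 0%N isT; rewrite mul0r addr0 => /le_trans; apply.
    apply: (@le_trans _ _ e%:E); last by rewrite leeDr.
    by rewrite twoD leeD2r.
  have [[i [iK /andP[yi iy]]]|Ky] := locate _ ax.
    rewrite subrK in iy.
    apply: le_trans (measure_itv_le m yi) _; apply: le_half.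
    have [+ _] := grid i iK => /le_trans; apply.
    by rewrite leeD2r// measure_itv_le.
  apply: le_trans (m_le1 _) _; apply: le_half.
  apply: le_trans GK' _; rewrite leeD2r// measure_itv_le//.
  by apply: (le_trans Ky); rewrite lerBlDr lerDl ltW.
have [xa|ax] := leP x a.
  apply: le_trans (measure_itv_le G xa) _; apply: (le_trans Ga).
  apply: (@le_trans _ _ e%:E); last by rewrite leeDr.
  by rewrite lee_fin; lra.
have [[i [iK /andP[yi iy]]]|Ky] := locate _ ax.
  apply: le_trans (measure_itv_le G yi) _; apply: le_half.
  have [_ +] := grid i iK => /le_trans; apply.
  by rewrite leeD2r// measure_itv_le.
apply: le_trans (G_le1 _) _.
rewrite twoD addeA; apply: (le_trans GK'); rewrite leeD2r//.
have [_ +] := grid K (leqnn K) => /le_trans; apply.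
by rewrite leeD2r// measure_itv_le// (le_trans Ky)// lerDl ltW.
Qed.

End levy_distance.

(** * From limits uniform over events to conditional distributions *)

Section conditional_limit.
Context d (T : measurableType d) (R : realType) (P : probability T R).

Lemma Rintegral_indic d' (T' : measurableType d') (Q : probability T' R) (A B : set T') :
  measurable A -> measurable B -> \int[Q]_(w in A) \1_B w = fine (Q (A `&` B)).
Proof. by move=> mA mB; rewrite /Rintegral integral_indic// setIC. Qed.

Lemma le_Rintegral_add d' (T' : measurableType d') (Q : probability T' R) (A : set T')
    (f h : T' -> R) (C eta : R) : measurable A ->
  measurable_fun setT f -> measurable_fun setT h ->
  (forall w, `|f w| <= C) -> (forall w, `|h w| <= C) -> 0 <= eta ->
  (forall w, f w <= h w + eta) ->
  \int[Q]_(w in A) f w <= \int[Q]_(w in A) h w + eta.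
Proof.
move=> mA mf mh fC hC eta0 fh.
have int (k : T' -> R) : measurable_fun setT k -> (forall w, `|k w| <= C) ->
    Q.-integrable A (EFin \o k).
  by move=> mk kC; apply: (integrableS measurableT) => //; exact: bounded_integrable kC.
have ic : Q.-integrable A (EFin \o (fun=> eta)).
  by apply: (integrableS measurableT) => //; exact: cst_integrable.
apply: (@le_trans _ _ (\int[Q]_(w in A) (h w + eta))).
  apply: le_Rintegral => //; first exact: int.
  exact: (integrableD mA (int _ mh hC) ic).
rewrite RintegralD//; last exact: int.
rewrite lerD2l Rintegral_cst// ler_piMr//.
by rewrite -lee_fin fineK ?fin_num_measure// probability_le1.
Qed.

Variables (Xc : T -> R) (Z V : nat -> T -> R) (N : probability R R).
Hypothesis mXc : measurable_fun setT Xc.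
Hypothesis mZ : forall n, measurable_fun setT (Z n).
Hypothesis mV : forall n, measurable_fun setT (V n).
Hypothesis close : forall delta eta : R, 0 < delta -> 0 < eta ->
  \forall n \near \oo, exists B, [/\ measurable B, (P B <= eta%:E)%E &
    forall w, ~ B w -> `|Z n w - V n w| <= delta].
Hypothesis clt : forall (C : R) (h h1 h2 : R -> R), taylor2 C h h1 h2 ->
  forall e : R, 0 < e -> \forall n \near \oo, forall A, measurable A ->
    `|\int[P]_(w in Xc @^-1` A) h (V n w) - fine (P (Xc @^-1` A)) * \int[N]_z h z| <= e.

Let G (x : R) : R := fine (N `]-oo, x]%classic).

Let mpre (f : T -> R) B : measurable_fun setT f -> measurable B -> measurable (f @^-1` B).
Proof. by move=> mf mB; rewrite -[X in measurable X]setTI; exact: mf. Qed.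

Let indic_bound d' (T' : measurableType d') (B : set T') w : `|\1_B w : R| <= 1.
Proof. by rewrite indicE; case: (_ \in _); rewrite ?normr1 ?normr0. Qed.

Let fine_prob_le1 A : measurable A -> 0 <= fine (P A) <= 1.
Proof.
by move=> mA; rewrite -!lee_fin fineK ?fin_num_measure// measure_ge0 probability_le1.
Qed.

Let fine_le_setU A B C (eta : R) : measurable A -> measurable B -> measurable C ->
  (P C <= eta%:E)%E -> A `<=` B `|` C -> fine (P A) <= fine (P B) + eta.
Proof.
move=> mA mB mC Ce ABC; rewrite -lee_fin EFinD !fineK ?fin_num_measure//.
apply: (@le_trans _ _ (P (B `|` C))).
  by apply: le_measure; rewrite ?inE//; exact: measurableU.
by apply: le_trans (measureU2 _ mB mC) _; rewrite leeD2l.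
Qed.

(* Stable convergence in Renyi's sense, uniformly over the events of [Xc]. *)
Lemma conditional_cdf_le (x delta eta : R) : 0 < delta -> 0 < eta ->
  \forall n \near \oo, forall A, measurable A ->
    fine (P (Xc @^-1` A `&` Z n @^-1` `]-oo, x]%classic)) <=
      fine (P (Xc @^-1` A)) * G (x + delta) + eta.
Proof.
move=> d0 eta0; have d20 : 0 < delta / 2 by rewrite divr_gt0.
have e40 : 0 < eta / 4 by rewrite divr_gt0.
(* The first half of [delta] pays for replacing [Z] by [V], the second half for the width of the
   smooth step. *)
have [C [h [h1 [h2 [th h01 hle hge]]]]] := smooth_step (x + delta / 2) d20 e40.
have mh := taylor2_mfun th.
have hb v : `|h v| <= 1 by have /andP[? ?] := h01 v; rewrite ger0_norm.
have cl := close d20 e40; have cv := clt th e40.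
near=> n => A mA.
have [B [mB PB hB]] : exists B, [/\ measurable B, (P B <= (eta / 4)%:E)%E &
    forall w, ~ B w -> `|Z n w - V n w| <= delta / 2] by near: n.
have cvA : `|\int[P]_(w in Xc @^-1` A) h (V n w) -
    fine (P (Xc @^-1` A)) * \int[N]_z h z| <= eta / 4.
  by move: A mA; near: n.
have mXA := mpre mXc mA; set A' := Xc @^-1` A in mXA cvA *.
pose Vx := V n @^-1` `]-oo, (x + delta / 2)%R]%classic.
have mVx : measurable Vx by exact: mpre.
have s1 : fine (P (A' `&` Z n @^-1` `]-oo, x]%classic)) <= fine (P (A' `&` Vx)) + eta / 4.
  apply: fine_le_setU PB _ => //; try by apply: measurableI => //; exact: mpre.
  move=> w [Aw /=]; rewrite in_itv/= => Zx.
  have [Bw|nBw] := pselect (B w); [by right|left; split=> //=].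
  by rewrite /Vx /= in_itv/=; have := hB w nBw; rewrite ler_norml => /andP[? ?]; lra.
have s2 : fine (P (A' `&` Vx)) <= \int[P]_(w in A') h (V n w) + eta / 4.
  rewrite -Rintegral_indic//; apply: (@le_Rintegral_add _ _ _ _ _ _ 1) => //.
  - exact: (measurableT_comp mh).
  - exact: ltW.
  - move=> w; rewrite indicE; have [|_] := boolP (w \in Vx); last first.
      by have /andP[? _] := h01 (V n w); rewrite /=; lra.
    rewrite inE /Vx /= in_itv/= => /hle; rewrite -lerBlDr.
    exact: le_trans.
have s3 : \int[N]_z h z <= G (x + delta) + eta / 4.
  rewrite /G -[X in N X]setTI -Rintegral_indic//.
  apply: (@le_Rintegral_add _ _ _ _ _ _ 1) => //; first exact: ltW.
  move=> z; rewrite indicE; have [|] := boolP (z \in _).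
    by move=> _; have /andP[_ ?] := h01 z; rewrite (le_trans _ (_ : 1 <= _))// lerDl ltW.
  rewrite notin_setE/= in_itv/= => /negP; rewrite -ltNge => xz.
  rewrite add0r; apply: hge; lra.
have /andP[p0 p1] := fine_prob_le1 mXA.
move: cvA; rewrite ler_norml => /andP[_ c2].
have s4 : fine (P A') * \int[N]_z h z <= fine (P A') * G (x + delta) + eta / 4.
  apply: (le_trans (ler_wpM2l p0 s3)); rewrite mulrDr lerD2l.
  by rewrite ler_piMl// ltW.
lra.
Unshelve. all: by end_near. Qed.

Lemma conditional_cdf_ge (x delta eta : R) : 0 < delta -> 0 < eta ->
  \forall n \near \oo, forall A, measurable A ->
    fine (P (Xc @^-1` A)) * G (x - delta) - eta <=
    fine (P (Xc @^-1` A `&` Z n @^-1` `]-oo, x]%classic)).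
Proof.
move=> d0 eta0; have d20 : 0 < delta / 2 by rewrite divr_gt0.
have e40 : 0 < eta / 4 by rewrite divr_gt0.
have [C [h [h1 [h2 [th h01 hle hge]]]]] := smooth_step (x - delta) d20 e40.
have mh := taylor2_mfun th.
have hb v : `|h v| <= 1 by have /andP[? ?] := h01 v; rewrite ger0_norm.
have cl := close d20 e40; have cv := clt th e40.
near=> n => A mA.
have [B [mB PB hB]] : exists B, [/\ measurable B, (P B <= (eta / 4)%:E)%E &
    forall w, ~ B w -> `|Z n w - V n w| <= delta / 2] by near: n.
have cvA : `|\int[P]_(w in Xc @^-1` A) h (V n w) -
    fine (P (Xc @^-1` A)) * \int[N]_z h z| <= eta / 4.
  by move: A mA; near: n.
have mXA := mpre mXc mA; set A' := Xc @^-1` A in mXA cvA *.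
pose Vx := V n @^-1` `]-oo, (x - delta / 2)%R]%classic.
have mVx : measurable Vx by exact: mpre.
have s1 : fine (P (A' `&` Vx)) <= fine (P (A' `&` Z n @^-1` `]-oo, x]%classic)) + eta / 4.
  apply: fine_le_setU PB _ => //; try by apply: measurableI => //; exact: mpre.
  move=> w [Aw /=]; rewrite in_itv/= => Vx'.
  have [Bw|nBw] := pselect (B w); [by right|left; split=> //=].
  move: Vx'; rewrite /Vx /= in_itv/=; have := hB w nBw.
  by rewrite ler_norml => /andP[? ?]; lra.
have s2 : \int[P]_(w in A') h (V n w) <= fine (P (A' `&` Vx)) + eta / 4.
  rewrite -Rintegral_indic//; apply: (@le_Rintegral_add _ _ _ _ _ _ 1) => //.
  - exact: (measurableT_comp mh).
  - exact: ltW.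
  - move=> w; rewrite indicE; have [|] := boolP (w \in Vx).
      by move=> _; have /andP[_ ?] := h01 (V n w); rewrite (le_trans _ (_ : 1 <= _))// lerDl ltW.
    rewrite notin_setE /Vx /= in_itv/= => /negP; rewrite -ltNge => xz.
    by rewrite add0r; apply: hge; lra.
have s3 : G (x - delta) <= \int[N]_z h z + eta / 4.
  rewrite /G -[X in N X]setTI -Rintegral_indic//.
  apply: (@le_Rintegral_add _ _ _ _ _ _ 1) => //; first exact: ltW.
  move=> z; rewrite indicE; have [|_] := boolP (z \in _); last first.
    by have /andP[? _] := h01 z; rewrite /=; lra.
  rewrite inE /= in_itv/= => /hle; rewrite -lerBlDr.
  exact: le_trans.
have /andP[p0 p1] := fine_prob_le1 mXA.
move: cvA; rewrite ler_norml => /andP[c1 _].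
have s4 : fine (P A') * G (x - delta) <= fine (P A') * \int[N]_z h z + eta / 4.
  apply: (le_trans (ler_wpM2l p0 s3)); rewrite mulrDr lerD2l.
  by rewrite ler_piMl// ltW.
lra.
Unshelve. all: by end_near. Qed.

Hypothesis G_continuous : forall x e : R, 0 < e -> exists2 delta, 0 < delta &
  G (x + delta) <= G x + e /\ G x - e <= G (x - delta).

Variable kappa : nat -> R.-pker R ~> R.
Hypothesis kappa_cond : forall n, (0 < n)%N ->
  is_regular_cond_dist P Xc (Z n) (kappa n).

Let K n x (z : R) : R := fine (kappa n z `]-oo, x]%classic).

Let KE n x z : kappa n z `]-oo, x]%classic = (K n x z)%:E.
Proof.
rewrite fineK// ge0_fin_numE//; apply: (@le_lt_trans _ _ 1%E); last exact: ltry.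
rewrite -(@prob_kernel _ _ _ _ _ (kappa n) z).
by apply: le_measure; rewrite ?inE.
Qed.

Let K01 n x z : 0 <= K n x z <= 1.
Proof.
rewrite -!lee_fin -KE measure_ge0 /= -(@prob_kernel _ _ _ _ _ (kappa n) z).
by apply: le_measure; rewrite ?inE.
Qed.

Let mK n x : measurable_fun setT (K n x).
Proof.
apply/measurable_EFinP; rewrite (_ : EFin \o _ = kappa n ^~ `]-oo, x]%classic).
  exact: measurable_kernel.
by apply/funext => z; rewrite /= -KE.
Qed.

Let mKX n x : measurable_fun setT (fun w => K n x (Xc w)).
Proof. exact: (measurableT_comp (mK n x)). Qed.

Let conditional_cdfE n x A : (0 < n)%N -> measurable A ->
  fine (P (Xc @^-1` A `&` Z n @^-1` `]-oo, x]%classic)) =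
  \int[P]_(w in Xc @^-1` A) K n x (Xc w).
Proof.
move=> n0 mA; rewrite kappa_cond//; congr fine.
by apply: eq_integral => w _; rewrite KE.
Qed.

(** The states where the conditional distribution function exceeds [G x + e] form an admissible [A]:
    the integral over it is at least [(G x + e) P(A)], while the limit bound gives
    [(G x + e / 2) P(A) + eta e / 2], so [P(A) <= eta]. This [A] depends on [n], which is why the
    limit had to be uniform over events. *)
Lemma kernel_cdf_close (x e eta : R) : 0 < e -> 0 < eta ->
  \forall n \near \oo,
    (P [set w | (G x + e < K n x (Xc w))%R] <= eta%:E)%E /\
    (P [set w | (K n x (Xc w) < G x - e)%R] <= eta%:E)%E.
Proof.
move=> e0 eta0; have e20 : 0 < e / 2 by rewrite divr_gt0.
have eta2 : 0 < eta * (e / 2) by rewrite mulr_gt0.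
have [delta d0 [Gle Gge]] := G_continuous x e20.
have up := conditional_cdf_le x d0 eta2; have lo := conditional_cdf_ge x d0 eta2.
near=> n; have n0 : (0 < n)%N by near: n; exact: nbhs_infty_gt.
have upA : forall A, measurable A ->
    fine (P (Xc @^-1` A `&` Z n @^-1` `]-oo, x]%classic)) <=
      fine (P (Xc @^-1` A)) * G (x + delta) + eta * (e / 2) by near: n.
have loA : forall A, measurable A ->
    fine (P (Xc @^-1` A)) * G (x - delta) - eta * (e / 2) <=
    fine (P (Xc @^-1` A `&` Z n @^-1` `]-oo, x]%classic)) by near: n.
have iK A : measurable A -> P.-integrable A (EFin \o (fun w => K n x (Xc w))).
  move=> mA; apply: (integrableS measurableT) => //.
  apply: (@bounded_integrable _ _ _ _ _ 1) => // w.
  by have /andP[? ?] := K01 n x (Xc w); rewrite ger0_norm.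
have ic (c : R) A : measurable A -> P.-integrable A (EFin \o (fun=> c)).
  by move=> mA; apply: (integrableS measurableT) => //; exact: cst_integrable.
have small (A : set R) : measurable A -> fine (P (Xc @^-1` A)) * (e / 2) <= eta * (e / 2) ->
    (P (Xc @^-1` A) <= eta%:E)%E.
  move=> mA; rewrite ler_pM2r// -lee_fin fineK// fin_num_measure//.
  exact: mpre.
split.
- pose A := [set z | G x + e < K n x z].
  have mA : measurable A.
    rewrite (_ : A = K n x @^-1` `](G x + e), +oo[%classic).
      by rewrite -[X in measurable X]setTI; exact: mK.
    by apply/seteqP; split=> z /=; rewrite in_itv/= andbT.
  have mXA := mpre mXc mA; apply: (small _ mA).
  have /andP[p0 _] := fine_prob_le1 mXA.
  have ge : (G x + e) * fine (P (Xc @^-1` A)) <= \int[P]_(w in Xc @^-1` A) K n x (Xc w).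
    rewrite -Rintegral_cst//; apply: le_Rintegral => //; [exact: ic|exact: iK|].
    by move=> w /ltW.
  have := upA _ mA; rewrite conditional_cdfE// => le.
  have := ler_wpM2l p0 Gle; rewrite mulrDr; lra.
- pose A := [set z | K n x z < G x - e].
  have mA : measurable A.
    rewrite (_ : A = K n x @^-1` `]-oo, (G x - e)[%classic).
      by rewrite -[X in measurable X]setTI; exact: mK.
    by apply/seteqP; split=> z /=; rewrite in_itv/=.
  have mXA := mpre mXc mA; apply: (small _ mA).
  have /andP[p0 _] := fine_prob_le1 mXA.
  have ge : \int[P]_(w in Xc @^-1` A) K n x (Xc w) <= (G x - e) * fine (P (Xc @^-1` A)).
    rewrite -Rintegral_cst//; apply: le_Rintegral => //; [exact: iK|exact: ic|].
    by move=> w /ltW.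
  have := loA _ mA; rewrite conditional_cdfE// => le.
  have := ler_wpM2l p0 Gge; rewrite mulrBr; lra.
Unshelve. all: by end_near. Qed.

Lemma measurable_levy_dist_ge n e :
  measurable [set w | e <= levy_dist (kappa n (Xc w)) N].
Proof.
pose C (q x : rat) : set T :=
  [set w | K n (ratr x - ratr q) (Xc w) - ratr q <= G (ratr x)] `&`
  [set w | G (ratr x) <= K n (ratr x + ratr q) (Xc w) + ratr q].
have mC q x : measurable (C q x).
  apply: measurableI.
    rewrite (_ : mkset _ = ((fun w => K n (ratr x - ratr q) (Xc w)) @^-1`
        `]-oo, (G (ratr x) + ratr q)]%classic)); first exact: mpre.
    by apply/seteqP; split=> w /=; rewrite in_itv/= lerBlDr.
  by apply: measurable_set_ge; exact: measurable_funD.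
rewrite (_ : mkset _ = ~` (\bigcup_q ([set _ | (0 : R) < ratr q < e] `&`
    ~` \bigcup_x ~` C q x))).
  apply: measurableC; apply: bigcupT_measurable_rat => q; apply: measurableI.
    have [qe|qe] := boolP ((0 : R) < ratr q < e).
      by rewrite (_ : mkset _ = setT)//; apply/seteqP; split.
    by rewrite (_ : mkset _ = set0)//; apply/seteqP; split.
  by apply: measurableC; apply: bigcupT_measurable_rat => x; exact: measurableC.
have lt_iff w : levy_dist (kappa n (Xc w)) N < e <->
    (\bigcup_q ([set _ | (0 : R) < ratr q < e] `&` ~` \bigcup_x ~` C q x)) w.
  have GE x : N `]-oo, x]%classic = (G x)%:E by rewrite fineK// fin_num_measure.
  have CE q x : C q x w <->
      (kappa n (Xc w) `]-oo, (ratr x - ratr q)%R]%classic - (ratr q)%:E <=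
        N `]-oo, ratr x]%classic)%E /\ (N `]-oo, ratr x]%classic <=
        kappa n (Xc w) `]-oo, (ratr x + ratr q)%R]%classic + (ratr q)%:E)%E.
    by rewrite !KE !GE -!EFinD !lee_fin.
  rewrite levy_dist_lt ?prob_kernel//; last exact: (probability_le1 N).
  split=> [[q q0e hq]|[q _ [q0e hq]]]; exists q => //.
    by split=> // -[x _]; apply; apply/CE; exact: hq.
  by move=> x; apply/CE; apply: contrapT => nC; apply: hq; exists x.
apply/seteqP; split=> w /=.
  by move=> ew /lt_iff; rewrite ltNge ew.
by move=> nw; rewrite leNgt; apply/negP => /lt_iff.
Qed.

Lemma levy_dist_cvg0 (tails : forall e : R, 0 < e -> exists a b : R,
    [/\ a < b, G a <= e & 1 - e <= G b]) (e : R) : 0 < e ->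
  (P [set w | (e <= levy_dist (kappa n (Xc w)) N)%R] @[n --> \oo] --> 0)%E.
Proof.
(* The grid argument yields a weak inequality, so it is run at [e / 2] to end strictly below [e]. *)
move=> e0; pose e' := e / 2; have e'0 : 0 < e' by rewrite divr_gt0.
have e''0 : 0 < e' / 2 by rewrite divr_gt0.
have [a [b [ab Ga Gb]]] := tails _ e''0.
pose M := (Num.truncn ((b - a) / e')).+1.
have bM : b <= a + M%:R * e'.
  have z0 : 0 <= (b - a) / e' by rewrite divr_ge0 ?subr_ge0// ltW.
  have /andP[_ /ltW] := truncn_itv z0; rewrite -/M ler_pdivrMr//; lra.
suff main eta : 0 < eta ->
    \forall n \near \oo, (P [set w | (e <= levy_dist (kappa n (Xc w)) N)%R] <= eta%:E)%E.
  apply/fine_cvgP; split.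
    by apply: nearW => n; rewrite fin_num_measure//; exact: measurable_levy_dist_ge.
  apply/cvgrPdist_le => eta eta0; apply: filterS (main _ eta0) => n.
  rewrite sub0r normrN /= ger0_norm ?fine_ge0// -lee_fin fineK//.
  by rewrite fin_num_measure//; exact: measurable_levy_dist_ge.
move=> eta0; pose x_ (i : nat) := a + i%:R * e'.
(* Two bad events at each of the [M.+1] grid points share the budget [eta]. *)
pose eta' := eta / (2 * M.+1%:R); have eta'0 : 0 < eta' by rewrite divr_gt0// mulr_gt0// ltr0n.
pose U n i := [set w | G (x_ i) + e' / 2 < K n (x_ i) (Xc w)].
pose L n i := [set w | K n (x_ i) (Xc w) < G (x_ i) - e' / 2].
have mU n i : measurable (U n i).
  rewrite /U (_ : mkset _ = (fun w => K n (x_ i) (Xc w)) @^-1`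
      `](G (x_ i) + e' / 2), +oo[%classic); first exact: mpre.
  by apply/seteqP; split=> w /=; rewrite in_itv/= andbT.
have mL n i : measurable (L n i).
  rewrite /L (_ : mkset _ = (fun w => K n (x_ i) (Xc w)) @^-1`
      `]-oo, (G (x_ i) - e' / 2)[%classic); first exact: mpre.
  by apply/seteqP; split=> w /=; rewrite in_itv/=.
have : \forall n \near \oo, forall i : 'I_M.+1,
    (P (U n i) <= eta'%:E)%E /\ (P (L n i) <= eta'%:E)%E.
  by apply: filter_forall => i; exact: kernel_cdf_close.
apply: filterS => n hn.
apply: (@le_trans _ _ (P (\big[setU/set0]_(i < M.+1) (U n i `|` L n i)))).
  apply: le_measure; rewrite ?inE.
  - exact: measurable_levy_dist_ge.
  - by apply: bigsetU_measurable => i _; exact: measurableU.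
  rewrite -(bigcup_mkord M.+1 (fun i => U n i `|` L n i)).
  move=> w /= ew; apply: contrapT => nUL.
  suff : levy_dist (kappa n (Xc w)) N <= e' by move: ew; rewrite /e'; lra.
  have GE x : N `]-oo, x]%classic = (G x)%:E by rewrite fineK// fin_num_measure.
  have Na : (N `]-oo, a]%classic <= (e' / 2)%:E)%E by rewrite GE lee_fin.
  have Nb : ((1 - e' / 2)%:E <= N `]-oo, (a + M%:R * e')%R]%classic)%E.
    by rewrite GE lee_fin (le_trans Gb)// -lee_fin -!GE (measure_itv_le N).
  have grid i : (i <= M)%N ->
      (kappa n (Xc w) `]-oo, x_ i]%classic <= N `]-oo, x_ i]%classic + (e' / 2)%:E)%E /\
      (N `]-oo, x_ i]%classic <= kappa n (Xc w) `]-oo, x_ i]%classic + (e' / 2)%:E)%E.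
    move=> iM; rewrite KE GE -!EFinD !lee_fin.
    split; rewrite leNgt; apply/negP => h; apply: nUL; exists i => //=.
      by left; rewrite /U /=; lra.
    by right; rewrite /L /=; lra.
  apply: (@levy_dist_grid _ _ _ _ _ e' a M) => //.
  - by rewrite prob_kernel.
  - exact: (probability_le1 N).
have mUL i : (i < M.+1)%N -> measurable (U n i `|` L n i).
  by move=> _; exact: measurableU.
apply: le_trans (Boole_inequality P mUL) _.
apply: (@le_trans _ _ (\sum_(i < M.+1) (2 * eta')%:E)%E).
  apply: lee_sum => i _; have [hU hL] := hn i.
  apply: le_trans (measureU2 _ (mU n i) (mL n i)) _.
  by rewrite mulr_natl mulr2n EFinD leeD.
rewrite sumEFin lee_fin sumr_const card_ord -[_ *+ M.+1]mulr_natr.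
rewrite /eta' le_eqVlt; apply/orP; left; apply/eqP; field.
by rewrite addrC natr1 pnatr_eq0.
Qed.

End conditional_limit.

(** * The truncated second moment of the first block *)

Section truncated_block.
Context d (T : measurableType d) (R : realType) (P : probability T R).
Variables (nu : probability R R) (p : R -> R).
Variables (W : int -> {RV P >-> R}) (xi : nat -> {RV P >-> bool}) (g : R -> R).
Hypothesis hp_meas : measurable_fun [set: R] p.
Hypothesis hp : forall x, 0 < p x < 1.
Hypothesis hxi : jump_indicators p nu W xi.
Hypothesis mg : measurable_fun setT g.

(** The two variables agree on good paths; elsewhere they may differ, as [block] subtracts jump
    times in the reals and the gap in the naturals. *)
Lemma truncated_second_moment_block :
  truncated_second_moment P (block W xi g 1) =
  truncated_second_moment P (block_value W xi (block_term g) 0).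
Proof.
have mb : measurable_fun setT (block W xi g 1).
  apply: measurable_funM.
    by apply: measurable_funB; exact: measurable_jump_time.
  exact: (measurableT_comp mg (measurable_mark W xi 0)).
have mX : measurable_fun setT (block_value W xi (block_term g) 0).
  by apply: measurable_block_value => k; exact: measurable_block_term.
have mt (X : T -> R) y : measurable_fun setT X ->
    measurable_fun setT (EFin \o (fun w => if `|X w| <= y then X w ^+ 2 else 0)).
  move=> mX'; apply/measurable_EFinP; apply: measurable_fun_ifT => //.
    by apply: measurable_fun_ler => //; exact: measurableT_comp.
  exact: measurable_funX.
apply/funext => y; rewrite !truncated_second_momentE// /Rintegral; congr fine.
apply: ae_eq_integral => //; [exact: mt|exact: mt|].
apply: filterS (good_ae hp_meas hp hxi) => w gw _ /=.
by rewrite (blockE _ _ gw).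
Qed.

End truncated_block.

Lemma finite_norm2_integrable (R : realType) (mu : probability R R) (g : R -> R) :
  measurable_fun setT g -> finite_norm mu 2%:E g -> mu.-integrable setT (EFin \o g).
Proof.
move=> mg g2; apply/Lfun1_integrable; apply: Lfun_subset12.
  exact: fin_num_measure.
by rewrite inE; apply/andP; split; rewrite inE.
Qed.

Theorem proposition4 (R : realType) (d : measure_display)
  (T : measurableType d) (P : probability T R)
  (nu : probability R R) (p : R -> R)
  (hp_meas : measurable_fun [set: R] p)
  (hp : forall x, 0 < p x < 1)
  (theta : R)
  (htheta : (\int[nu]_x ((1 - p x)^-1)%:E = theta%:E)%E)
  (mu : probability R R)
  (hmu : forall B : set R, measurable B ->
    mu B = (\int[nu]_(x in B) ((theta * (1 - p x))^-1)%:E)%E)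
  (W : int -> {RV P >-> R}) (xi : nat -> {RV P >-> bool})
  (hW : stationary_markov_chain (transition p nu) mu W)
  (hxi : jump_indicators p nu W xi)
  (g : R -> R)
  (hg_meas : measurable_fun [set: R] g)
  (hg_L2 : finite_norm mu 2%:E g)
  (hg_mean : (\int[mu]_x (g x)%:E = 0)%E)
  (hH : slowly_varying (truncated_second_moment P (block W xi g 1)))
  (gamma : nat -> R)
  (hgamma_pos : forall m, (0 < m)%N -> 0 < gamma m)
  (hgamma_infty : gamma m @[m --> \oo] --> +oo)
  (hgamma : asymp_equiv (fun m => gamma m ^+ 2)
    (fun m => m%:R * truncated_second_moment P (block W xi g 1) (gamma m))) :
  cond_dist_cvg_in_prob P (W 0)
    (fun n w => partial_sum W g n w / gamma n)
    (normal_prob 0 (Num.sqrt theta^-1)).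
Proof.
move=> kappa kappa_cond e e0.
have ig := finite_norm2_integrable hg_meas hg_L2.
rewrite (truncated_second_moment_block hp_meas hp hxi hg_meas) in hH hgamma.
have theta0 : 0 < theta := lt_le_trans ltr01 (mean_gap_ge1 hp_meas hp htheta).
have v0 : 0 < theta^-1 by rewrite invr_gt0.
have s0 : 0 < Num.sqrt theta^-1 by rewrite sqrtr_gt0.
(* As a set function [N] coincides with the [normal_prob] of the goal; only the measurable structure
   attached to the line differs. *)
pose N := normal_law (Num.sqrt theta^-1).
have iidY := iid_blocks hp_meas hp hxi ig.
have mW n : measurable_fun setT (W n) by exact: measurable_funP.
pose V n w := (\sum_(i < Num.truncn (theta^-1 * n%:R))
  block_value W xi (block_term g) i w) / gamma n.
apply: (@levy_dist_cvg0 _ _ _ P (W 0) (fun n w => partial_sum W g n w / gamma n) V N) => //.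
- move=> n; apply: measurable_funM => //; apply: measurable_sum => k.
  exact: (measurableT_comp hg_meas).
- move=> n; apply: measurable_funM => //; apply: measurable_sum => k.
  exact: iid_mfun iidY k.
- move=> delta eta delta0 eta0.
  exact: (partial_sum_approximation hp_meas hp htheta hmu hxi ig hg_mean hH hgamma_pos
    hgamma_infty hgamma delta0 eta0).
- move=> C h h1 h2 th eps eps0.
  have := normal_approximation iidY (block_integrable hp_meas hp htheta hmu hxi ig)
    (block_centered hp_meas hp htheta hmu hxi ig hg_mean) hH hgamma_pos hgamma_infty
    hgamma v0 th eps0.
  apply: filterS => n close A mA; apply: close.
  apply: chain0_block.
  exact: sub_measurable_chain.
- by move=> x eps eps0; have [del del0 hdel] := normal_cdf_continuous s0 eps0; exists del.
- move=> eps eps0; have [a [b [ab Na Nb]]] := normal_cdf_tails (Num.sqrt theta^-1) eps0.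
  exists a, b; split=> //; first by rewrite -lee_fin fineK ?fin_num_measure.
  by rewrite -lee_fin fineK ?fin_num_measure.
Qed.
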